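(* Let $n$ be a positive even integer, $\lambda$ a positive integer, and $\mathcal{T}=[T_1^{\langle\beta_1\rangle},\ldots,T_s^{\langle\beta_s\rangle}]$ an admissible bipartite 2-factorization type for $\lambda K_n$, with each $T_i$ an admissible bipartite 2-factor type for $K_n$. Suppose there exists a refinement $[\alpha_1,\ldots,\alpha_k]$ of $[\beta_1,\ldots,\beta_s]$ such that one of the following holds: (i) $n\equiv 2\pmod 4$ and $|\{i:\alpha_i\text{ is odd}\}|\le\lfloor\lambda/2\rfloor$; or (ii) $n\equiv 0\pmod 4$, $|\{i:\alpha_i\text{ is odd}\}|\le\lambda+\lfloor\lambda/2\rfloor$, and $|\{i:\alpha_i\text{ is odd},\ \alpha_i\ge 3\}|\ge\lambda$. Then $\lambda K_n$ admits a 2-factorization of type $\mathcal{T}$.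
   Context: $\lambda K_n$: complete multigraph on $n$ vertices with $\lambda$ parallel edges per pair. A 2-factor has type $[c_1,\ldots,c_t]$ if it is a disjoint union of cycles of lengths $c_1,\ldots,c_t$; a type is bipartite if all entries are even; a 2-factor type is admissible for $K_n$ iff its entries are integers $\ge3$ summing to $n$, and for $\lambda K_n$ with $\lambda\ge2$ iff entries are $\ge2$ summing to $n$. A 2-factorization of an $r$-regular graph is a decomposition into $\lfloor r/2\rfloor$ 2-factors plus a single 1-factor if $r$ is odd; its type is the multiset of types of its 2-factors. A 2-factorization type for an $r$-regular graph is admissible if it consists of $\lfloor r/2\rfloor$ admissible 2-factor types, and bipartite if all of them are bipartite. $[T^{\langle a\rangle}]$ denotes $a$ copies of $T$. A multiset $[y_1,\ldots,y_t]$ of positive integers is a refinement of $[x_1,\ldots,x_s]$ if $\{1,\ldots,t\}$ can be partitioned into sets $P_1,\ldots,P_s$ with $\sum_{j\in P_i}y_j=x_i$ for all $i$. *)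

(* Defs.v *)
From mathcomp Require Import all_boot.

Set Implicit Arguments.
Unset Strict Implicit.
Unset Printing Implicit Defensive.

(* Multisets are represented by sequences: no definition below depends on the
   order of the entries. *)

(* Finite loopless multigraphs; parallel edges are distinct edges with the same
   set of endpoints. *)
Record mgraph := MGraph {
  vertex : finType;
  edge : finType;
  ends : edge -> {set vertex};
  card_ends : forall e, #|ends e| == 2
}.

Definition complete_mgraph (lam n : nat) : mgraph :=
  @MGraph 'I_n ({e : {set 'I_n} | #|e| == 2} * 'I_lam)%type
    (fun e => val e.1) (fun e => valP e.1).

Section Factors.
Variable G : mgraph.
Implicit Types (F J : {set edge G}) (T : seq nat) (TT : seq (seq nat)).

Definition degree F (v : vertex G) := #|[set e in F | v \in ends e]|.

Definition regular r := [forall v, degree setT v == r].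

(* A spanning subgraph is identified with its set of edges. *)
Definition is_factor k F := [forall v, degree F v == k].

(* [vs] lists the vertices and [es] the edges of a cycle, the i-th edge joining
   the i-th vertex to the cyclically following one. A cycle of length 2 is a
   pair of parallel edges. *)
Definition is_cycle (c : seq (vertex G) * seq (edge G)) :=
  let: (vs, es) := c in
  [&& 2 <= size vs, uniq vs, uniq es &
      all2 (fun v e => ends e == [set v; next vs v]) vs es].

(* The [perm_eq] on vertices says both that the cycles are vertex-disjoint and
   that they span. *)
Definition has_type F T :=
  exists cs : seq (seq (vertex G) * seq (edge G)),
    [/\ all is_cycle cs,
        perm_eq [seq size c.1 | c <- cs] T,
        perm_eq (flatten [seq c.1 | c <- cs]) (enum (vertex G)) &
        F = [set e in flatten [seq c.2 | c <- cs]]].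

Definition has_2factorization TT :=
  exists r, [/\ regular r, size TT = r./2 &
    exists (F : 'I_(size TT) -> {set edge G}) (J : {set edge G}),
      [/\ forall i, is_factor 2 (F i) /\ has_type (F i) (nth [::] TT i),
          if odd r then is_factor 1 J else J == set0 &
          forall e, \sum_i (e \in F i) + (e \in J) = 1]].

End Factors.

Definition admissible_2factor_type (lam n : nat) (T : seq nat) :=
  all (leq (if lam == 1 then 3 else 2)) T && (sumn T == n).

Definition bipartite_2factor_type (T : seq nat) := all (predC odd) T.

(* lam * n.-1 is the degree of the vertices of the complete multigraph. *)
Definition admissible_2factorization_type (lam n : nat) (TT : seq (seq nat)) :=
  (size TT == (lam * n.-1)./2) && all (admissible_2factor_type lam n) TT.

Definition bipartite_2factorization_type (TT : seq (seq nat)) :=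
  all bipartite_2factor_type TT.

Definition repeat_types (s : nat) (T : 'I_s -> seq nat) (beta : 'I_s -> nat) :=
  flatten [seq nseq (beta i) (T i) | i <- enum 'I_s].

(* The multiset [y] is a refinement of the multiset [x]. *)
Definition refinement (y x : seq nat) :=
  [/\ all (leq 1) y, all (leq 1) x &
    exists P : 'I_(size x) -> {set 'I_(size y)},
      (forall j, exists! i, j \in P i) /\
      (forall i, \sum_(j in P i) nth 0 y j = nth 0 x i)].

(* Main.v *)
Require Import Defs.
From mathcomp Require Import all_boot.
From mathcomp Require Import zify ring.

Set Implicit Arguments.
Unset Strict Implicit.
Unset Printing Implicit Defensive.

(** Consider first one layer [K_n], [n = 2m], obtained from [K_m] by
    replacing every vertex by two twins. By Haggkvist's lemma the doubling [C[2]]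
    of a Hamilton cycle [C] of [K_m] splits into two 2-factors of any given
    bipartite type. For [m] odd, [K_m] splits into Hamilton cycles (Walecki), hence
    [K_n] splits into pairs of 2-factors of equal type and the 1-factor of the
    twins. For [m] even, [K_m] splits into Hamilton cycles and a cubic graph, a
    ladder closed up at its ends; the doubled ladder with its twin edges splits
    into three 2-factors of any given bipartite type and a 1-factor. To see this,
    attach the columns of the ladder one by one: the ends of the open paths of the
    three factors in the last column are the states of a finite automaton, and
    finitely many tables of edge labels lead from state to state while closing
    cycles of the prescribed lengths, long cycles being obtained by repeating a
    column. This accounts for the [alpha_i]: even ones give pairs, [lambda] odd ones that
    are at least 3 give a triple in each layer when [n] is divisible by 4, and the
    remaining odd ones give single 2-factors, each of which is the union of the
    left-over 1-factors of two layers, after relabelling these layers. *)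

(** For m even, Hamilton cycles leave at best a perfect matching of K_m; doubled and taken with the
    twin edges it is a union of copies of K_4, which carry no cycle longer than 4. One Hamilton
    cycle is therefore kept with the matching, which gives the cubic graph; it accounts for three
    2-factors, hence for the triples.

    The numerical conditions are a count. The lambda layers leave lambda 1-factors, which serve
    floor(lambda/2) single 2-factors, and one of them survives if lambda is odd. Two of them can
    form any 2-factor with even cycles: it is the union of two perfect matchings, and a permutation
    of the vertices of one copy of K_n carries its left-over 1-factor to any perfect matching. When
    there are fewer singles, pairs of equal types are broken up.

    A state forgets the closed cycles and the inner vertices of the open paths, and keeps lengths as
    linear forms. Its main interfaces leave fixed numbers of vertices open and a column has 4, so
    cycles are passed in groups of total length divisible by 4: one cycle, or two of lengths 2 mod
    4. A type whose sum is divisible by 4 has an even number of the latter. *)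

Section Adjacency.
Variable T : eqType.
Implicit Types (p c : seq T) (x y : T).

(** * Adjacency on paths and on cycles *)

Definition padj p x y := exists p1 p2, p = p1 ++ [:: x, y & p2].
Definition pedge p x y := padj p x y \/ padj p y x.
Definition cadj c x y := exists i s, rot i c = [:: x, y & s].
Definition cedge c x y := cadj c x y \/ cadj c y x.

Lemma pedgeC p x y : pedge p x y -> pedge p y x.
Proof. by case; [right|left]. Qed.

Lemma cedgeC c x y : cedge c x y -> cedge c y x.
Proof. by case; [right|left]. Qed.

Lemma padj_catl p q x y : padj p x y -> padj (p ++ q) x y.
Proof. by case=> p1 [p2 ->]; exists p1, (p2 ++ q); rewrite -catA. Qed.

Lemma padj_catr p q x y : padj q x y -> padj (p ++ q) x y.
Proof. by case=> p1 [p2 ->]; exists (p ++ p1), p2; rewrite catA. Qed.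

Lemma padj_rev p x y : padj p x y -> padj (rev p) y x.
Proof.
case=> p1 [p2 ->]; exists (rev p2), (rev p1).
by rewrite rev_cat !rev_cons -!cats1 -!catA.
Qed.

Lemma pedge_catl p q x y : pedge p x y -> pedge (p ++ q) x y.
Proof. by case=> H; [left|right]; apply: padj_catl. Qed.

Lemma pedge_catr p q x y : pedge q x y -> pedge (p ++ q) x y.
Proof. by case=> H; [left|right]; apply: padj_catr. Qed.

Lemma pedge_rev p x y : pedge p x y -> pedge (rev p) x y.
Proof. by case=> H; [right|left]; apply: padj_rev. Qed.

Lemma pedge_junction p q x y : pedge (rcons p x ++ y :: q) x y.
Proof. by left; exists p, q; rewrite -cats1 -catA. Qed.

Lemma cadj_path p x y : padj p x y -> cadj p x y.
Proof.
case=> p1 [p2 ->]; exists (size p1), (p2 ++ p1).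
by rewrite rot_size_cat.
Qed.

Lemma cedge_path p x y : pedge p x y -> cedge p x y.
Proof. by case=> H; [left|right]; apply: cadj_path. Qed.

Lemma cadj_close p x y : cadj (y :: rcons p x) x y.
Proof.
exists (size (y :: p)), p.
by rewrite -rcons_cons -cats1 rot_size_cat.
Qed.

Lemma cedge_close p x y : cedge (y :: rcons p x) x y.
Proof. by left; apply: cadj_close. Qed.

Lemma cadj_next c x y : uniq c -> cadj c x y -> [/\ x \in c, y \in c & next c x = y].
Proof.
move=> Uc [i [s E]].
have [Hx Hy]: x \in rot i c /\ y \in rot i c by rewrite E !inE !eqxx orbT.
split; rewrite -1?(mem_rot i) //.
by rewrite -(next_rot i Uc) E /= eqxx.
Qed.

End Adjacency.

Lemma cedge_map (T U : eqType) (f : T -> U) c x y :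
  cedge c x y -> cedge (map f c) (f x) (f y).
Proof.
have H a b : cadj c a b -> cadj (map f c) (f a) (f b).
  by case=> i [s E]; exists i, (map f s); rewrite -map_rot E.
by case=> /H; [left|right].
Qed.

(* A factor under construction: closed cycles and open paths. *)
Definition partial := (seq (seq nat) * seq (seq nat))%type.

Definition spans n (f : partial) := perm_eq (flatten f.1 ++ flatten f.2) (iota 0 n).

Definition joined (f : partial) x y :=
  (exists2 c, c \in f.1 & cedge c x y) \/ (exists2 p, p \in f.2 & pedge p x y).

(* The coefficients of a linear form; the variables always take the values
   [1; i; j; h], so that the first coefficient is a constant term. *)
Definition form := seq nat.

Fixpoint fadd (f g : form) : form :=
  match f, g with
  | [::], _ => g
  | _, [::] => f
  | a :: f', b :: g' => a + b :: fadd f' g'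
  end.

Fixpoint fval (r : seq nat) (f : form) {struct f} : nat :=
  if f is a :: f' then if r is x :: r' then a * x + fval r' f' else 0 else 0.

Lemma fval_add r f g : fval r (fadd f g) = fval r f + fval r g.
Proof.
elim: f r g => [|a f IH] r [|b g]; case: r => [|x r] //=; rewrite ?addn0 //.
by rewrite IH mulnDl addnACA.
Qed.

(** Trailing zero coefficients are dropped, so that equal linear forms become equal lists. *)
Definition trim (f : form) : form :=
  foldr (fun a s => if (a == 0) && nilp s then [::] else a :: s) [::] f.

Lemma fval_trim r f : fval r (trim f) = fval r f.
Proof.
elim: f r => [|a f IH] r //=; case: ifP => [/andP[/eqP-> /nilP E]|_].
  by case: r => //= x r; have := IH r; rewrite E => <-.
by case: r => //= x r; rewrite -[in RHS]IH.
Qed.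

(* An open path is known by its end slots and its number of vertices, a factor
   by its open paths and the lengths of its closed cycles, and a state by the
   slots still unmatched by the 1-factor and its factors. *)
Definition opath := (nat * nat * form)%type.
Definition fstate := (seq opath * seq form)%type.
Definition state := (seq nat * seq fstate)%type.

(** * Realization of symbolic factors by cycles and paths *)

Section Realization.
Variable (phi : nat -> nat) (r : seq nat).

(** The two ends are an unordered pair: the list may be stored in either direction, and joining two
    paths reverses one where required. *)
Definition pathrep (a : opath) (p : seq nat) :=
  [/\ size p = fval r a.2, p != [::] &
      (head 0 p = phi a.1.1 /\ last 0 p = phi a.1.2) \/
      (head 0 p = phi a.1.2 /\ last 0 p = phi a.1.1)].

Fixpoint pathreps (A : seq opath) (ps : seq (seq nat)) : Prop :=
  match A, ps with
  | [::], [::] => True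
  | a :: A', p :: ps' => pathrep a p /\ pathreps A' ps'
  | _, _ => False
  end.

(** [B] holds the lengths of closed cycles that have been erased from the symbolic factor. This lets
    a state return to one of finitely many interfaces whatever has been closed before. *)
Definition realizes n (B : seq nat) (F : fstate) (f : partial) :=
  [/\ spans n f, pathreps F.1 f.2 & perm_eq (map size f.1) (B ++ map (fval r) F.2)].

Fixpoint realizes_all n (Bs : seq (seq nat)) (Fs : seq fstate) (fs : seq partial) :=
  match Bs, Fs, fs with
  | [::], [::], [::] => True
  | B :: Bs', F :: Fs', f :: fs' => realizes n B F f /\ realizes_all n Bs' Fs' fs'
  | _, _, _ => False
  end.

Fixpoint take_end (u : nat) (A : seq opath) : option (nat * form * seq opath) :=
  if A is (a, b, l) :: A' then
    if a == u then Some (b, l, A') else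
    if b == u then Some (a, l, A') else
    if take_end u A' is Some (x, m, R) then Some (x, m, (a, b, l) :: R) else None
  else None.

Definition link (u v : nat) (F : fstate) : option fstate :=
  if u == v then None else
  if take_end u F.1 is Some (x, l, R) then
    if x == v then Some (R, l :: F.2)
    else if take_end v R is Some (y, m, R') then Some ((x, y, fadd l m) :: R', F.2)
    else None
  else None.

Lemma take_endP u A ps x l R : pathreps A ps -> take_end u A = Some (x, l, R) ->
  exists p ps', [/\ pathreps R ps',
    [/\ size p = fval r l, p != [::], head 0 p = phi x & last 0 p = phi u],
    perm_eq (flatten ps) (p ++ flatten ps') &
    forall a b, (exists2 q, q \in ps & pedge q a b) ->
      pedge p a b \/ exists2 q, q \in ps' & pedge q a b].
Proof.
elim: A ps x l R => [|[[a b] m] A IH] [|p ps] x l R //= [[Hs Hn He] HA].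
have base z k : pathrep (z, k, m) p -> k = u ->
  exists p0 ps', [/\ pathreps A ps',
    [/\ size p0 = fval r m, p0 != [::], head 0 p0 = phi z & last 0 p0 = phi u],
    perm_eq (p ++ flatten ps) (p0 ++ flatten ps') &
    forall a b, (exists2 q, q \in p :: ps & pedge q a b) ->
      pedge p0 a b \/ exists2 q, q \in ps' & pedge q a b].
  case=> /= Hs' Hn' [[H1 H2]|[H1 H2]] E; subst k.
    exists p, ps; split=> // i j [q]; rewrite inE => /orP[/eqP->|Hq] Hij; first by left.
    by right; exists q.
  exists (rev p), ps; split=> //.
  - split; rewrite ?size_rev //.
    + by rewrite -size_eq0 size_rev size_eq0.
    + by rewrite -H2; case: (lastP p) Hn' => // s z0 _; rewrite rev_rcons last_rcons.
    + by rewrite -H1; case: (p) Hn' => // z0 s _; rewrite rev_cons last_rcons.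
  - by rewrite perm_cat2r perm_sym perm_rev.
  - move=> i j [q]; rewrite inE => /orP[/eqP->|Hq] Hij; first by left; apply: pedge_rev.
    by right; exists q.
case: eqP => [Ea [<- <- <-]|_].
  by apply: (base b a) => //; split=> //=; case: He; [right|left].
case: eqP => [Eb [<- <- <-]|_].
  by apply: (base a b).
case E: (take_end u A) => [[[x' m'] R']|] // [<- <- <-].
have [q [ps' [H1 H2 H3 H4]]] := IH _ _ _ _ HA E.
exists q, (p :: ps'); split=> //=.
- by rewrite perm_sym perm_catCA perm_cat2l perm_sym.
- move=> i j [s]; rewrite inE => /orP[/eqP->|Hs'] Hij.
    by right; exists p; rewrite ?mem_head.
  have [|[t Ht Htij]] := H4 i j (ex_intro2 _ _ s Hs' Hij); first by left.
  by right; exists t; rewrite // inE Ht orbT.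
Qed.

(** Distinct slots could name the same vertex; the hypothesis on [phi] excludes that a path of a
    single vertex is closed to a cycle. *)
Lemma link_realizes n B F f u v F' : phi u != phi v ->
  realizes n B F f -> link u v F = Some F' ->
  exists f', [/\ realizes n B F' f', forall x y, joined f x y -> joined f' x y &
    joined f' (phi u) (phi v)].
Proof.
move=> Duv; case: F f => A C [cs ps] [/= Hsp HA HC]; rewrite /link /=; case: eqP => // Huv.
case E: (take_end u A) => [[[x l] R]|] //.
have [p [ps' [H1 [Hsz Hn Hh Hl] Hperm Hadj]]] := take_endP HA E.
case: eqP => [Ex [<-]|Hxv].
  exists (p :: cs, ps'); split.
  - split=> //=.
      apply: perm_trans Hsp; rewrite /= -catA perm_catCA perm_cat2l perm_sym.
      exact: Hperm.
    by rewrite Hsz perm_sym -cat1s perm_catCA /= perm_cons perm_sym.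
  - move=> a b [[c Hc Hab]|Hab]; first by left; exists c; rewrite // inE Hc orbT.
    have [Hp|[q Hq Hqab]] := Hadj a b Hab; last by right; exists q.
    by left; exists p; [exact: mem_head|exact: cedge_path].
  - left; exists p; first exact: mem_head.
    rewrite -Hl -Ex -Hh; case: (p) Hn Hh Hl => //= z s _ Hz.
    case/lastP: s => [|s w] /= Hw; first by move: Duv; rewrite -Hw -Ex -Hz eqxx.
    by rewrite last_rcons; apply: cedge_close.
case E2: (take_end v R) => [[[y m] R']|] // [<-].
have [q [ps2 [K1 [Ksz Kn Kh Kl] Kperm Kadj]]] := take_endP H1 E2.
exists (cs, (p ++ rev q) :: ps2); split.
- split=> //=.
    apply: perm_trans Hsp; rewrite /= perm_cat2l perm_sym (permPl Hperm) -catA perm_cat2l.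
    by rewrite (permPl Kperm) perm_cat2r perm_sym perm_rev.
  split=> //; split=> /=.
  + by rewrite size_cat size_rev fval_add Hsz Ksz.
  + by case: (p) Hn.
  + left; rewrite last_cat; split; first by case: (p) Hn Hh.
    by case: (q) Kn Kh => //= z s _ <-; rewrite rev_cons last_rcons.
- move=> a b [[c Hc Hab]|Hab]; first by left; exists c.
  have [Hp|Hq] := Hadj a b Hab.
    by right; exists (p ++ rev q); [exact: mem_head|exact: pedge_catl].
  have [Hp|[t Ht Htab]] := Kadj a b Hq.
    right; exists (p ++ rev q); [exact: mem_head|].
    by apply: pedge_catr; apply: pedge_rev.
  by right; exists t; rewrite // inE Ht orbT.
- right; exists (p ++ rev q); first exact: mem_head.
  have ->: p = rcons (belast (head 0 p) (behead p)) (phi u).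
    by rewrite -Hl; case: (p) Hn => //= z s _; rewrite -lastI.
  have ->: rev q = phi v :: rev (belast (head 0 q) (behead q)).
    by rewrite -Kl; case: (q) Kn => //= z s _; rewrite -rev_rcons -lastI.
  exact: pedge_junction.
Qed.

End Realization.

(** * Placing labelled edges in a symbolic state *)

Fixpoint apply_nth (A : Type) k (g : A -> option A) (s : seq A) : option (seq A) :=
  match s, k with
  | [::], _ => None
  | x :: s', 0 => if g x is Some y then Some (y :: s') else None
  | x :: s', k'.+1 => if apply_nth k' g s' is Some t then Some (x :: t) else None
  end.

Definition labelled := (nat * nat * nat)%type.

(* Label 0 puts the edge in the 1-factor, label k.+1 in the k-th 2-factor. *)
Definition place (e : labelled) (S : state) : option state :=
  let: (u, v, k) := e in
  if k is k'.+1 then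
    if apply_nth k' (link u v) S.2 is Some Fs then Some (S.1, Fs) else None
  else if [&& u != v, u \in S.1 & v \in S.1] then Some (rem v (rem u S.1), S.2)
  else None.

Fixpoint place_all (es : seq labelled) (S : state) : option state :=
  if es is e :: es' then
    if place e S is Some S' then place_all es' S' else None
  else Some S.

(** [M] is a perfect matching on the vertices below [n] when this list is a permutation of
    [iota 0 n]. *)
Definition pairs_of (M : seq (nat * nat)) := flatten [seq [:: e.1; e.2] | e <- M].

Definition covered (M : seq (nat * nat)) (fs : seq partial) x y :=
  [\/ (x, y) \in M, (y, x) \in M | exists2 f, f \in fs & joined f x y].

(** The slots [S.1] name the vertices that the 1-factor still misses, and [C] is a set of pairs
    already covered by the 1-factor or by a 2-factor; nothing is said about pairs covered twice. *)
Definition represents phi r n Bs (S : state) (C : nat -> nat -> Prop) :=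
  exists M fs,
    [/\ perm_eq (pairs_of M ++ map phi S.1) (iota 0 n),
        realizes_all phi r n Bs S.2 fs &
        forall x y, C x y -> covered M fs x y].

Lemma joinedC f x y : joined f x y -> joined f y x.
Proof.
by case=> [] [c Hc H]; [left; exists c => //; apply: cedgeC|
  right; exists c => //; apply: pedgeC].
Qed.

Lemma coveredC M fs x y : covered M fs x y -> covered M fs y x.
Proof.
case=> [H|H|[f Hf H]]; [by apply: Or32|by apply: Or31|apply: Or33; exists f => //].
exact: joinedC.
Qed.

Lemma apply_link_realizes phi r n Bs Fs fs k u v Fs' : phi u != phi v ->
  realizes_all phi r n Bs Fs fs -> apply_nth k (link u v) Fs = Some Fs' ->
  exists fs', [/\ realizes_all phi r n Bs Fs' fs',
    forall x y, (exists2 f, f \in fs & joined f x y) ->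
      exists2 f, f \in fs' & joined f x y &
    exists2 f, f \in fs' & joined f (phi u) (phi v)].
Proof.
move=> D; elim: Fs Bs fs k Fs' => [|F Fs IH] [|B Bs] [|f fs] [|k] Fs' //= [HF HFs].
  case E: (link u v F) => [F'|] // [<-].
  have [f' [H1 H2 H3]] := link_realizes D HF E.
  exists (f' :: fs); split=> //; last by exists f'; rewrite ?mem_head.
  move=> x y [g]; rewrite inE => /orP[/eqP->|Hg] Hxy.
    by exists f'; [exact: mem_head|exact: H2].
  by exists g; rewrite // inE Hg orbT.
case E: (apply_nth k _ Fs) => [Gs|] // [<-].
have [gs [H1 H2 [g Hg Hguv]]] := IH _ _ _ _ HFs E.
exists (f :: gs); split=> //; last by exists g; rewrite // inE Hg orbT.
move=> x y [h]; rewrite inE => /orP[/eqP->|Hh] Hxy.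
  by exists f; rewrite ?mem_head.
have [h' Hh' Hh'xy] := H2 x y (ex_intro2 _ _ h Hh Hxy).
by exists h'; rewrite // inE Hh' orbT.
Qed.

Lemma place_represents phi r n Bs S C e S' : phi e.1.1 != phi e.1.2 ->
  represents phi r n Bs S C -> place e S = Some S' ->
  represents phi r n Bs S'
    (fun x y => C x y \/ (x, y) = (phi e.1.1, phi e.1.2)).
Proof.
case: e S => [[u v] [|k]] [J Fs] /= D [M [fs [/= HM Hfs HC]]].
  case: and3P => // -[Huv Hu Hv] [<-].
  exists ((phi u, phi v) :: M), fs; split=> //=.
    apply: perm_trans HM; rewrite -[_ :: _ :: _]/([:: phi u; phi v] ++ _) perm_catCA.
    rewrite perm_cat2l perm_sym; apply: (perm_map phi (t := [:: u, v & rem v (rem u J)])).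
    rewrite (permPl (perm_to_rem Hu)) perm_cons; apply: perm_to_rem.
    by apply: rem_mem; rewrite // eq_sym.
  move=> x y [/HC|[-> ->]]; last by apply: Or31; rewrite mem_head.
  case=> [H|H|H]; [apply: Or31|apply: Or32|exact: Or33]; by rewrite inE H orbT.
case E: (apply_nth k _ Fs) => [Gs|] // [<-].
have [gs [H1 H2 H3]] := apply_link_realizes D Hfs E.
exists M, gs; split=> // x y [/HC|[-> ->]]; last exact: Or33.
by case=> [H|H|H]; [apply: Or31|apply: Or32|apply: Or33; apply: H2].
Qed.

Lemma represents_sub phi r n Bs S (C C' : nat -> nat -> Prop) :
  (forall x y, C' x y -> C x y) -> represents phi r n Bs S C ->
  represents phi r n Bs S C'.
Proof. by move=> H [M [fs [H1 H2 H3]]]; exists M, fs; split=> // x y /H /H3. Qed.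

Lemma place_all_represents phi r n Bs es S C S' :
  {in es, forall e, phi e.1.1 != phi e.1.2} ->
  represents phi r n Bs S C -> place_all es S = Some S' ->
  represents phi r n Bs S'
    (fun x y => C x y \/ exists2 e, e \in es & (x, y) = (phi e.1.1, phi e.1.2)).
Proof.
elim: es S C => [|e es IH] S C D HS /=.
  by move=> [<-]; apply: represents_sub HS => x y [|[]].
case E: (place e S) => [S1|] // HS'.
have D' : {in es, forall d, phi d.1.1 != phi d.1.2}.
  by move=> d Hd; apply: D; rewrite inE Hd orbT.
have H := IH S1 _ D' (place_represents (D e (mem_head _ _)) HS E) HS'.
apply: represents_sub H => x y [H|[d]]; first by left; left.
by rewrite inE => /orP[/eqP->|Hd] H; [left; right|right; exists d].
Qed.

Lemma pathreps_cat phi r A A' ps ps' :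
  pathreps phi r A ps -> pathreps phi r A' ps' ->
  pathreps phi r (A ++ A') (ps ++ ps').
Proof. by elim: A ps => [|a A IH] [|p ps] //= [H1 H2] H3; split=> //; apply: IH. Qed.

(** * New vertices, renaming of slots, normal forms *)

Definition singles (ss : seq nat) : seq opath := [seq (s, s, [:: 1]) | s <- ss].

Definition add_slots (ss : seq nat) (S : state) : state :=
  (S.1 ++ ss, [seq (F.1 ++ singles ss, F.2) | F <- S.2]).

(** New vertices enter each 2-factor as paths of one vertex, and the 1-factor as unmatched. With
    [head 0 r = 1] the form [[:: 1]] has the value 1, the length of such a path. *)
Lemma represents_add phi r n Bs S C ss : head 0 r = 1 ->
  perm_eq (map phi ss) (iota n (size ss)) ->
  represents phi r n Bs S C -> represents phi r (n + size ss) Bs (add_slots ss S) C.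
Proof.
move=> Hr Hss [M [fs [HM Hfs HC]]].
pose ext (f : partial) : partial := (f.1, f.2 ++ [seq [:: phi s] | s <- ss]).
exists M, (map ext fs); split=> /=.
- by rewrite map_cat catA iotaD perm_cat.
- case: S Hfs {HM} => J Fs /= Hfs.
  elim: Fs Bs fs Hfs {HC} => [|F Fs IH] [|B Bs] [|f fs] //= [[H1 H2 H3] H4]; split; last exact: IH.
  split=> //=.
    rewrite /spans /= flatten_cat catA iotaD perm_cat //.
    by rewrite (map_comp (fun x => [:: x]) phi) flatten_seq1.
  apply: pathreps_cat => //; case: r Hr {H2 H3 H4 IH} => //= x r ->.
  by elim: (ss) => //= s ss' ?; split=> //; split; [case: (r)| |left].
- move=> x y /HC [H|H|[f Hf Hj]]; [exact: Or31|exact: Or32|apply: Or33].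
  exists (ext f); first exact: map_f.
  case: Hj => [] [c Hc H]; [by left; exists c|right; exists c => //=].
  by rewrite mem_cat Hc.
Qed.

Definition path_slots (a : opath) := [:: a.1.1; a.1.2].
Definition slots (S : state) :=
  S.1 ++ flatten [seq flatten [seq path_slots a | a <- F.1] | F <- S.2].

Definition map_slots (g : nat -> nat) (S : state) : state :=
  (map g S.1, [seq ([seq (g a.1.1, g a.1.2, a.2) | a <- F.1], F.2) | F <- S.2]).

Lemma represents_map_slots phi phi' r n Bs S C g :
  {in slots S, forall s, phi' (g s) = phi s} ->
  represents phi r n Bs S C -> represents phi' r n Bs (map_slots g S) C.
Proof.
case: S => J Fs H [M [fs [/= HM Hfs HC]]]; exists M, fs; split=> //=.
  rewrite -map_comp; have -> // : map (phi' \o g) J = map phi J.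
  by apply/eq_in_map => s Hs /=; apply: H; rewrite mem_cat Hs.
have {H} : {in flatten [seq flatten [seq path_slots a | a <- F.1] | F <- Fs],
  forall s, phi' (g s) = phi s}.
  by move=> s Hs; apply: H; rewrite mem_cat Hs orbT.
elim: Fs Bs fs Hfs {HC HM} => [|F Fs IH] [|B Bs] [|f fs] //= [[H1 H2 H3] H4] H; split; last first.
  by apply: IH => // s Hs; apply: H; rewrite mem_cat Hs orbT.
split=> //=.
have {H IH} : {in flatten [seq path_slots a | a <- F.1], forall s, phi' (g s) = phi s}.
  by move=> s Hs; apply: H; rewrite mem_cat Hs.
elim: (F.1) (f.2) H2 => [|a A IH] [|p ps] //= [[K1 K2 K3] K4] H; split; last first.
  by apply: IH => // s Hs; apply: H; rewrite !inE Hs !orbT.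
by split; rewrite //= !H // !inE eqxx ?orbT.
Qed.

Definition norm_path (a : opath) : opath :=
  (minn a.1.1 a.1.2, maxn a.1.1 a.1.2, trim a.2).
Definition norm_paths (A : seq opath) :=
  sort (fun a b : opath => a.1.1 <= b.1.1) (map norm_path A).
(** A canonical form, so that a computed state can be compared with an expected one by boolean
    equality. *)
Definition normalize (S : state) : state :=
  (sort leq S.1, [seq (norm_paths F.1, map trim F.2) | F <- S.2]).

Lemma pathreps_perm phi r A A' ps : perm_eq A A' -> pathreps phi r A ps ->
  exists ps', perm_eq ps ps' /\ pathreps phi r A' ps'.
Proof.
elim: A' A ps => [|a A' IH] A ps HA.
  have -> : A = [::] by apply/nilP; rewrite /nilp (perm_size HA).
  by case: ps => // _; exists [::].
have Ha : a \in A by rewrite (perm_mem HA) mem_head.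
have H : perm_eq (rem a A) A'.
  by rewrite -(perm_cons a) -(permPl (perm_to_rem Ha)).
move=> HP.
have [p [ps1 [K1 K2 K3]]] : exists p ps1, [/\ pathrep phi r a p, perm_eq ps (p :: ps1) &
    pathreps phi r (rem a A) ps1].
  elim: A ps Ha HP {IH HA H} => [|b A IH] [|q ps] //=; rewrite inE eq_sym.
  case: eqP => [<- _|_ /= Ha] [Hb Hr]; first by exists q, ps.
  have [p [ps1 [K1 K2 K3]]] := IH _ Ha Hr.
  exists p, (q :: ps1); split=> //.
  apply: (@perm_trans _ (q :: p :: ps1)); first by rewrite perm_cons.
  by rewrite -[q :: _]/([:: q] ++ [:: p] ++ ps1) perm_catCA.
have [ps2 [L1 L2]] := IH _ _ H K3.
by exists (p :: ps2); split=> //; rewrite (permPl K2) perm_cons.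
Qed.

Lemma pathrep_norm phi r a p : pathrep phi r a p -> pathrep phi r (norm_path a) p.
Proof.
case=> H1 H2 H3; split; rewrite //= ?fval_trim //.
by case: leqP => // _; case: H3; [right|left].
Qed.

Lemma represents_normalize phi r n Bs S C :
  represents phi r n Bs S C -> represents phi r n Bs (normalize S) C.
Proof.
case: S => J Fs [M [fs [/= HM Hfs HC]]].
have [fs' [H1 H2]] : exists fs',
    realizes_all phi r n Bs [seq (norm_paths F.1, map trim F.2) | F <- Fs] fs' /\
    forall x y, (exists2 f, f \in fs & joined f x y) ->
      exists2 f, f \in fs' & joined f x y.
  elim: Fs Bs fs Hfs {HC HM} => [|F Fs IH] [|B Bs] [|[cs ps] fs] //=.
    by move=> _; exists [::].
  move=> [[/= H1 H2 H3] /IH [fs' [H4 H5]]].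
  have H6 : pathreps phi r (map norm_path F.1) ps.
    elim: (F.1) (ps) H2 => [|a A IH'] [|p ps'] //= [K1 K2]; split; last exact: IH'.
    exact: pathrep_norm.
  have [ps' [H7 H8]] : exists ps', perm_eq ps ps' /\ pathreps phi r (norm_paths F.1) ps'.
    by apply: pathreps_perm H6; rewrite perm_sym perm_sort.
  exists ((cs, ps') :: fs'); split=> /=.
    split=> //; split=> //=.
      by apply: perm_trans H1; rewrite /= perm_cat2l; apply: perm_flatten; rewrite perm_sym.
    by rewrite -map_comp (eq_map (fval_trim r)).
  move=> x y [f]; rewrite inE => /orP[/eqP->|Hf] Hxy; last first.
    by have [g Hg Hgxy] := H5 x y (ex_intro2 _ _ f Hf Hxy); exists g; rewrite // inE Hg orbT.
  exists (cs, ps'); rewrite ?mem_head //.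
  case: Hxy => [] [c Hc H]; [by left; exists c|right; exists c => //=].
  by rewrite -(perm_mem H7).
exists M, fs'; split=> //=.
  by apply: perm_trans HM; rewrite perm_cat2l; apply: perm_map; rewrite perm_sort.
by move=> x y /HC [H|H|/H2 H]; [exact: Or31|exact: Or32|exact: Or33].
Qed.

(** * The columns of the doubled ladder *)

Definition flip_slot (o : bool) t := nth 0 (if o then [:: 2; 3; 0; 1] else [:: 0; 1; 2; 3]) t.

(* Slots 0, 1 are the two copies of the vertex that closes the ladder, slots
   2-5 the last completed column and slots 6-9 the column being attached; [o]
   tells whether the two sides of the ladder are exchanged. *)
Definition slot_vertex c (o : bool) s :=
  if s < 2 then s else if s < 6 then 4 * c + flip_slot o (s - 2)
  else 4 * c.+1 + flip_slot o (s - 6).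

(** The new column takes over the slots of the last completed one, so that the same ten slots serve
    for a ladder of any length. *)
Definition rename (o : bool) s := if s < 6 then s else flip_slot o (s - 6) + 2.

Definition column_edges := [:: (6, 8); (6, 9); (7, 8); (7, 9); (6, 7); (8, 9)].
(** A table lists its labels in this order: the two doubled rails, the doubled rung, the two twin
    edges. *)
Definition step_edges :=
  [:: (2, 6); (2, 7); (3, 6); (3, 7); (4, 8); (4, 9); (5, 8); (5, 9)] ++ column_edges.
(** Of the two vertices in column 0, the one with twins in slots 4 and 5 is joined to both vertices
    of the first column; the other one, in slots 0 and 1, waits for the last column. *)
Definition first_edges :=
  [:: (4, 6); (4, 7); (4, 8); (4, 9); (5, 6); (5, 7); (5, 8); (5, 9)] ++ column_edges.
Definition init_edges := [:: (0, 4); (0, 5); (1, 4); (1, 5); (0, 1); (4, 5)].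
Definition final_edges :=
  [:: (2, 0); (2, 1); (3, 0); (3, 1); (4, 0); (4, 1); (5, 0); (5, 1)].

(** The test on [slots] asks that nothing be left to do in the previous column: no path ends there
    and the 1-factor misses none of its vertices. Its slots are then free, and [o] exchanges the two
    sides if this leads to a known state. *)
Definition attach E tab o (S : state) : option state :=
  if size tab == size E then
    if place_all (zip E tab) (add_slots [:: 6; 7; 8; 9] S) is Some S' then
      if all (fun s => (s < 2) || (6 <= s < 10)) (slots S')
      then Some (normalize (map_slots (rename o) S')) else None
    else None
  else None.

Lemma mem_zip1 (A B : eqType) (s : seq A) (t : seq B) x :
  size s = size t -> x \in s -> exists y, (x, y) \in zip s t.
Proof.
elim: s t => [|a s IH] [|b t] //= [Hs]; rewrite inE => /orP[/eqP->|Hx].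
  by exists b; rewrite mem_head.
by have [y Hy] := IH _ Hs Hx; exists y; rewrite inE Hy orbT.
Qed.

Lemma mem_zip_fst (A B : eqType) (s : seq A) (t : seq B) x : x \in zip s t -> x.1 \in s.
Proof.
elim: s t => [|a s IH] [|b t] //=; rewrite !inE => /orP[/eqP->|/IH ->]; rewrite ?eqxx //.
by rewrite orbT.
Qed.

Lemma place_table phi r n Bs E tab S C S' : size tab = size E ->
  all (fun e => phi e.1 != phi e.2) E ->
  represents phi r n Bs S C -> place_all (zip E tab) S = Some S' ->
  represents phi r n Bs S'
    (fun x y => C x y \/ exists2 e, e \in E & (x, y) = (phi e.1, phi e.2)).
Proof.
move=> Hs /allP HE HS HS'.
have D : {in zip E tab, forall e, phi e.1.1 != phi e.1.2}.
  by move=> e /mem_zip_fst /HE.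
apply: represents_sub (place_all_represents D HS HS') => x y [|[e He Hxy]]; first by left.
have [k Hk] := mem_zip1 (esym Hs) He.
by right; exists (e, k).
Qed.

Lemma attach_represents c o r Bs E tab f S C S' : head 0 r = 1 ->
  all (fun e => slot_vertex c o e.1 != slot_vertex c o e.2) E ->
  represents (slot_vertex c o) r (4 * c.+1) Bs S C -> attach E tab f S = Some S' ->
  represents (slot_vertex c.+1 (o (+) f)) r (4 * c.+2) Bs S'
    (fun x y => C x y \/
       exists2 e, e \in E & (x, y) = (slot_vertex c o e.1, slot_vertex c o e.2)).
Proof.
move=> Hr HE HS; rewrite /attach; case: eqP => // Hs.
case ES: (place_all _ _) => [S1|] //; case: ifP => // Hall [<-].
apply: represents_normalize; apply: (represents_map_slots (phi := slot_vertex c o)).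
  move=> s /(allP Hall); rewrite /rename /slot_vertex.
  case: (ltnP s 2) => [Hs2|_] /=; first by rewrite (ltn_trans Hs2) ?Hs2.
  case/andP=> H6 H10; have -> : (s < 6) = false by lia.
  have : s \in iota 6 4 by rewrite mem_iota H6.
  by rewrite !inE; case: (o); case: (f) => /or4P[] /eqP ->.
apply: place_table ES => //.
have -> : 4 * c.+2 = 4 * c.+1 + size [:: 6; 7; 8; 9] by rewrite /=; lia.
apply: represents_add => //=.
set N := 4 * c.+1; rewrite /slot_vertex /= -/N; case: (o); rewrite /= !addnS addn0 //.
by rewrite -[X in perm_eq X _]/(rot 2 [:: N; N.+1; N.+2; N.+3]) perm_rot.
Qed.

(* The doubled ladder with its 1-factor of twin vertices; the edges from the
   last column back to the vertices 0, 1 are not included. *)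
Definition ladder_edge x y :=
  (x %/ 4 == y %/ 4) ||
  (y %/ 4 == (x %/ 4).+1) && (if x < 4 then 2 <= x else (x %% 4)./2 == (y %% 4)./2).

Lemma ladder_edge_next c s t : 0 < c -> s < 4 -> t < 4 ->
  ladder_edge (4 * c + s) (4 * c.+1 + t) = (s./2 == t./2).
Proof.
move=> c0 Hs Ht; rewrite /ladder_edge.
have -> : (4 * c + s) %/ 4 = c by lia.
have -> : (4 * c.+1 + t) %/ 4 = c.+1 by lia.
have -> : (4 * c + s) %% 4 = s by lia.
have -> : (4 * c.+1 + t) %% 4 = t by lia.
have -> : (4 * c + s < 4) = false by lia.
by rewrite eqxx /=; case: eqP => //; lia.
Qed.

Definition ladder_upto n x y := [/\ x < y, y < n & ladder_edge x y].

(** The number of columns and the orientation are hidden, so that tables can be composed without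
    regard to the position reached. *)
Definition config r Bs (S : state) := exists c o,
  0 < c /\ represents (slot_vertex c o) r (4 * c.+1) Bs S (ladder_upto (4 * c.+1)).

Lemma represents_subC phi r n Bs S (C C' : nat -> nat -> Prop) :
  (forall x y, C' x y -> C x y \/ C y x) -> represents phi r n Bs S C ->
  represents phi r n Bs S C'.
Proof.
move=> H [M [fs [H1 H2 H3]]]; exists M, fs; split=> // x y /H [/H3//|/H3].
exact: coveredC.
Qed.

Lemma flip_slotK o t : t < 4 -> flip_slot o (flip_slot o t) = t.
Proof.
move=> Ht; have : t \in iota 0 4 by rewrite mem_iota.
by rewrite !inE; case: o => /or4P[] /eqP ->.
Qed.

Lemma flip_slot_lt o t : t < 4 -> flip_slot o t < 4.
Proof.
move=> Ht; have : t \in iota 0 4 by rewrite mem_iota.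
by rewrite !inE; case: o => /or4P[] /eqP ->.
Qed.

Lemma slot_vertex_last c o s : s < 4 -> slot_vertex c o (2 + flip_slot o s) = 4 * c + s.
Proof.
move=> Hs; have H := flip_slot_lt o Hs; rewrite /slot_vertex.
have -> : (2 + flip_slot o s < 2) = false by lia.
have -> : (2 + flip_slot o s < 6) by lia.
by rewrite addKn flip_slotK.
Qed.

Lemma slot_vertex_new c o s : s < 4 -> slot_vertex c o (6 + flip_slot o s) = 4 * c.+1 + s.
Proof.
move=> Hs; have H := flip_slot_lt o Hs; rewrite /slot_vertex.
have -> : (6 + flip_slot o s < 2) = false by lia.
have -> : (6 + flip_slot o s < 6) = false by lia.
by rewrite addKn flip_slotK.
Qed.

Lemma table_coverage c o (E : seq (nat * nat)) :
  (forall s t, s < t < 4 ->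
     let e := (6 + flip_slot o s, 6 + flip_slot o t) in
     (e \in E) || ((e.2, e.1) \in E)) ->
  (forall s t, s < 4 -> t < 4 -> ladder_edge (4 * c + s) (4 * c.+1 + t) ->
     (2 + flip_slot o s, 6 + flip_slot o t) \in E) ->
  forall x y, ladder_upto (4 * c.+2) x y ->
  let D x y := ladder_upto (4 * c.+1) x y \/
    exists2 e, e \in E & (x, y) = (slot_vertex c o e.1, slot_vertex c o e.2) in
  D x y \/ D y x.
Proof.
move=> HK HR x y [Hxy Hy L] D.
have [Hy'|Hy'] := ltnP y (4 * c.+1); first by left; left.
have [t Ht Ey] : exists2 t, t < 4 & y = 4 * c.+1 + t.
  by exists (y - 4 * c.+1); lia.
have [s Hs Ex] : exists2 s, s < 4 & x = 4 * c + s \/ x = 4 * c.+1 + s.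
  have H : y %/ 4 = c.+1 by lia.
  move: L; rewrite /ladder_edge H => /orP[/eqP Hx|/andP[/eqP Hx _]].
    by exists (x - 4 * c.+1); lia.
  by exists (x - 4 * c); lia.
case: Ex => Ex.
  left; right; exists (2 + flip_slot o s, 6 + flip_slot o t).
    by apply: HR => //; rewrite -Ex -Ey.
  by rewrite slot_vertex_last // slot_vertex_new // Ex Ey.
have Hst : s < t < 4 by lia.
have /= /orP[H|H] := HK s t Hst; [left|right]; right.
  by exists (6 + flip_slot o s, 6 + flip_slot o t); rewrite // !slot_vertex_new // Ex Ey.
by exists (6 + flip_slot o t, 6 + flip_slot o s); rewrite // !slot_vertex_new // Ex Ey.
Qed.

Lemma step_edges_distinct E c o : E = step_edges \/ E = first_edges ->
  all (fun e => slot_vertex c o e.1 != slot_vertex c o e.2) E.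
Proof. by case=> ->; case: o; rewrite /slot_vertex /flip_slot /=; lia. Qed.

Lemma config_attach r Bs S tab f S' : head 0 r = 1 ->
  config r Bs S -> attach step_edges tab f S = Some S' -> config r Bs S'.
Proof.
move=> Hr [c [o [c0 HS]]] E; exists c.+1, (o (+) f); split=> //.
have := attach_represents Hr (step_edges_distinct c o (or_introl erefl)) HS E.
apply: represents_subC; apply: table_coverage.
  move=> s t /andP[Hst Ht].
  by case: t Ht s Hst => [|[|[|[|t]]]] // _ [|[|[|[|s]]]] // _; case: (o).
move=> s t Hs Ht; rewrite ladder_edge_next //.
by case: s t Hs Ht => [|[|[|[|s]]]] [|[|[|[|t]]]] // _ _; case: (o).
Qed.

(** Column 0 alone. Slots 2 and 3 would name the vertices 0 and 1 a second time and are left out. *)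
Definition start_state : state :=
  ([:: 0; 1; 4; 5], nseq 3 (singles [:: 0; 1; 4; 5], [::])).

Definition start tab tab' f : option state :=
  if size tab == size init_edges then
    if place_all (zip init_edges tab) start_state is Some S0
    then attach first_edges tab' f S0 else None
  else None.

Lemma config_start r tab tab' f S : head 0 r = 1 ->
  start tab tab' f = Some S -> config r (nseq 3 [::]) S.
Proof.
move=> Hr; rewrite /start; case: eqP => // Hs.
case E: (place_all _ _) => [S0|] // E'; exists 1, f; split=> //.
have H0 : represents (slot_vertex 0 false) r 4 (nseq 3 [::]) start_state (fun _ _ => False).
  have -> : start_state = add_slots [:: 0; 1; 4; 5] ([::], nseq 3 ([::], [::])) by [].
  apply: (@represents_add _ _ 0) => //.
  by exists [::], (nseq 3 ([::], [::])); split=> //=; repeat split.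
have := place_table Hs _ H0 E; move=> /(_ isT) H1.
have := attach_represents (c := 0) Hr (step_edges_distinct 0 false (or_intror erefl)) H1 E'.
apply: represents_subC => x y Hxy.
have Hinit a b : ladder_upto 4 a b -> exists2 e, e \in init_edges &
    (a, b) = (slot_vertex 0 false e.1, slot_vertex 0 false e.2) \/
    (b, a) = (slot_vertex 0 false e.1, slot_vertex 0 false e.2).
  case=> Hab Hb _; have : a < 4 by lia.
  case: b Hb a Hab => [|[|[|[|b]]]] // _ [|[|[|[|a]]]] // _ _.
  - by exists (0, 1); [|left].
  - by exists (0, 4); [|left].
  - by exists (1, 4); [|left].
  - by exists (0, 5); [|left].
  - by exists (1, 5); [|left].
  - by exists (4, 5); [|left].
have [||H|H] := @table_coverage 0 false first_edges _ _ x y Hxy.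
- move=> s t /andP[Hst Ht].
  by case: t Ht s Hst => [|[|[|[|t]]]] // _ [|[|[|[|s]]]].
- by move=> [|[|[|[|s]]]] [|[|[|[|t]]]].
- case: H => [/Hinit [e He [] H]|H]; [left|right|left]; [left|left|]; right; by [exists e|].
- case: H => [/Hinit [e He [] H]|H]; [right|left|right]; [left|left|]; right; by [exists e|].
Qed.

(** * Repeating a column *)

Definition evaluate r (S : state) :=
  (S.1, [seq ([seq (a.1, fval r a.2) | a <- F.1], map (fval r) F.2) | F <- S.2]).

(** A realization sees the forms only through their values, so forms and variables may be changed
    together. *)
Lemma represents_evaluate phi r r' n Bs S S' C : evaluate r S = evaluate r' S' ->
  represents phi r n Bs S C -> represents phi r' n Bs S' C.
Proof.
case: S S' => J Fs [J' Fs'] [<- E] [M [fs [/= HM Hfs HC]]].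
exists M, fs; split=> //=.
elim: Fs Fs' Bs fs E Hfs {HM HC} => [|F Fs IH] [|F' Fs'] //= [|B Bs] [|f fs] // [E1 E2 E3].
move=> [[H1 H2 H3] H4]; split; last exact: IH.
split=> //; last by rewrite -E2.
elim: (F.1) (F'.1) (f.2) E1 H2 => [|a A IH'] [|a' A'] //= [|p ps] // [K1 K2 K3] [K4 K5].
split; last exact: IH'.
by case: K4 => L1 L2 L3; split; rewrite -?K1 -?K2.
Qed.

(** [ncons k 0 [:: d]] is the linear form that equals d times the variable [k]; with [k = 0] it is
    the constant d. *)
Definition scale_path k (ad : opath * nat) : opath :=
  (ad.1.1, trim (fadd ad.1.2 (ncons k 0 [:: ad.2]))).

Definition lengthen k (ds : seq (seq nat)) (S : state) : state :=
  (S.1, [seq (map (scale_path k) (zip Fd.1.1 Fd.2), Fd.1.2) | Fd <- zip S.2 ds]).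

(** A guess, which matches paths by their order and looks at constant terms only; the last test in
    [repeat_attach] verifies it. *)
Definition growth (S S' : state) : seq (seq nat) :=
  [seq [seq head 0 aa.2.2 - head 0 aa.1.2 | aa <- zip FF.1.1 FF.2.1] | FF <- zip S.2 S'.2].

Definition bounded_lengths m (S : state) :=
  all (fun F : fstate => all (fun a : opath => size a.2 <= m) F.1 &&
                        all (fun l : form => size l <= m) F.2) S.2.

(* Attaching the same table [r`_k] times.  The table is checked once, on path
   lengths that depend on the fresh variable 4, which counts the repetitions. *)
Definition repeat_attach k tab f (S : state) : option state :=
  if attach step_edges tab f S is Some S' then
    let ds := growth S S' in
    let S4 := lengthen 4 ds S in
    if [&& bounded_lengths 4 S,
           size ds == size S.2,
           all (fun Fd => size Fd.1.1 == size Fd.2) (zip S.2 ds) &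
           attach step_edges tab f S4 == Some (lengthen 4 ds (lengthen 0 ds S))]
    then Some (lengthen k ds S) else None
  else None.

Lemma fval_ncons r k d : fval r (ncons k 0 [:: d]) = d * nth 0 r k.
Proof. by elim: k r => [|k IH] [|x r] //=; rewrite ?nth_nil ?addn0 ?muln0 ?mul0n ?IH. Qed.

Lemma fval_rcons r l x : size l <= size r -> fval (rcons r x) l = fval r l.
Proof. by elim: l r => [|a l IH] [|y r] //= /IH ->. Qed.

Lemma evaluate_ext r r' S S' : S.1 = S'.1 -> size S.2 = size S'.2 ->
  (forall i, i < size S.2 ->
     let F := nth ([::], [::]) S.2 i in let F' := nth ([::], [::]) S'.2 i in
     [/\ size F.1 = size F'.1, map (fval r) F.2 = map (fval r') F'.2 &
         forall j, j < size F.1 ->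
           let a := nth (0, 0, [::]) F.1 j in let a' := nth (0, 0, [::]) F'.1 j in
           a.1 = a'.1 /\ fval r a.2 = fval r' a'.2]) ->
  evaluate r S = evaluate r' S'.
Proof.
case: S S' => J Fs [J' Fs'] /= <- H3 H; congr pair.
apply: (@eq_from_nth _ ([::], [::])); rewrite !size_map // => i Hi.
rewrite !(nth_map ([::], [::])) -?H3 //=.
have [K3 -> K4] := H i Hi; congr pair.
apply: (@eq_from_nth _ (0, 0, 0)); rewrite !size_map // => j Hj.
rewrite !(nth_map (0, 0, [::])) -?K3 //=.
by have [L1 ->] := K4 j Hj; congr pair.
Qed.

Lemma size_lengthen k ds S : size ds = size S.2 -> size (lengthen k ds S).2 = size S.2.
Proof. by move=> H; rewrite size_map size_zip H minnn. Qed.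

Lemma nth_lengthen k ds S i : size ds = size S.2 -> i < size S.2 ->
  nth ([::], [::]) (lengthen k ds S).2 i =
  (map (scale_path k) (zip (nth ([::], [::]) S.2 i).1 (nth [::] ds i)),
   (nth ([::], [::]) S.2 i).2).
Proof.
move=> H Hi; rewrite (nth_map ([::], [::], [::])) ?size_zip ?H ?minnn //.
by rewrite nth_zip.
Qed.

Lemma nth_scale_path k (A : seq opath) (d : seq nat) j : size d = size A -> j < size A ->
  nth (0, 0, [::]) (map (scale_path k) (zip A d)) j =
  scale_path k (nth (0, 0, [::]) A j, nth 0 d j).
Proof.
move=> H Hj; rewrite (nth_map (0, 0, [::], 0)) ?size_zip ?H ?minnn //.
by rewrite nth_zip.
Qed.

Lemma fval_scale_path r k ad :
  fval r (scale_path k ad).2 = fval r ad.1.2 + ad.2 * nth 0 r k.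
Proof. by rewrite fval_trim fval_add fval_ncons. Qed.

Lemma config_evaluate r r' Bs S S' : evaluate r S = evaluate r' S' ->
  config r Bs S -> config r' Bs S'.
Proof. by move=> E [c [o [c0 H]]]; exists c, o; split=> //; apply: represents_evaluate E H. Qed.

(** Induction on the value x of the variable 4: by the symbolic check, one more table turns lengths
    increased by d x into lengths increased by d (x + 1). The forms in [S] have at most 4
    coefficients, so that this variable is indeed fresh. *)
Lemma config_repeat_attach r Bs S k tab f S' : head 0 r = 1 -> size r = 4 -> k < 4 ->
  config r Bs S -> repeat_attach k tab f S = Some S' -> config r Bs S'.
Proof.
move=> Hr Hs Hk HS; rewrite /repeat_attach.
case E: (attach _ _ _ S) => [S1|] //; set ds := growth S S1.
case: ifP => // /and4P[Hb /eqP Hds /allP Hall /eqP E4] [<-].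
have Hd i : i < size S.2 -> size (nth [::] ds i) = size (nth ([::], [::]) S.2 i).1.
  move=> Hi; have := Hall (nth (([::], [::]), [::]) (zip S.2 ds) i).
  rewrite mem_nth ?size_zip ?Hds ?minnn // => /(_ isT).
  by rewrite nth_zip //= => /eqP ->.
have Hbl i : i < size S.2 -> let F := nth ([::], [::]) S.2 i in
    (forall j, j < size F.1 -> size (nth (0, 0, [::]) F.1 j).2 <= 4) /\
    (forall x, map (fval (rcons r x)) F.2 = map (fval r) F.2).
  move=> Hi F; have /andP[/allP H1 /allP H2] := allP Hb _ (mem_nth ([::], [::]) Hi).
  split=> [j Hj|x]; first by apply: H1; apply: mem_nth.
  by apply/eq_in_map => l /H2 Hl; rewrite fval_rcons // Hs.
have r0 x : nth 0 (rcons r x) 0 = 1 by case: (r) Hr Hs.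
have r4 x : nth 0 (rcons r x) 4 = x by rewrite nth_rcons Hs.
have Hsz m : size (lengthen m ds S).2 = size S.2 by rewrite size_lengthen.
have step x : config (rcons r x) Bs (lengthen 4 ds S) ->
    config (rcons r x.+1) Bs (lengthen 4 ds S).
  move=> H; have Hh : head 0 (rcons r x) = 1 by rewrite -nth0.
  have := config_attach Hh H E4; apply: config_evaluate.
  apply: evaluate_ext => //; rewrite !size_lengthen ?Hsz // => i Hi.
  have [H1 H2] := Hbl i Hi.
  rewrite !nth_lengthen ?Hsz //= !size_map !size_zip Hd // size_map size_zip Hd // !minnn.
  split=> //; first by rewrite !H2.
  move=> j Hj; rewrite !nth_scale_path ?size_map ?size_zip ?Hd ?minnn //; split=> //.
  rewrite !fval_scale_path /= r0 !r4.
  by rewrite !fval_rcons ?Hs ?H1 //; lia.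
have H0 : config (rcons r 0) Bs (lengthen 4 ds S).
  apply: config_evaluate HS; apply: evaluate_ext => // i Hi.
  have [H1 H2] := Hbl i Hi; rewrite nth_lengthen //=.
  split; rewrite ?size_map ?size_zip ?Hd ?minnn ?H2 // => j Hj.
  by rewrite nth_scale_path ?Hd // fval_scale_path /= r4 muln0 addn0 fval_rcons ?Hs ?H1.
have HN : config (rcons r (nth 0 r k)) Bs (lengthen 4 ds S).
  by elim: (nth 0 r k) => // x; apply: step.
apply: config_evaluate HN; apply: evaluate_ext => //; rewrite ?Hsz // => i Hi.
have [H1 H2] := Hbl i Hi; rewrite !nth_lengthen //=.
split; rewrite ?size_map ?size_zip ?Hd ?minnn ?H2 // => j Hj.
rewrite !nth_scale_path ?Hd // !fval_scale_path /= r4.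
by rewrite fval_rcons ?Hs ?H1.
Qed.

(** * Sequences of tables and the closing of the ladder *)

Inductive move :=
| Attach of bool & seq nat
| Repeat of nat & bool & seq nat.

Fixpoint run (ms : seq move) (S : state) : option state :=
  match ms with
  | [::] => Some S
  | Attach f tab :: ms' => if attach step_edges tab f S is Some S' then run ms' S' else None
  | Repeat k f tab :: ms' =>
    if k < 4 then if repeat_attach k tab f S is Some S' then run ms' S' else None else None
  end.

Lemma config_run r Bs S ms S' : head 0 r = 1 -> size r = 4 ->
  config r Bs S -> run ms S = Some S' -> config r Bs S'.
Proof.
move=> Hr Hs; elim: ms S => [|[f tab|k f tab] ms IH] S HS /=; first by move=> [<-].
  by case E: (attach _ _ _ _) => [S1|] //; apply: IH; apply: config_attach HS E.
case: ifP => // Hk; case E: (repeat_attach _ _ _ _) => [S1|] //.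
by apply: IH; apply: config_repeat_attach HS E.
Qed.

Definition finish tab (S : state) : option (seq (seq form)) :=
  if size tab == size final_edges then
    if place_all (zip final_edges tab) S is Some S' then
      if nilp S'.1 && all (fun F : fstate => nilp F.1) S'.2
      then Some [seq F.2 | F <- S'.2] else None
    else None
  else None.

Fixpoint factors_typed n (Ts : seq (seq nat)) (Fs : seq (seq (seq nat))) : Prop :=
  match Ts, Fs with
  | [::], [::] => True
  | T :: Ts', F :: Fs' =>
    [/\ perm_eq (flatten F) (iota 0 n), perm_eq (map size F) T & factors_typed n Ts' Fs']
  | _, _ => False
  end.

Definition factor_edge (F : seq (seq nat)) x y := exists2 c, c \in F & cedge c x y.

Definition closed_ladder_edge K x y :=
  ladder_edge x y || ((x < 2) && (y %/ 4 == K)).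

(* Only covering is recorded: disjointness of the factors follows by counting,
   once all of them have been assembled. *)
Definition ladder_splits (Ts : seq (seq nat)) := exists K M Fs,
  [/\ 0 < K, perm_eq (pairs_of M) (iota 0 (4 * K.+1)), factors_typed (4 * K.+1) Ts Fs &
      forall x y, x < y < 4 * K.+1 -> closed_ladder_edge K x y ->
        [\/ (x, y) \in M, (y, x) \in M | exists2 F, F \in Fs & factor_edge F x y]].

Lemma config_finish r Bs S tab Ls : config r Bs S -> finish tab S = Some Ls ->
  size Bs = size Ls /\
  ladder_splits [seq BL.1 ++ map (fval r) BL.2 | BL <- zip Bs Ls].
Proof.
move=> [c [o [c0 HS]]]; rewrite /finish; case: eqP => // Hs.
case E: (place_all _ _) => [S'|] //; case: ifP => // /andP[/nilP E1 Ha] [<-].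
have Hf : all (fun e => slot_vertex c o e.1 != slot_vertex c o e.2) final_edges.
  by case: (o); rewrite /slot_vertex /flip_slot /=; lia.
have {HS E} [M [fs [HM Hfs HC]]] := place_table Hs Hf HS E.
have {Hfs} [H1 H2] : size Bs = size S'.2 /\
    factors_typed (4 * c.+1) [seq BL.1 ++ map (fval r) BL.2 | BL <- zip Bs [seq F.2 | F <- S'.2]]
      [seq f.1 | f <- fs] /\ all (fun f : partial => nilp f.2) fs.
  move: Ha Hfs; move: (S'.2) => Fs; clear.
  elim: Fs Bs fs => [|F Fs IH] [|B Bs] [|f fs] //= /andP[/nilP E Ha] [[H1 H2 H3] H4].
  have [-> [H5 H6]] := IH _ _ Ha H4.
  have Ef : f.2 = [::] by move: H2; rewrite E; case: (f.2).
  by move: H1; rewrite /spans Ef cats0.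
rewrite size_map; split=> //; exists c, M, [seq f.1 | f <- fs]; split=> //.
- by move: HM; rewrite E1 cats0.
- by case: H2.
move=> x y Hxy Hl; have : covered M fs x y.
  have [L|L] := boolP (ladder_edge x y); first by apply: HC; left; split=> //; lia.
  have [Hx /eqP Hy] : x < 2 /\ y %/ 4 == c.
    by apply/andP; move: Hl; rewrite /closed_ladder_edge (negbTE L).
  have [t Ht Et] : exists2 t, t < 4 & y = 4 * c + t by exists (y - 4 * c); lia.
  apply: coveredC; apply: HC; right.
  exists (2 + flip_slot o t, x); last by rewrite /= slot_vertex_last // Et /slot_vertex Hx.
  by case: x Hx {L Hxy Hl} => [|[|x]] // _; case: t Ht {Et} => [|[|[|[|t]]]] // _; case: (o).
case=> [H|H|[f Hf' Hj]]; [exact: Or31|exact: Or32|apply: Or33].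
exists f.1; first exact: map_f.
case: Hj => [] // [p Hp _].
by case: H2 => _ /allP/(_ _ Hf')/nilP E2; rewrite E2 in Hp.
Qed.

Definition conclude (mt : seq move * seq nat) (S : state) : option (seq (seq form)) :=
  obind (finish mt.2) (run mt.1 S).

Definition erase (S : state) : state := (S.1, [seq (F.1, [::]) | F <- S.2]).
Definition closed (S : state) : seq (seq form) := [seq F.2 | F <- S.2].

Lemma config_erase r Bs S : config r Bs S ->
  config r [seq BC.1 ++ map (fval r) BC.2 | BC <- zip Bs (closed S)] (erase S).
Proof.
move=> [c [o [c0 [M [fs [HM Hfs HC]]]]]]; exists c, o; split=> //; exists M, fs; split=> //.
case: S Hfs {HM} => J Fs /=.
elim: Fs Bs fs {HC} => [|F Fs IH] [|B Bs] [|f fs] //= [[H1 H2 H3] H4]; split; last exact: IH.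
by split=> //=; rewrite cats0.
Qed.

Lemma config_size r Bs S : config r Bs S -> size Bs = size S.2.
Proof.
move=> [c [o [c0 [M [fs [_ Hfs _]]]]]].
by elim: (S.2) Bs fs Hfs => [|F Fs IH] [|B Bs] [|f fs] //= [_ /IH ->].
Qed.

Lemma config_perm r Bs Bs' S : all2 perm_eq Bs Bs' -> config r Bs S -> config r Bs' S.
Proof.
move=> H [c [o [c0 [M [fs [HM Hfs HC]]]]]]; exists c, o; split=> //; exists M, fs; split=> //.
elim: (S.2) Bs Bs' fs H Hfs {HC HM} => [|F Fs IH] [|B Bs] [|B' Bs'] [|f fs] //=.
move=> /andP[HB HBs] [[H1 H2 H3] H4]; split; last exact: (IH Bs).
by split=> //; rewrite (permPl H3) perm_cat2r.
Qed.

Lemma ladder_splits_perm Ts Ts' : all2 perm_eq Ts Ts' -> ladder_splits Ts -> ladder_splits Ts'.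
Proof.
move=> H [K [M [Fs [K0 HM HF HC]]]]; exists K, M, Fs; split=> //.
elim: Ts Ts' Fs H HF {HC HM} => [|T Ts IH] [|T' Ts'] [|F Fs] //= /andP[HT HTs] [H1 H2 H3].
by split=> //; [apply: perm_trans H2 _|apply: IH].
Qed.

Lemma config_conclude r Bs S mt Ls : head 0 r = 1 -> size r = 4 ->
  config r Bs S -> conclude mt S = Some Ls ->
  size Bs = size Ls /\ ladder_splits [seq BL.1 ++ map (fval r) BL.2 | BL <- zip Bs Ls].
Proof.
move=> Hr Hs HS; rewrite /conclude; case E: (run mt.1 S) => [S'|] //= E'.
exact: config_finish (config_run Hr Hs HS E) E'.
Qed.

(** The three 2-factors are to have equal types, so all of them must close the same cycles [X]
    between the two interfaces. *)
Definition segment ms S T (X : seq form) :=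
  if run ms S is Some S' then (erase S' == T) && all (perm_eq X) (closed S') else false.

Lemma config_segment r Bs ms S T X : head 0 r = 1 -> size r = 4 ->
  segment ms S T X -> config r Bs S -> config r [seq map (fval r) X ++ B | B <- Bs] T.
Proof.
move=> Hr Hs; rewrite /segment; case E: (run ms S) => [S'|] // /andP[/eqP <- HX] HS.
have HS' := config_run Hr Hs HS E.
apply: config_perm (config_erase HS').
have := config_size HS'; rewrite -(size_map (fun F : fstate => F.2)) -/(closed S').
elim: (closed S') Bs HX {HS E HS'} => [|C Cs IH] [|B Bs] //= /andP[HC HCs] [Hsz].
by rewrite IH // andbT perm_catC perm_cat2r perm_sym perm_map.
Qed.

(** * Interfaces between groups of cycles *)

Definition singletons : seq opath := [:: (0, 0, [:: 1]); (1, 1, [:: 1])].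

(* The open paths through the closing vertices 0 and 1; the variable 3 stands
   for a length that is fixed when the ladder is started. *)
Definition closing0 : seq (seq opath) := [:: [::]; singletons; [:: (0, 1, [:: 4])]].
Definition closing1 : seq (seq opath) := [:: singletons; [:: (0, 1, [:: 0; 0; 0; 1])]; [::]].
Definition closing2 : seq (seq opath) := [:: [:: (0, 1, [:: 4])]; [::]; singletons].
Definition closing4 : seq (seq opath) :=
  [:: [:: (0, 1, [:: 6])]; [:: (0, 1, [:: 2])]; [:: (0, 1, [:: 4])]].
Definition closings := [:: closing0; closing1; closing2; closing4].

(* The two interfaces between consecutive groups of cycles; only [node true]
   allows a group consisting of one 4-cycle. *)
Definition node (b : bool) (P : seq (seq opath)) : state :=
  ([:: 0; 1; 2; 4], [seq (PA.1 ++ PA.2, [::]) | PA <- zip P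
     (if b then [:: [::]; [:: (2, 3, [:: 3]); (5, 5, [:: 1])]; [:: (3, 4, [:: 2])]]
      else [:: [::]; [:: (2, 5, [:: 2]); (3, 4, [:: 2])]; [:: (3, 5, [:: 2])]])]).

(** The edges of a step avoid the slots 0 and 1, so the same tables work for all four ways in which
    the ladder is going to be closed. *)
Definition segments ms b b' X := all (fun P => segment ms (node b P) (node b' P) X) closings.

Lemma evaluate_node i j h i' j' b P : P \in closings ->
  evaluate [:: 1; i; j; h] (node b P) = evaluate [:: 1; i'; j'; h] (node b P).
Proof. by rewrite !inE => /or4P[] /eqP ->; case: b. Qed.

(* [h] is the value of the variable 3, [Os] lists the cycles already closed by
   the start of the ladder, and [L] those closed since then. *)
Definition reached (b : bool) P (h : nat) (Os : seq (seq nat)) (L : seq nat) :=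
  P \in closings /\ config [:: 1; 0; 0; h] [seq L ++ Q | Q <- Os] (node b P).

Lemma reached_perm b P h Os L L' : perm_eq L L' -> reached b P h Os L -> reached b P h Os L'.
Proof.
move=> H [HP HS]; split=> //; apply: config_perm HS.
by elim: Os => //= Q Os ->; rewrite perm_cat2r H.
Qed.

Lemma reached_segment i j b b' P h Os L ms X : segments ms b b' X ->
  reached b P h Os L -> reached b' P h Os (map (fval [:: 1; i; j; h]) X ++ L).
Proof.
move=> /allP HX [HP HS]; split=> //.
have := config_evaluate (evaluate_node 0 0 h i j b HP) HS.
move=> /(config_segment _ _ (HX P HP)) => /(_ erefl erefl).
move=> /(config_evaluate (evaluate_node i j h 0 0 b' HP)).
by rewrite -map_comp; congr config; apply: eq_map => Q /=; rewrite catA.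
Qed.

(** The parity meant is that of [l./2]. Length 4 is excluded because 4-cycles need an interface of
    their own. *)
Definition even_long l := (8 <= l) && (l %% 4 == 0).
Definition odd_long l := (6 <= l) && (l %% 4 == 2).

(** Length 8 has its own tables; those with a repeated column begin at 12. In the same way 6 is
    separated from 10 and above in the other residue class. *)
Lemma even_longP l : even_long l -> l = 8 \/ exists i, l = 12 + 4 * i.
Proof.
case/andP=> H1 /eqP H2; have [->|H] := eqVneq l 8; [by left|right].
by exists ((l - 12) %/ 4); lia.
Qed.

Lemma odd_longP l : odd_long l -> l = 6 \/ exists i, l = 10 + 4 * i.
Proof.
case/andP=> H1 /eqP H2; have [->|H] := eqVneq l 6; [by left|right].
by exists ((l - 10) %/ 4); lia.
Qed.

(* The tables below were found by computer search; the suffixes [t] and [f]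
   refer to the node from which the segment or the end starts. *)
Definition seg_4_t : seq move :=
  [:: Attach true [:: 2; 0; 2; 3; 3; 0; 2; 2; 1; 3; 3; 1; 1; 1]].

Definition seg_6_6_t : seq move :=
  [:: Attach true [:: 2; 0; 3; 2; 3; 0; 2; 2; 1; 1; 1; 3; 3; 3];
    Attach false [:: 0; 2; 2; 1; 2; 0; 2; 1; 1; 3; 0; 1; 3; 3];
    Attach true [:: 2; 1; 2; 3; 3; 1; 2; 2; 1; 3; 3; 0; 1; 1]].

Definition seg_6_6_f : seq move :=
  [:: Attach false [:: 0; 2; 2; 3; 2; 0; 3; 2; 3; 3; 0; 3; 1; 1];
    Attach false [:: 2; 1; 1; 2; 1; 2; 2; 1; 3; 2; 2; 0; 3; 3];
    Attach false [:: 1; 0; 3; 1; 1; 0; 3; 1; 3; 2; 2; 3; 1; 1]].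

Definition seg_8_t : seq move :=
  [:: Attach false [:: 2; 0; 3; 2; 3; 0; 2; 2; 1; 2; 2; 1; 3; 3];
    Attach false [:: 1; 0; 3; 1; 1; 0; 3; 1; 3; 2; 2; 3; 1; 1]].

Definition seg_8_f : seq move :=
  [:: Attach false [:: 2; 0; 3; 2; 2; 0; 3; 2; 1; 3; 3; 1; 2; 2];
    Attach false [:: 1; 0; 3; 1; 1; 0; 3; 1; 3; 2; 2; 3; 1; 1]].

Definition seg_12_t : seq move :=
  [:: Attach true [:: 2; 0; 3; 2; 3; 0; 2; 2; 0; 1; 1; 1; 3; 3];
    Repeat 1 false [:: 2; 1; 3; 2; 2; 1; 3; 2; 0; 1; 1; 0; 3; 3];
    Attach false [:: 2; 1; 3; 2; 2; 1; 3; 2; 1; 2; 2; 0; 3; 3];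
    Attach false [:: 1; 0; 3; 1; 1; 0; 3; 1; 3; 2; 2; 3; 1; 1]].

Definition seg_12_f : seq move :=
  [:: Attach true [:: 2; 0; 3; 2; 2; 0; 3; 2; 0; 1; 1; 1; 2; 3];
    Repeat 1 true [:: 2; 1; 3; 2; 3; 1; 3; 3; 0; 2; 2; 0; 1; 1];
    Attach false [:: 2; 1; 3; 2; 3; 1; 3; 3; 1; 2; 2; 0; 3; 2];
    Attach false [:: 1; 0; 3; 1; 1; 0; 3; 1; 3; 2; 2; 3; 1; 1]].

Definition seg_6_10_t : seq move :=
  [:: Attach true [:: 2; 0; 3; 2; 3; 0; 2; 2; 1; 1; 1; 3; 3; 3];
    Attach false [:: 0; 2; 2; 1; 2; 0; 2; 1; 1; 2; 0; 1; 3; 3];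
    Repeat 1 false [:: 3; 1; 2; 3; 3; 1; 2; 3; 0; 1; 1; 0; 2; 2];
    Attach false [:: 3; 1; 2; 3; 1; 3; 3; 2; 3; 1; 2; 0; 2; 2];
    Attach false [:: 1; 0; 3; 1; 1; 0; 3; 1; 3; 2; 2; 3; 1; 1]].

Definition seg_6_10_f : seq move :=
  [:: Attach false [:: 2; 0; 3; 2; 2; 0; 3; 2; 1; 1; 1; 3; 3; 3];
    Attach false [:: 2; 0; 1; 2; 2; 0; 1; 2; 1; 3; 2; 1; 3; 3];
    Repeat 1 true [:: 2; 0; 3; 1; 3; 0; 1; 2; 1; 1; 3; 3; 2; 2];
    Attach false [:: 2; 0; 3; 1; 3; 0; 2; 1; 1; 2; 2; 2; 3; 3];
    Attach false [:: 1; 0; 3; 1; 1; 0; 3; 1; 3; 2; 2; 3; 1; 1]].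

Definition seg_10_10_f : seq move :=
  [:: Attach false [:: 2; 0; 3; 2; 2; 0; 3; 2; 0; 1; 1; 1; 3; 3];
    Repeat 1 false [:: 2; 1; 3; 2; 2; 1; 3; 2; 0; 1; 1; 0; 3; 3];
    Attach false [:: 2; 1; 2; 3; 2; 1; 2; 3; 3; 1; 1; 0; 3; 3];
    Attach false [:: 1; 0; 2; 2; 1; 0; 2; 2; 1; 3; 2; 1; 3; 3];
    Repeat 2 true [:: 2; 0; 3; 1; 3; 0; 1; 2; 1; 1; 3; 3; 2; 2];
    Attach false [:: 2; 0; 3; 1; 3; 0; 2; 1; 1; 2; 2; 2; 3; 3];
    Attach false [:: 1; 0; 3; 1; 1; 0; 3; 1; 3; 2; 2; 3; 1; 1]].

Definition seg_10_10_t : seq move :=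
  [:: Attach false [:: 2; 0; 3; 2; 3; 0; 2; 2; 2; 1; 1; 1; 3; 3];
    Attach true [:: 0; 1; 2; 3; 0; 1; 3; 2; 3; 2; 2; 0; 1; 1];
    Attach true [:: 2; 1; 3; 3; 3; 1; 3; 2; 1; 0; 0; 1; 2; 2];
    Attach false [:: 2; 1; 3; 3; 1; 3; 3; 2; 3; 1; 2; 0; 2; 2];
    Attach false [:: 1; 0; 3; 1; 1; 0; 3; 1; 3; 2; 2; 3; 1; 1]].

Definition seg_10_14_t : seq move :=
  [:: Attach false [:: 2; 0; 3; 2; 3; 0; 2; 2; 1; 2; 1; 1; 3; 3];
    Repeat 1 true [:: 1; 0; 3; 2; 2; 0; 3; 1; 1; 3; 3; 1; 2; 2];
    Attach false [:: 0; 1; 2; 3; 2; 0; 3; 1; 2; 3; 0; 2; 1; 1];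
    Attach true [:: 1; 3; 3; 2; 3; 1; 2; 3; 3; 1; 1; 0; 2; 2];
    Repeat 2 true [:: 1; 0; 3; 2; 2; 0; 3; 1; 1; 3; 3; 1; 2; 2];
    Attach true [:: 1; 0; 3; 2; 2; 0; 3; 1; 0; 2; 1; 1; 2; 3];
    Attach false [:: 2; 1; 3; 2; 3; 1; 3; 3; 1; 2; 2; 0; 3; 2];
    Attach false [:: 1; 0; 3; 1; 1; 0; 3; 1; 3; 2; 2; 3; 1; 1]].

Definition start2_8_init : seq nat := [:: 1; 2; 2; 1; 2; 1].

Definition start2_8_first : seq nat := [:: 2; 0; 3; 3; 0; 3; 3; 2; 2; 1; 1; 1; 3; 0].

Definition start2_8 : option state :=
  obind (run [:: Attach true [:: 2; 1; 2; 3; 3; 1; 2; 2; 1; 3; 3; 0; 1; 1]]) (start start2_8_init start2_8_first true).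

Definition start2_12_init : seq nat := [:: 1; 2; 2; 1; 2; 1].

Definition start2_12_first : seq nat := [:: 2; 0; 3; 3; 3; 2; 3; 0; 1; 2; 1; 1; 3; 2].

Definition start2_12 : option state :=
  obind (run [:: Repeat 1 true [:: 1; 0; 3; 2; 2; 0; 3; 1; 1; 3; 3; 1; 2; 2];
    Attach true [:: 0; 1; 2; 3; 2; 0; 3; 1; 3; 2; 0; 3; 1; 1];
    Attach true [:: 2; 1; 2; 3; 3; 1; 2; 2; 1; 3; 3; 0; 1; 1]]) (start start2_12_init start2_12_first false).

Definition start0_6_6_init : seq nat := [:: 1; 3; 3; 1; 1; 3].

Definition start0_6_6_first : seq nat := [:: 2; 0; 2; 1; 2; 1; 0; 2; 1; 0; 3; 1; 3; 3].

Definition start0_6_6 : option state :=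
  obind (run [:: Attach true [:: 2; 1; 2; 3; 3; 1; 2; 2; 1; 3; 3; 0; 1; 1]]) (start start0_6_6_init start0_6_6_first true).

Definition start1_10_init : seq nat := [:: 2; 3; 3; 2; 3; 0].

Definition start1_10_first : seq nat := [:: 1; 1; 2; 3; 2; 1; 3; 1; 0; 3; 2; 0; 3; 1].

Definition start1_10 : option state :=
  obind (run [:: Attach true [:: 2; 1; 2; 3; 3; 1; 2; 2; 1; 3; 3; 0; 1; 1]]) (start start1_10_init start1_10_first false).

Definition start1_14_init : seq nat := [:: 2; 3; 3; 2; 3; 0].

Definition start1_14_first : seq nat := [:: 1; 1; 2; 3; 2; 1; 3; 1; 3; 0; 0; 2; 3; 1].

Definition start1_14 : option state :=
  obind (run [:: Repeat 1 false [:: 2; 1; 3; 2; 2; 1; 3; 2; 0; 1; 1; 0; 3; 3];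
    Attach false [:: 2; 1; 3; 2; 2; 1; 2; 3; 0; 1; 1; 0; 3; 3];
    Attach true [:: 2; 1; 2; 3; 3; 1; 2; 2; 1; 3; 3; 0; 1; 1]]) (start start1_14_init start1_14_first true).

Definition start4_6_init : seq nat := [:: 1; 3; 3; 1; 2; 3].

Definition start4_6_first : seq nat := [:: 2; 0; 2; 1; 2; 1; 0; 2; 1; 0; 3; 1; 3; 3].

Definition start4_6 : option state :=
  obind (run [:: Attach true [:: 2; 1; 2; 3; 3; 1; 2; 2; 1; 3; 3; 0; 1; 1]]) (start start4_6_init start4_6_first true).

Definition end2_8_t : seq move * seq nat :=
  ([:: Attach true [:: 2; 0; 3; 2; 3; 0; 2; 2; 1; 2; 2; 1; 1; 3]],
    [:: 0; 1; 1; 3; 3; 0; 3; 3]).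

Definition end2_8_f : seq move * seq nat :=
  ([:: Attach false [:: 2; 0; 3; 2; 2; 0; 3; 2; 1; 3; 1; 1; 2; 2]],
    [:: 0; 1; 3; 3; 3; 0; 1; 3]).

Definition end2_12_t : seq move * seq nat :=
  ([:: Attach true [:: 2; 0; 3; 2; 3; 0; 2; 2; 0; 1; 1; 1; 3; 3];
    Repeat 1 false [:: 2; 1; 3; 2; 2; 1; 3; 2; 0; 1; 1; 0; 3; 3];
    Attach true [:: 2; 1; 3; 2; 2; 1; 3; 2; 1; 2; 2; 0; 1; 3]],
    [:: 0; 1; 1; 3; 3; 0; 3; 3]).

Definition end2_12_f : seq move * seq nat :=
  ([:: Attach true [:: 2; 0; 3; 2; 2; 0; 3; 2; 0; 1; 1; 1; 2; 3];
    Repeat 1 true [:: 2; 1; 3; 2; 3; 1; 3; 3; 0; 2; 2; 0; 1; 1];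
    Attach true [:: 2; 1; 3; 2; 3; 1; 3; 3; 1; 2; 2; 0; 1; 2]],
    [:: 0; 1; 1; 3; 3; 0; 3; 3]).

Definition end0_t : seq move * seq nat :=
  ([::],
    [:: 0; 2; 2; 3; 3; 0; 2; 2]).

Definition end0_f : seq move * seq nat :=
  ([::],
    [:: 0; 2; 3; 2; 2; 0; 2; 3]).

Definition end1_10_t : seq move * seq nat :=
  ([:: Attach false [:: 2; 0; 3; 2; 3; 0; 2; 2; 1; 2; 1; 1; 3; 3];
    Attach true [:: 1; 0; 3; 2; 2; 0; 3; 1; 1; 2; 2; 3; 3; 3]],
    [:: 0; 1; 1; 2; 2; 0; 1; 1]).

Definition end1_10_f : seq move * seq nat :=
  ([:: Attach false [:: 2; 0; 3; 2; 2; 0; 3; 2; 0; 1; 1; 1; 3; 3];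
    Attach false [:: 2; 1; 2; 3; 1; 2; 3; 2; 1; 3; 2; 0; 3; 3]],
    [:: 0; 1; 1; 2; 2; 0; 1; 1]).

Definition end1_14_t : seq move * seq nat :=
  ([:: Attach true [:: 2; 0; 3; 2; 3; 0; 2; 2; 0; 1; 1; 1; 3; 3];
    Repeat 1 false [:: 2; 1; 3; 2; 2; 1; 3; 2; 0; 1; 1; 0; 3; 3];
    Attach false [:: 2; 1; 3; 2; 2; 1; 3; 2; 1; 2; 1; 0; 3; 3];
    Attach true [:: 1; 0; 3; 2; 2; 0; 3; 1; 1; 2; 2; 3; 3; 3]],
    [:: 0; 1; 1; 2; 2; 0; 1; 1]).

Definition end1_14_f : seq move * seq nat :=
  ([:: Attach true [:: 2; 0; 3; 2; 2; 0; 3; 2; 0; 1; 1; 1; 2; 3];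
    Repeat 1 true [:: 2; 1; 3; 2; 3; 1; 3; 3; 0; 2; 2; 0; 1; 1];
    Attach false [:: 2; 1; 3; 2; 3; 1; 3; 3; 1; 2; 1; 0; 3; 2];
    Attach true [:: 1; 0; 3; 2; 2; 0; 3; 1; 1; 2; 2; 3; 3; 3]],
    [:: 0; 1; 1; 2; 2; 0; 1; 1]).

Definition end4_10_t : seq move * seq nat :=
  ([:: Attach false [:: 2; 0; 3; 2; 3; 0; 2; 2; 2; 1; 1; 1; 3; 3]],
    [:: 0; 1; 2; 3; 1; 0; 3; 2]).

Definition end4_10_f : seq move * seq nat :=
  ([:: Attach false [:: 2; 0; 3; 2; 2; 0; 3; 2; 2; 1; 1; 1; 3; 3]],
    [:: 0; 1; 2; 3; 1; 0; 3; 2]).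

Definition end4_14_t : seq move * seq nat :=
  ([:: Attach true [:: 2; 0; 3; 2; 3; 0; 2; 2; 0; 1; 1; 1; 3; 3];
    Repeat 1 false [:: 2; 1; 3; 2; 2; 1; 3; 2; 0; 1; 1; 0; 3; 3];
    Attach false [:: 2; 1; 3; 2; 2; 1; 3; 2; 2; 1; 1; 0; 3; 3]],
    [:: 0; 1; 2; 3; 1; 0; 3; 2]).

Definition end4_14_f : seq move * seq nat :=
  ([:: Attach true [:: 2; 0; 3; 2; 2; 0; 3; 2; 0; 1; 1; 1; 2; 3];
    Repeat 1 true [:: 2; 1; 3; 2; 3; 1; 3; 3; 0; 2; 2; 0; 1; 1];
    Attach false [:: 2; 1; 3; 2; 3; 1; 3; 3; 2; 1; 1; 0; 3; 2]],
    [:: 0; 1; 2; 3; 1; 0; 3; 2]).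

Definition whole_8_init : seq nat := [:: 0; 1; 1; 0; 2; 1].

Definition whole_8_first : seq nat := [:: 2; 2; 3; 3; 3; 2; 3; 2; 0; 1; 1; 0; 1; 2].

Definition whole_8 : option (seq (seq form)) :=
  obind (conclude ([::],
    [:: 1; 2; 3; 1; 2; 3; 3; 3])) (start whole_8_init whole_8_first true).

Definition whole_12_init : seq nat := [:: 0; 1; 1; 0; 2; 1].

Definition whole_12_first : seq nat := [:: 2; 2; 3; 3; 3; 2; 3; 2; 0; 1; 1; 0; 1; 2].

Definition whole_12 : option (seq (seq form)) :=
  obind (conclude ([:: Repeat 1 true [:: 1; 2; 3; 1; 3; 2; 3; 3; 1; 0; 0; 1; 2; 2];
    Attach true [:: 1; 2; 3; 1; 3; 2; 3; 3; 1; 0; 0; 1; 2; 2]],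
    [:: 1; 2; 3; 1; 2; 3; 3; 3])) (start whole_12_init whole_12_first true).

Definition start_4_4_init : seq nat := [:: 0; 1; 1; 0; 1; 1].

Definition start_4_4_first : seq nat := [:: 2; 2; 3; 3; 2; 2; 3; 3; 0; 1; 1; 0; 1; 1].

Definition start_4_4 : option state :=
  obind (run [::]) (start start_4_4_init start_4_4_first true).

Definition seg_4_small : seq move := [:: Attach true [:: 2; 2; 2; 2; 3; 3; 3; 3; 0; 1; 1; 0; 1; 1]].

Definition end_4_small : seq move * seq nat :=
  ([::],
    [:: 2; 2; 2; 2; 3; 3; 3; 3]).

Definition start_4_8_init : seq nat := [:: 0; 1; 1; 0; 1; 1].

Definition start_4_8_first : seq nat := [:: 2; 2; 3; 3; 2; 3; 2; 3; 3; 0; 0; 2; 1; 1].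

Definition start_4_8 : option state :=
  obind (run [:: Attach true [:: 1; 2; 2; 1; 1; 3; 3; 1; 0; 1; 1; 0; 2; 3]]) (start start_4_8_init start_4_8_first true).

Definition start_4_12_init : seq nat := [:: 1; 1; 1; 1; 0; 2].

Definition start_4_12_first : seq nat := [:: 2; 0; 3; 3; 3; 2; 3; 0; 1; 2; 1; 1; 3; 2].

Definition start_4_12 : option state :=
  obind (run [:: Repeat 1 true [:: 1; 0; 3; 2; 2; 0; 3; 1; 1; 3; 3; 1; 2; 2];
    Attach true [:: 0; 1; 2; 3; 2; 0; 3; 1; 1; 3; 0; 2; 2; 3];
    Attach true [:: 1; 2; 2; 1; 1; 3; 3; 1; 0; 1; 1; 0; 2; 3]]) (start start_4_12_init start_4_12_first false).

(** * From the start of the ladder to its end *)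

Lemma reached_four n P h Os L : reached true P h Os L -> reached true P h Os (nseq n 4 ++ L).
Proof.
move=> H; elim: n => // n IH.
by apply: (reached_segment 0 0 (ms := seg_4_t) (X := [:: [:: 4]])) IH; vm_compute.
Qed.

Lemma reached_even b P h Os L e : even_long e ->
  reached b P h Os L -> reached false P h Os (e :: L).
Proof.
move=> /even_longP[->|[i ->]] H.
  case: b H => H.
    by apply: (reached_segment 0 0 (ms := seg_8_t) (X := [:: [:: 8]])) H; vm_compute.
  by apply: (reached_segment 0 0 (ms := seg_8_f) (X := [:: [:: 8]])) H; vm_compute.
have -> : 12 + 4 * i = fval [:: 1; i; 0; h] [:: 12; 4] by rewrite /=; lia.
case: b H => H.
  by apply: (reached_segment i 0 (ms := seg_12_t) (X := [:: [:: 12; 4]])) H; vm_compute.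
by apply: (reached_segment i 0 (ms := seg_12_f) (X := [:: [:: 12; 4]])) H; vm_compute.
Qed.

(** Both interfaces leave 0, 4 and 2 vertices open in the three factors, apart from the paths
    through the slots 0 and 1. A group thus has a total length divisible by 4, and lengths 2 mod 4
    go two at a time. *)
Lemma reached_pair b P h Os L o1 o2 : odd_long o1 -> odd_long o2 ->
  reached b P h Os L -> exists b', reached b' P h Os (o1 :: o2 :: L).
Proof.
wlog Hle : o1 o2 / o1 <= o2.
  move=> W H1 H2 H; have [Hle|/ltnW Hle] := leqP o1 o2; first exact: W.
  have [b' Hb'] := W _ _ Hle H2 H1 H; exists b'.
  by apply: reached_perm Hb'; rewrite -[X in perm_eq X _]/([:: o2] ++ [:: o1] ++ L) perm_catCA.
move=> /odd_longP[E1|[i E1]] /odd_longP[E2|[j E2]] H; last 1 first.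
- subst o1 o2; case: b H => H.
    case: j Hle => [|j] Hle.
      have -> : i = 0 by lia.
      by exists false; apply: (reached_segment 0 0 (ms := seg_10_10_t) (X := [:: [:: 10]; [:: 10]])) H;
        vm_compute.
    have -> : 10 + 4 * i = fval [:: 1; i; j; h] [:: 10; 4] by rewrite /=; lia.
    have -> : 10 + 4 * j.+1 = fval [:: 1; i; j; h] [:: 14; 0; 4] by rewrite /=; lia.
    by exists false; apply: (reached_segment i j (ms := seg_10_14_t)
      (X := [:: [:: 10; 4]; [:: 14; 0; 4]])) H; vm_compute.
  have -> : 10 + 4 * i = fval [:: 1; i; j; h] [:: 10; 4] by rewrite /=; lia.
  have -> : 10 + 4 * j = fval [:: 1; i; j; h] [:: 10; 0; 4] by rewrite /=; lia.
  by exists false; apply: (reached_segment i j (ms := seg_10_10_f)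
    (X := [:: [:: 10; 4]; [:: 10; 0; 4]])) H; vm_compute.
- subst o1 o2; case: b H => H.
    by exists true; apply: (reached_segment 0 0 (ms := seg_6_6_t) (X := [:: [:: 6]; [:: 6]])) H; vm_compute.
  by exists false; apply: (reached_segment 0 0 (ms := seg_6_6_f) (X := [:: [:: 6]; [:: 6]])) H; vm_compute.
- rewrite E1; have -> : o2 = fval [:: 1; j; 0; h] [:: 10; 4] by rewrite E2 /=; lia.
  exists false; case: b H => H.
    by apply: (reached_segment j 0 (ms := seg_6_10_t) (X := [:: [:: 6]; [:: 10; 4]])) H; vm_compute.
  by apply: (reached_segment j 0 (ms := seg_6_10_f) (X := [:: [:: 6]; [:: 10; 4]])) H; vm_compute.
- by move: Hle; rewrite E1 E2; lia.
Qed.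

Lemma reached_all b P h Os L E Q : all even_long E -> all odd_long Q -> ~~ odd (size Q) ->
  reached b P h Os L -> exists b', reached b' P h Os (E ++ Q ++ L).
Proof.
move=> HE HO Hodd H.
have [b1 {}H] : exists b1, reached b1 P h Os (Q ++ L).
  elim: {Q}(size Q) {-2}Q (leqnn (size Q)) HO Hodd => [|n IH] Q Hn HO Hodd.
    by case: Q Hn HO Hodd => // _ _ _; exists b.
  case: Q Hn HO Hodd => [|o1 [|o2 Q]] //=; first by exists b.
  rewrite negbK => Hn /and3P[H1 H2 H3] H4.
  have [|b1 H5] := IH Q _ H3 H4; first lia.
  exact: reached_pair H1 H2 H5.
elim: E HE => [|e E IH] /=; first by exists b1.
by case/andP=> He /IH [b2 /(reached_even He) ?]; exists false.
Qed.

Lemma reached_conclude i b P h Os L C mt Ls :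
  conclude mt (node b P) = Some Ls ->
  all (fun OL => perm_eq (OL.1 ++ map (fval [:: 1; i; 0; h]) OL.2) C) (zip Os Ls) ->
  reached b P h Os L -> ladder_splits (nseq (size Os) (C ++ L)).
Proof.
move=> HL HC [HP HS].
have {}HS := config_evaluate (evaluate_node 0 0 h i 0 b HP) HS.
have [||] := config_conclude _ _ HS HL => //; rewrite size_map => Hsz.
apply: ladder_splits_perm; elim: Os Ls Hsz HC {HS HL} => [|Q Os IH] [|X Ls] //= [Hsz].
case/andP=> HX HLs; rewrite IH // andbT -catA perm_catC perm_cat2r //.
Qed.

Definition starts (o : option state) T Cs :=
  if o is Some S0 then (erase S0 == T) && (closed S0 == Cs) else false.

Lemma config_starts r t t' f ms T Cs : head 0 r = 1 -> size r = 4 ->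
  starts (obind (run ms) (start t t' f)) T Cs ->
  config r [seq map (fval r) C | C <- Cs] T.
Proof.
move=> Hr Hs; rewrite /starts; case E: (start t t' f) => [S|] //=.
case E': (run ms S) => [S'|] // /andP[/eqP <- /eqP <-].
have H := config_run Hr Hs (config_start Hr E) E'.
have := config_erase H; have := config_size H.
rewrite -(size_map (fun F : fstate => F.2)) -/(closed S').
by case: (closed S') => [|C1 [|C2 [|C3 [|]]]].
Qed.

Lemma start_even e : even_long e -> reached true closing2 0 [:: [:: e]; [:: e]; [:: e]] [::].
Proof.
move=> /even_longP[->|[i ->]]; split=> //=.
  have /config_starts H : starts start2_8 (node true closing2) (nseq 3 [:: [:: 8]]) by vm_compute.
  by apply: (config_evaluate _ (H [:: 1; 0; 0; 0] erefl erefl)).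
have /config_starts H : starts start2_12 (node true closing2) (nseq 3 [:: [:: 12; 4]]) by vm_compute.
have := config_evaluate (evaluate_node i 0 0 0 0 true _) (H [:: 1; i; 0; 0] erefl erefl).
by move=> /(_ isT) /=; rewrite !muln1 !addn0.
Qed.

Lemma start_six_six : reached true closing0 0 [:: [:: 6; 6]; [:: 6]; [:: 6]] [::].
Proof.
split=> //.
have /config_starts H : starts start0_6_6 (node true closing0)
  [:: [:: [:: 6]; [:: 6]]; [:: [:: 6]]; [:: [:: 6]]] by vm_compute.
exact: (H [:: 1; 0; 0; 0]).
Qed.

Lemma start_six : reached true closing4 0 [:: [:: 6]; [:: 6]; [:: 6]] [::].
Proof.
split=> //.
have /config_starts H : starts start4_6 (node true closing4) (nseq 3 [:: [:: 6]]) by vm_compute.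
exact: (H [:: 1; 0; 0; 0]).
Qed.

(* The second 2-factor keeps a path with l - 2 vertices between 0 and 1, which
   becomes a cycle of length l only when the ladder is closed. *)
Lemma start_odd i (l := 10 + 4 * i) : reached true closing1 (8 + 4 * i) [:: [:: l]; [::]; [:: l]] [::].
Proof.
split=> //; rewrite /l; case: i {l} => [|i].
  have /config_starts H : starts start1_10
    ([:: 0; 1; 2; 4], [:: (singletons, [::]);
       ([:: (0, 1, [:: 8]); (2, 3, [:: 3]); (5, 5, [:: 1])], [::]);
       ([:: (3, 4, [:: 2])], [::])])
    [:: [:: [:: 10]]; [::]; [:: [:: 10]]] by vm_compute.
  exact: (config_evaluate _ (H [:: 1; 0; 0; 0] erefl erefl)).
have /config_starts H : starts start1_14
    ([:: 0; 1; 2; 4], [:: (singletons, [::]);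
       ([:: (0, 1, [:: 12; 4]); (2, 3, [:: 3]); (5, 5, [:: 1])], [::]);
       ([:: (3, 4, [:: 2])], [::])])
    [:: [:: [:: 14; 4]]; [::]; [:: [:: 14; 4]]] by vm_compute.
have := H [:: 1; i; 0; 0] erefl erefl.
have E : 14 * 1 + (4 * i + 0) = 10 + 4 * i.+1 by lia.
rewrite [map _ _]/= E; apply: config_evaluate; rewrite /evaluate /=.
by have -> : 12 * 1 + (4 * i + 0) = 0 * 1 + (0 * 0 + (0 * 0 + (1 * (8 + 4 * i.+1) + 0))) by lia.
Qed.

Lemma finish_even b Os L e : even_long e -> size Os = 3 ->
  all (perm_eq^~ (head [::] Os)) Os -> reached b closing2 0 Os L ->
  ladder_splits (nseq 3 ((head [::] Os ++ [:: e]) ++ L)).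
Proof.
case: Os => [|O1 [|O2 [|O3 []]]] // He _ /= /and4P[_ H2 H3 _] H.
have go i f mt : fval [:: 1; i; 0; 0] f = e ->
    conclude mt (node b closing2) = Some (nseq 3 [:: f]) ->
    ladder_splits (nseq 3 ((O1 ++ [:: e]) ++ L)).
  move=> Ef HL; apply: (reached_conclude (i := i) HL) H.
  by rewrite /= Ef !perm_cat2r H2 H3 perm_refl.
case: (even_longP He) => [E|[i E]].
  case: b go {H} => go.
    by apply: (go 0 [:: 8] end2_8_t); [rewrite E|vm_compute].
  by apply: (go 0 [:: 8] end2_8_f); [rewrite E|vm_compute].
case: b go {H} => go.
  by apply: (go i [:: 12; 4] end2_12_t); [rewrite E /=; lia|vm_compute].
by apply: (go i [:: 12; 4] end2_12_f); [rewrite E /=; lia|vm_compute].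
Qed.

Lemma finish_six_six b L : reached b closing0 0 [:: [:: 6; 6]; [:: 6]; [:: 6]] L ->
  ladder_splits (nseq 3 ([:: 6; 6] ++ L)).
Proof.
case: b => H.
  by apply: (reached_conclude (i := 0) (mt := end0_t) (Ls := [:: [::]; [:: [:: 6]]; [:: [:: 6]]])) H;
    vm_compute.
by apply: (reached_conclude (i := 0) (mt := end0_f) (Ls := [:: [::]; [:: [:: 6]]; [:: [:: 6]]])) H;
  vm_compute.
Qed.

Lemma finish_six b L j : reached b closing4 0 [:: [:: 6]; [:: 6]; [:: 6]] L ->
  ladder_splits (nseq 3 ([:: 6; 10 + 4 * j] ++ L)).
Proof.
have go i f mt : fval [:: 1; i; 0; 0] f = 10 + 4 * j ->
    conclude mt (node b closing4) = Some (nseq 3 [:: f]) ->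
    reached b closing4 0 [:: [:: 6]; [:: 6]; [:: 6]] L ->
    ladder_splits (nseq 3 ([:: 6; 10 + 4 * j] ++ L)).
  by move=> Ef HL H; apply: (reached_conclude (i := i) HL) H; rewrite /= Ef perm_refl.
case: b go; case: j => [|j] go.
- by apply: (go 0 [:: 10] end4_10_t); [|vm_compute].
- by apply: (go j [:: 14; 4] end4_14_t); [rewrite /=; lia|vm_compute].
- by apply: (go 0 [:: 10] end4_10_f); [|vm_compute].
- by apply: (go j [:: 14; 4] end4_14_f); [rewrite /=; lia|vm_compute].
Qed.

Lemma finish_odd b L i j (l := 10 + 4 * i) :
  reached b closing1 (8 + 4 * i) [:: [:: l]; [::]; [:: l]] L ->
  ladder_splits (nseq 3 ([:: l; 10 + 4 * j] ++ L)).
Proof.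
have go k f mt : fval [:: 1; k; 0; 8 + 4 * i] f = 10 + 4 * j ->
    conclude mt (node b closing1) = Some [:: [:: f]; [:: [:: 2; 0; 0; 1]; f]; [:: f]] ->
    reached b closing1 (8 + 4 * i) [:: [:: l]; [::]; [:: l]] L ->
    ladder_splits (nseq 3 ([:: l; 10 + 4 * j] ++ L)).
  move=> Ef HL H; apply: (reached_conclude (i := k) HL) H.
  have El : 2 * 1 + (0 * k + (0 * 0 + (1 * (8 + 4 * i) + 0))) = l by rewrite /l; lia.
  by rewrite /= Ef El !perm_refl.
case: b go; case: j => [|j] go.
- by apply: (go 0 [:: 10] end1_10_t); [|vm_compute].
- by apply: (go j [:: 14; 4] end1_14_t); [rewrite /=; lia|vm_compute].
- by apply: (go 0 [:: 10] end1_10_f); [|vm_compute].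
- by apply: (go j [:: 14; 4] end1_14_f); [rewrite /=; lia|vm_compute].
Qed.

(* An interface through which only 4-cycles are passed. *)
Definition small_node : state :=
  ([::], [:: ([::], [::]); (singletons ++ [:: (2, 2, [:: 1]); (3, 3, [:: 1])], [::]);
             (singletons ++ [:: (4, 4, [:: 1]); (5, 5, [:: 1])], [::])]).

(** The first factor stays one 4-cycle ahead of the two others, which catch up at the end. *)
Lemma small_splits n i C (f : form) (c := fval [:: 1; i; 0; 0] f) :
  config [:: 1; i; 0; 0] C small_node -> C = [:: [:: c; 4]; [:: c]; [:: c]] ->
  ladder_splits (nseq 3 ([:: 4; c] ++ nseq n 4)).
Proof.
move=> HS EC; rewrite {}EC in HS.
have {HS} : config [:: 1; i; 0; 0] [seq nseq n 4 ++ B | B <- [:: [:: c; 4]; [:: c]; [:: c]]] small_node.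
  elim: n => // n IH.
  have H : segment seg_4_small small_node small_node [:: [:: 4]] by vm_compute.
  exact: (@config_segment [:: 1; i; 0; 0] _ _ _ _ _ erefl erefl H IH).
move=> HS; have HL : conclude end_4_small small_node = Some [:: [::]; [:: [:: 4]]; [:: [:: 4]]].
  by vm_compute.
have [||_] := config_conclude _ _ HS HL => //; apply: ladder_splits_perm.
have H4 (B B' : seq nat) : perm_eq (B ++ B') [:: 4; c] ->
    perm_eq ((nseq n 4 ++ B) ++ B') ([:: 4; c] ++ nseq n 4).
  by move=> H; rewrite -catA perm_catC perm_cat2r.
by rewrite [zip _ _]/= [map _ [:: _; _; _]]/= /= !H4 // (perm_catC [:: c] [:: 4]).
Qed.

Lemma splits_at_once r t t' f mt Ls : head 0 r = 1 -> size r = 4 ->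
  obind (conclude mt) (start t t' f) = Some Ls -> ladder_splits (map (map (fval r)) Ls).
Proof.
move=> Hr Hs; case E: (start t t' f) => [S|] //= E'.
have [] := config_conclude Hr Hs (config_start Hr E) E'.
by case: Ls {E'} => [|C1 [|C2 [|C3 [|]]]].
Qed.

(** Two entries are set aside for the start and the end of the ladder: two that are 2 mod 4 if there
    are any, otherwise two of at least 8 divisible by 4. In the remaining cases at most one entry
    differs from 4: either it is the only entry and the whole ladder is done at once, or the
    4-cycles pass through [small_node]. *)
Lemma ladder_splits_all L : all (leq 4) L -> all (predC odd) L ->
  sumn L %% 4 = 0 -> 8 <= sumn L -> ladder_splits (nseq 3 L).
Proof.
move=> H4 Heven Hmod Hsum.
pose E := filter even_long L; pose Q := filter odd_long L; pose n := count_mem 4 L.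
have HL : perm_eq L (E ++ Q ++ nseq n 4).
  rewrite /E /Q /n; elim: L H4 Heven {Hmod Hsum E Q n} => //= l L IH /andP[l4 H4] /andP[le He].
  have {}IH := IH H4 He.
  have insert X Y : perm_eq L (X ++ Y) -> perm_eq (l :: L) (X ++ l :: Y).
    by move=> H; rewrite -[l :: Y]/([:: l] ++ Y) perm_sym perm_catCA perm_cons perm_sym.
  have [E4|N4] := eqVneq l 4.
    by rewrite E4 /= catA -E4; apply: insert; rewrite -catA E4.
  have [Hl|Hl] := boolP (even_long l).
    have -> : odd_long l = false by move: Hl; rewrite /even_long /odd_long; lia.
    by rewrite /= perm_cons.
  have -> : odd_long l by move: Hl N4 le l4; rewrite /even_long /odd_long /=; lia.
  exact: insert.
have HE : all even_long E by apply: filter_all.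
have HQ : all odd_long Q by apply: filter_all.
have HQodd : ~~ odd (size Q).
  have HsE : sumn E %% 4 = 0.
    by elim: (E) HE => //= e E' IH /andP[/andP[_ /eqP He] /IH H]; lia.
  have HsQ : sumn Q = (size Q).*2 %[mod 4].
    by elim: (Q) HQ => //= e E' IH /andP[/andP[_ /eqP He] /IH H]; lia.
  move: Hmod; rewrite (perm_sumn HL) !sumn_cat sumn_nseq; lia.
suff : ladder_splits (nseq 3 (E ++ Q ++ nseq n 4)).
  by apply: ladder_splits_perm; rewrite /= !(perm_sym _ L) !HL.
have targets X Y : perm_eq X Y -> ladder_splits (nseq 3 X) -> ladder_splits (nseq 3 Y).
  by move=> H; apply: ladder_splits_perm; rewrite /= !H.
move: E Q HE HQ HQodd HL => {}E {}Q HE HQ HQodd HL.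
case: Q HQ HQodd HL => [|q1 [|q2 Q]] //= HQ HQodd HL; last first.
  case/and3P: HQ => H1 H2 HQ; rewrite negbK in HQodd.
  have rest b P h Os : reached b P h Os [::] -> b ->
      exists b', reached b' P h Os (E ++ Q ++ nseq n 4).
    (* 4-cycles go right after the start: they need [node true], and the longer groups may lead to
       [node false], which is never left again. *)
    case: b => // H _; have := reached_four n H; rewrite cats0.
    exact: reached_all.
  apply: (targets ([:: q1; q2] ++ (E ++ Q ++ nseq n 4))).
    by rewrite perm_catCA.
  wlog Hle : q1 q2 H1 H2 {HL} / q1 <= q2.
    move=> W; have [|/ltnW] := leqP q1 q2; first exact: W.
    move/(W q2 q1 H2 H1); apply: targets.
    by rewrite perm_cat2r (perm_catC [:: q2] [:: q1]).
  case: (odd_longP H1) => [E1|[i E1]]; case: (odd_longP H2) => [E2|[j E2]].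
  - subst q1 q2; have [b] := rest _ _ _ _ start_six_six isT.
    exact: finish_six_six.
  - subst q1 q2; have [b] := rest _ _ _ _ start_six isT.
    exact: finish_six.
  - by move: Hle; rewrite E1 E2; lia.
  - subst q1 q2; have [b] := rest _ _ _ _ (start_odd i) isT.
    exact: finish_odd.
case: E HE HL => [|e1 [|e2 E]] HE HL.
- have n2 : 2 <= n.
    by move: Hsum; rewrite (perm_sumn HL) /= sumn_nseq; lia.
  have /config_starts H : starts start_4_4 small_node
    [:: [:: [:: 4]; [:: 4]]; [:: [:: 4]]; [:: [:: 4]]] by vm_compute.
  have En : nseq n 4 = [:: 4; 4] ++ nseq (n - 2) 4 by rewrite -{1}(subnKC n2).
  rewrite En; exact: (small_splits (n - 2) (f := [:: 4]) (H [:: 1; 0; 0; 0] erefl erefl) erefl).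
- case/andP: HE => He _; have [n0|] := posnP n.
    rewrite n0 /=; case: (even_longP He) => [->|[i ->]].
      have H : whole_8 = Some (nseq 3 [:: [:: 8]]) by vm_compute.
      exact: (splits_at_once (r := [:: 1; 0; 0; 0]) erefl erefl H).
    have H : whole_12 = Some (nseq 3 [:: [:: 12; 4]]) by vm_compute.
    have := splits_at_once (r := [:: 1; i; 0; 0]) erefl erefl H.
    by rewrite /= muln1 addn0.
  case En : n => [//|m] _.
  apply: (targets ([:: 4; e1] ++ nseq m 4)).
    by rewrite -[X in perm_eq X _]/([:: 4] ++ [:: e1] ++ nseq m 4) perm_catCA.
  case: (even_longP He) => [->|[i ->]].
    have /config_starts H : starts start_4_8 small_node
      [:: [:: [:: 8]; [:: 4]]; [:: [:: 8]]; [:: [:: 8]]] by vm_compute.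
    exact: (small_splits m (f := [:: 8]) (H [:: 1; 0; 0; 0] erefl erefl) erefl).
  have /config_starts H : starts start_4_12 small_node
    [:: [:: [:: 12; 4]; [:: 4]]; [:: [:: 12; 4]]; [:: [:: 12; 4]]] by vm_compute.
  have := small_splits m (f := [:: 12; 4]) (H [:: 1; i; 0; 0] erefl erefl) erefl.
  by rewrite /= muln1 addn0.
case/and3P: HE => H1 H2 HE.
have := reached_four n (start_even H1); rewrite cats0 => /(reached_all HE (isT : all odd_long [::]) isT).
case=> b H; apply: (targets ([:: e1; e2] ++ (E ++ [::] ++ nseq n 4))); first by [].
by apply: (finish_even H2 _ _ H); rewrite //= perm_refl.
Qed.

(** * Adjacency under rotation and reversal of a cycle *)

Lemma cadj_rot (T : eqType) k (c : seq T) x y : cadj (rot k c) x y -> cadj c x y.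
Proof.
have [Hk|/ltnW/rot_oversize->//] := leqP k (size c).
case=> i [s E]; have [Hi|/ltnW Hi] := leqP i (size c).
  by move: E; rewrite rot_add_mod //; case: ifP => _ E; [exists (i + k)|exists (i + k - size c)]; exists s.
by move: E; rewrite rot_oversize ?size_rot // => E; exists k, s.
Qed.

Lemma cedge_rot (T : eqType) k (c : seq T) x y : cedge (rot k c) x y -> cedge c x y.
Proof. by case=> /cadj_rot; [left|right]. Qed.

Lemma cedge_rev (T : eqType) (c : seq T) x y : cedge (rev c) x y -> cedge c x y.
Proof.
have H a b : cadj (rev c) a b -> cadj c b a.
  case=> i [s E]; apply: (@cadj_rot _ (size (rev c) - i)).
  have -> : rot (size (rev c) - i) c = rev (rot i (rev c)).
    by rewrite rev_rot revK /rotr size_rev.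
  rewrite E; apply: cadj_path; apply: padj_rev; by exists [::], s.
by case=> /H; [right|left].
Qed.

Lemma padj_map_iota (g : nat -> nat) a n i : a <= i -> i.+1 < a + n ->
  padj (map g (iota a n)) (g i) (g i.+1).
Proof.
move=> Ha Hi; exists (map g (iota a (i - a))), (map g (iota i.+2 (a + n - i.+2))).
have En : n = (i - a) + (a + n - i.+2).+2 by lia.
by rewrite {1}En iotaD map_cat subnKC.
Qed.

Lemma perm_flatten_pairs (T : eqType) (f g : nat -> T) s :
  perm_eq (map f s ++ map g s) (flatten [seq [:: f i; g i] | i <- s]).
Proof.
elim: s => //= i s IH; rewrite perm_cons -[_ :: map g s]/([:: _] ++ _) perm_catCA.
by rewrite perm_cons.
Qed.

(** * Doubling Hamilton cycles *)

Section Haggkvist.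
Variable m : nat.
Implicit Types (f t : bool) (a r i : nat).

Definition column_vertex i (b : bool) := 2 * (i %% m) + b.

Definition track f t a r :=
  [seq column_vertex i (t (+) (f && odd i)) | i <- iota a.+1 r.-1].

(* A cycle of length 2r over the columns a, ..., a+r of C_m[2]: it has one
   vertex in each of the two extreme columns and two parallel tracks between
   them, which swap sides at each step when f holds. *)
Definition haggkvist_cycle f a r :=
  column_vertex a (~~ f) :: track f false a r ++
  column_vertex (a + r) f :: rev (track f true a r).

Fixpoint haggkvist_cycles f a rs :=
  if rs is r :: rs' then haggkvist_cycle f a r :: haggkvist_cycles f (a + r) rs' else [::].

Lemma track_edge f t a r i (g := fun i => column_vertex i
    (if i == a then ~~ f else if i == a + r then f else t (+) (f && odd i))) :
  1 < r -> a <= i < a + r -> cedge (haggkvist_cycle f a r) (g i) (g i.+1).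
Proof.
move=> r1 /andP[Ha Hi].
have Hin : map g (iota a.+1 r.-1) = track f t a r.
  apply/eq_in_map => j; rewrite mem_iota /g => Hj.
  have -> : (j == a) = false by lia.
  by have -> : (j == a + r) = false by lia.
have Hp : pedge (column_vertex a (~~ f) :: track f t a r ++ [:: column_vertex (a + r) f]) (g i) (g i.+1).
  left; rewrite -Hin.
  have -> : column_vertex a (~~ f) = g a by rewrite /g eqxx.
  have -> : column_vertex (a + r) f = g (a + r).
    rewrite /g eqxx.
    by have -> : (a + r == a) = false by lia.
  have -> : g a :: map g (iota a.+1 r.-1) ++ [:: g (a + r)] = map g (iota a r.+1).
    have Er : r.+1 = (1 + r.-1) + 1 by lia.
    by rewrite Er !iotaD !map_cat /= addn1; congr (_ :: _ ++ [:: g _]); lia.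
  by apply: padj_map_iota => //; lia.
case: t g Hin Hp => g _ Hp.
  (* This track is stored backwards; reversing and rotating the cycle brings it to the front. *)
  apply: cedge_rev; rewrite /haggkvist_cycle rev_cons rev_cat rev_cons revK.
  apply: (@cedge_rot _ (size (track f true a r ++ column_vertex (a + r) f :: rev (track f false a r)))).
  rewrite -cats1 cat_rcons rot_size_cat; apply: cedge_path.
  by rewrite -[_ :: rev _]cat1s cat1s -cat_rcons -cats1 /= -!catA /=;
     have := pedge_catl (rev (track f false a r)) Hp; rewrite /= -catA.
apply: cedge_path; rewrite /haggkvist_cycle -[_ :: rev _]cat1s catA.
by have := pedge_catl (rev (track f true a r)) Hp; rewrite /= .
Qed.

(** Between inner columns the tracks are straight for [f = false] and crossed for [f = true], so [f]
    is [b (+) c]. The cycle uses only the vertex [~~ f] of its first column and only [f] of its last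
    one, which determines [f] there. *)
Lemma haggkvist_cycle_edge a r i (b c : bool) : 1 < r -> a <= i < a + r ->
  exists f, cedge (haggkvist_cycle f a r) (column_vertex i b) (column_vertex i.+1 c).
Proof.
move=> r1 Hi.
have [Ei|Ni] := eqVneq i a.
  exists (~~ b); have := @track_edge (~~ b) (c (+) (~~ b && odd i.+1)) a r i r1 Hi.
  rewrite Ei eqxx negbK.
  have -> : (a.+1 == a) = false by lia.
  have -> : (a.+1 == a + r) = false by lia.
  by rewrite -addbA addbb addbF.
have [Ei'|Ni'] := eqVneq i.+1 (a + r).
  exists c; have := @track_edge c (b (+) (c && odd i)) a r i r1 Hi.
  rewrite (negbTE Ni) Ei' eqxx.
  have -> : (i == a + r) = false by lia.
  have -> : (a + r == a) = false by lia.
  by rewrite -addbA addbb addbF.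
exists (b (+) c); have := @track_edge (b (+) c) (b (+) ((b (+) c) && odd i)) a r i r1 Hi.
rewrite (negbTE Ni) (negbTE Ni').
have -> : (i == a + r) = false by lia.
have -> : (i.+1 == a) = false by lia.
by case: b; case: c; rewrite /=; case: (odd i).
Qed.

Lemma size_haggkvist_cycle f a r : 0 < r -> size (haggkvist_cycle f a r) = 2 * r.
Proof. by move=> r0; rewrite /= size_cat /= size_rev !size_map size_iota; lia. Qed.

Definition column_pairs a n :=
  flatten [seq [:: column_vertex i false; column_vertex i true] | i <- iota a n].

Lemma perm_tracks f a r :
  perm_eq (track f false a r ++ track f true a r) (column_pairs a.+1 r.-1).
Proof.
rewrite (permPl (perm_flatten_pairs _ _ _)) /column_pairs; elim: (iota _ _) => //= i s IH.
case: (f && odd i); last by rewrite !perm_cons.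
rewrite -[_ :: _ :: flatten _]/([:: _] ++ [:: _] ++ _) perm_catCA.
by rewrite !perm_cons.
Qed.

(** Two successive cycles share a column but no vertex: one ends there at [f], the next starts at
    [~~ f]. Over the whole range only the vertex [f] of the first column is missed, and it is
    supplied by the last column when the columns close up modulo [m]. *)
Lemma haggkvist_cycles_span f a rs : all (leq 1) rs ->
  perm_eq (column_vertex a f :: flatten (haggkvist_cycles f a rs))
          (column_vertex (a + sumn rs) f :: column_pairs a (sumn rs)).
Proof.
elim: rs a => [|r rs IH] a /=; first by rewrite addn0 /column_pairs.
case/andP=> r0 Hrs; apply/permP => p.
have := permP (perm_tracks f a r) p; have := permP (IH (a + r) Hrs) p.
rewrite /column_pairs iotaD map_cat flatten_cat -[r in iota a r](prednK r0) /=.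
rewrite !(count_cat, count_rev) /= !(count_cat, count_rev) /= (addnA a r).
by case: (f); rewrite /=; lia.
Qed.

Lemma column_pairs_iota : column_pairs 0 m = iota 0 (2 * m).
Proof.
rewrite /column_pairs; have : forall n, n <= m ->
    flatten [seq [:: column_vertex i false; column_vertex i true] | i <- iota 0 n] = iota 0 (2 * n).
  elim=> // n IH Hn; rewrite -addn1 iotaD map_cat flatten_cat IH ?(ltnW Hn) //=.
  have -> : 2 * (n + 1) = 2 * n + 2 by lia.
  by rewrite iotaD /column_vertex /= add0n modn_small ?addn0 ?addn1.
by apply.
Qed.

Lemma haggkvist_factor f rs : all (leq 1) rs -> sumn rs = m ->
  perm_eq (flatten (haggkvist_cycles f 0 rs)) (iota 0 (2 * m)) /\
  map size (haggkvist_cycles f 0 rs) = map (muln 2) rs.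
Proof.
move=> H1 Hm; split.
  have := haggkvist_cycles_span f 0 H1; rewrite Hm column_pairs_iota.
  have -> : column_vertex (0 + m) f = column_vertex 0 f by rewrite /column_vertex add0n modnn mod0n.
  by rewrite perm_cons.
have H a : map size (haggkvist_cycles f a rs) = map (muln 2) rs; last exact: H.
elim: rs H1 {Hm} a => // r rs IH /andP[r0 Hrs] a.
rewrite -[LHS]/(size (haggkvist_cycle f a r) :: map size (haggkvist_cycles f (a + r) rs)).
by rewrite size_haggkvist_cycle // IH.
Qed.

Lemma haggkvist_cover rs i (b c : bool) : all (leq 2) rs -> sumn rs = m -> i < m ->
  exists f, factor_edge (haggkvist_cycles f 0 rs) (column_vertex i b) (column_vertex i.+1 c).
Proof.
move=> H2 Hm Hi.
have : forall a, a <= i < a + sumn rs ->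
    exists f, factor_edge (haggkvist_cycles f a rs) (column_vertex i b) (column_vertex i.+1 c).
  elim: rs H2 {Hm} => [|r rs IH] /= => [_ a|/andP[r2 Hrs] a Hia]; first by rewrite addn0; lia.
  have [Hir|Hir] := ltnP i (a + r).
    have Hi' : a <= i < a + r by lia.
    have [f Hf] := haggkvist_cycle_edge b c r2 Hi'.
    by exists f, (haggkvist_cycle f a r); rewrite ?mem_head.
  have Hi' : a + r <= i < a + r + sumn rs by lia.
  have [f [d Hd Hcd]] := IH Hrs (a + r) Hi'.
  by exists f, d; rewrite // inE Hd orbT.
by apply; rewrite add0n Hm.
Qed.

End Haggkvist.

(** * Hamilton cycles in complete graphs *)

Section Walecki.
Variable k : nat.

(* The zigzag 0, 1, -1, 2, -2, ... modulo 2k, rotated by i. *)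
Definition zigzag i j :=
  if odd j then i + (j./2).+1 else if j./2 <= i then i - j./2 else i + 2 * k - j./2.

Lemma zigzag_even i d : zigzag i (2 * d) = if d <= i then i - d else i + 2 * k - d.
Proof. by rewrite /zigzag mul2n odd_double doubleK. Qed.

Lemma zigzag_odd i d : zigzag i (2 * d).+1 = i + d.+1.
Proof. by rewrite /zigzag mul2n /= odd_double /= uphalf_double. Qed.

Lemma zigzag_perm i : i < k -> perm_eq (map (zigzag i) (iota 0 (2 * k))) (iota 0 (2 * k)).
Proof.
move=> Hi; have U : uniq (map (zigzag i) (iota 0 (2 * k))).
  rewrite map_inj_in_uniq ?iota_uniq // => a b; rewrite !mem_iota !add0n /zigzag /=.
  by do ?case: ifP => ?; lia.
have S : {subset map (zigzag i) (iota 0 (2 * k)) <= iota 0 (2 * k)}.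
  move=> x /mapP[j]; rewrite !mem_iota !add0n /zigzag /= => Hj ->.
  by do ?case: ifP => ?; lia.
have [|_ E] := uniq_min_size U S; first by rewrite size_map.
by apply: uniq_perm; rewrite ?iota_uniq.
Qed.

(** Modulo [2 * k], consecutive terms in rotation [i] have the sum [2 * i] or [(2 * i).+1]. Half of
    [x + y] therefore gives the rotation, reduced by [k] if necessary. *)
Lemma zigzag_pair x y : x < y -> y < 2 * k -> exists i j,
  [/\ i < k, j.+1 < 2 * k & (x = zigzag i j /\ y = zigzag i j.+1) \/
                            (y = zigzag i j /\ x = zigzag i j.+1)].
Proof.
move=> Hxy Hy; have [e He] : exists e, x + y = 2 * e \/ x + y = (2 * e).+1.
  by exists ((x + y)./2); lia.
case: He => He; have [Hk|Hk] := ltnP e k.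
- exists e, (2 * (e - x.+1)).+1; split; [lia|lia|right]; rewrite zigzag_odd.
  have -> : (2 * (e - x.+1)).+2 = 2 * (e - x) by lia.
  by rewrite zigzag_even; case: ifP; lia.
- exists (e - k), (2 * (x - (e - k).+1)).+1; split; [lia|lia|left]; rewrite zigzag_odd.
  have -> : (2 * (x - (e - k).+1)).+2 = 2 * (x - (e - k)) by lia.
  by rewrite zigzag_even; case: ifP; lia.
- exists e, (2 * (e - x)); split; [lia|lia|left]; rewrite zigzag_odd zigzag_even.
  by case: ifP; lia.
- exists (e - k), (2 * (x - (e - k).+1)); split; [lia|lia|right]; rewrite zigzag_odd zigzag_even.
  by case: ifP; lia.
Qed.

(** Rotation [i] starts at [i] and stops at [i + k]: the ends of the rotations exhaust the vertices
    to which the extra vertex [2 * k] has to be joined. *)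
Lemma zigzag_ends x : x < 2 * k -> exists i, i < k /\
  (x = zigzag i 0 \/ x = zigzag i (2 * k).-1).
Proof.
move=> Hx; have [H|H] := ltnP x k.
  by exists x; split=> //; left; rewrite (zigzag_even x 0) subn0.
exists (x - k); split; first lia; right.
have -> : (2 * k).-1 = (2 * k.-1).+1 by lia.
by rewrite zigzag_odd; lia.
Qed.

Lemma zigzag_middle i : i < k -> exists h,
  (zigzag i k.-1 = h /\ zigzag i k = h + k) \/ (zigzag i k.-1 = h + k /\ zigzag i k = h).
Proof.
move=> Hi; have [Hk|Hk] : k = 2 * k./2 \/ k = (2 * k./2).+1 by lia.
  have E : k.-1 = (2 * (k./2).-1).+1 by lia.
  rewrite E zigzag_odd [X in zigzag _ X]Hk zigzag_even.
  case: ifP => H; [exists (i - k./2); right|exists (i + k./2); left]; lia.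
have E : k.-1 = 2 * k./2 by lia.
rewrite E zigzag_even [X in zigzag _ X]Hk zigzag_odd.
case: ifP => H; [exists (i - k./2); left|exists (i + k./2).+1; right]; lia.
Qed.

Lemma perm_map_iota n (g : nat -> nat) : {in iota 0 n &, injective g} ->
  (forall j, j < n -> g j < n) -> perm_eq (map g (iota 0 n)) (iota 0 n).
Proof.
move=> Hinj Hlt; have U : uniq (map g (iota 0 n)) by rewrite map_inj_in_uniq ?iota_uniq.
have S : {subset map g (iota 0 n) <= iota 0 n}.
  by move=> x /mapP[j]; rewrite !mem_iota !add0n /= => /Hlt Hj ->.
have [|_ E] := uniq_min_size U S; first by rewrite size_map.
by apply: uniq_perm; rewrite ?iota_uniq.
Qed.

Definition odd_hamilton i := 2 * k :: map (zigzag i) (iota 0 (2 * k)).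

Lemma odd_hamilton_perm i : i < k -> perm_eq (odd_hamilton i) (iota 0 (2 * k).+1).
Proof.
move=> Hi; have -> : (2 * k).+1 = 2 * k + 1 by lia.
rewrite iotaD perm_sym perm_catC /= add0n perm_cons perm_sym.
exact: zigzag_perm.
Qed.

Lemma odd_hamilton_cover x y : x < y < (2 * k).+1 ->
  exists i, i < k /\ cedge (odd_hamilton i) x y.
Proof.
case/andP=> Hxy Hy; have [Ey|Hy'] := eqVneq y (2 * k).
  have Hx : x < 2 * k by lia.
  have Hk : 0 < k by lia.
  have [i [Hi Ex]] := zigzag_ends Hx; exists i; split=> //; apply: cedgeC; rewrite Ey.
  case: Ex => ->.
    left; exists 0, (map (zigzag i) (iota 1 (2 * k).-1)).
    by rewrite rot0 /odd_hamilton -[in iota 0 _](prednK (n := 2 * k)) //; lia.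
  have E : iota 0 (2 * k) = iota 0 (2 * k).-1 ++ [:: (2 * k).-1].
    by rewrite -(iotaD 0 _ 1); congr (iota 0 _); lia.
  by apply: cedgeC; rewrite /odd_hamilton E map_cat cats1; apply: cedge_close.
have [|i [j [Hi Hj Exy]]] := @zigzag_pair x y Hxy; first by lia.
exists i; split=> //; have H : cedge (odd_hamilton i) (zigzag i j) (zigzag i j.+1).
  apply: cedge_path; rewrite /odd_hamilton -cat1s; apply: pedge_catr; left.
  by apply: padj_map_iota; lia.
by case: Exy => -[-> ->] //; apply: cedgeC.
Qed.

(** The second extra vertex subdivides the middle edge of the zigzag, which joins an antipodal pair.
    The edges lost in this way, with {2k, 2k+1}, are the perfect matching left over by the
    cycles. *)
Definition even_hamilton i :=
  2 * k :: map (zigzag i) (iota 0 k) ++ (2 * k).+1 :: map (zigzag i) (iota k k).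

Lemma even_hamilton_perm i : i < k -> perm_eq (even_hamilton i) (iota 0 (2 * k).+2).
Proof.
move=> Hi; have -> : (2 * k).+2 = 2 * k + 2 by lia.
rewrite iotaD perm_sym perm_catC /= perm_cons /even_hamilton -[_ :: map _ _]cat1s.
rewrite perm_sym perm_catCA perm_cons -map_cat -iotaD addnn -mul2n.
exact: zigzag_perm.
Qed.

(* The vertices in the order of the columns of the ladder formed by
   [even_hamilton 0], the antipodal pairs and the edge {2k, 2k+1}. *)
Definition ladder_vertex p :=
  if p == 0 then (2 * k).+1 else if p == 1 then 2 * k else
  if odd p then zigzag 0 (2 * k - p./2) else zigzag 0 (p./2).-1.

Lemma ladder_vertex_perm : 0 < k ->
  perm_eq (map ladder_vertex (iota 0 (2 * k).+2)) (iota 0 (2 * k).+2).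
Proof.
move=> k0; apply: perm_map_iota.
  move=> a b; rewrite !mem_iota !add0n /ladder_vertex /zigzag /=.
  by do ?case: ifP => ?; lia.
by move=> j; rewrite /ladder_vertex /zigzag; do ?case: ifP => ?; lia.
Qed.

(** Vertex [p] lies in column [p./2]. The clauses are the rungs, the rails together with the edges
    from vertex 1 to the first column, and the edges from vertex 0 to the last column [k]. *)
Definition column_edge p q :=
  [|| p./2 == q./2,
      (q./2 == (p./2).+1) && (if p < 2 then p == 1 else odd p == odd q) |
      (p == 0) && (q./2 == k)].

Lemma zigzag_middles x : x < 2 * k -> exists i, i < k /\
  (x = zigzag i k.-1 \/ x = zigzag i k).
Proof.
move=> Hx; have [Hk|Hk] : k = 2 * k./2 \/ k = (2 * k./2).+1 by lia.
  have E : k.-1 = (2 * (k./2).-1).+1 by lia.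
  have Z i : zigzag i k.-1 = i + k./2 by rewrite E zigzag_odd; lia.
  have Z' i : zigzag i k = if k./2 <= i then i - k./2 else i + 2 * k - k./2.
    by rewrite {1}Hk zigzag_even.
  have [H|H] := leqP (k./2) x; last by exists (x + k./2); rewrite Z Z'; case: ifP; lia.
  have [H'|H'] := ltnP (x - k./2) k; first by exists (x - k./2); rewrite Z; lia.
  by exists (x + k./2 - 2 * k); rewrite Z Z'; case: ifP; lia.
have E : k.-1 = 2 * k./2 by lia.
have Z i : zigzag i k.-1 = if k./2 <= i then i - k./2 else i + 2 * k - k./2.
  by rewrite E zigzag_even.
have Z' i : zigzag i k = i + (k./2).+1 by rewrite {1}Hk zigzag_odd.
have [H|H] := leqP (k./2).+1 x; last by exists (x + k./2); rewrite Z Z'; case: ifP; lia.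
have [H'|H'] := ltnP (x - (k./2).+1) k; first by exists (x - (k./2).+1); rewrite Z'; lia.
by exists (x + k./2 - 2 * k); rewrite Z Z'; case: ifP; lia.
Qed.

(** Column [c] of the ladder holds two terms of [zigzag 0] that are symmetric about its middle, and
    symmetric terms are antipodal. *)
Lemma antipodal_rung h : h < k -> exists c, [/\ 0 < c, c <= k &
  (zigzag 0 c.-1 = h /\ zigzag 0 (2 * k - c) = h + k) \/
  (zigzag 0 c.-1 = h + k /\ zigzag 0 (2 * k - c) = h)].
Proof.
move=> Hh; have [->|h0] := posnP h.
  exists 1; split; [by []|lia|left]; rewrite (zigzag_even 0 0); split=> //.
  have -> : 2 * k - 1 = (2 * k.-1).+1 by lia.
  by rewrite zigzag_odd; lia.
have [H|H] := leqP (2 * h) k.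
  exists (2 * h); split; [lia|lia|left].
  have -> : (2 * h).-1 = (2 * h.-1).+1 by lia.
  have -> : 2 * k - 2 * h = 2 * (k - h) by lia.
  by rewrite zigzag_odd zigzag_even; case: ifP; lia.
exists (2 * (k - h)).+1; split; [lia|lia|right].
have -> : 2 * k - (2 * (k - h)).+1 = (2 * h.-1).+1 by lia.
by rewrite zigzag_odd zigzag_even; case: ifP; lia.
Qed.

Lemma even_hamilton_cover x y : 0 < k -> x < y < (2 * k).+2 ->
  (exists i, 0 < i < k /\ cedge (even_hamilton i) x y) \/
  exists p q, [/\ p < q < (2 * k).+2, column_edge p q &
    (x = ladder_vertex p /\ y = ladder_vertex q) \/ (y = ladder_vertex p /\ x = ladder_vertex q)].
Proof.
move=> k0 /andP[Hxy Hy].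
have lvE c : 0 < c -> ladder_vertex (2 * c) = zigzag 0 c.-1.
  by move=> c0; rewrite /ladder_vertex; do 2![case: eqP; first lia]; rewrite mul2n odd_double doubleK.
have lvO c : 0 < c -> ladder_vertex (2 * c).+1 = zigzag 0 (2 * k - c).
  move=> c0; rewrite /ladder_vertex; do 2![case: eqP; first lia].
  by rewrite mul2n /= odd_double /= uphalf_double.
have [Ey|Ny] := eqVneq y (2 * k).+1.
  have [Ex|Nx] := eqVneq x (2 * k).
    by right; exists 0, 1; split=> //; right; rewrite Ex Ey.
  have [|i [Hi Ex]] := @zigzag_middles x; first by lia.
  have [Ei|Ni] := posnP i.
    right; exists 0, (if x == zigzag i k.-1 then 2 * k else (2 * k).+1).
    split; first by case: ifP; lia.
      by rewrite /column_edge; case: ifP => _; lia.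
    right; split; first (by rewrite Ey); case: eqP Ex => [-> _|_ [//|->]].
      by rewrite lvE // Ei.
    by rewrite lvO // Ei; congr (zigzag 0 _); lia.
  left; exists i; split; first by rewrite Ni.
  apply: cedgeC; apply: cedge_path; rewrite Ey /even_hamilton -cat1s.
  case: Ex => ->; apply: pedge_catr.
    have -> : iota 0 k = iota 0 k.-1 ++ [:: k.-1] by rewrite -(iotaD 0 _ 1); congr (iota 0 _); lia.
    by apply: pedgeC; rewrite map_cat cats1; apply: pedge_junction.
  apply: pedge_catr; rewrite -[in iota k k](prednK k0) /=.
  by left; exists [::], (map (zigzag i) (iota k.+1 k.-1)); rewrite prednK.
have [Ey|Ny'] := eqVneq y (2 * k).
  have [|i [Hi Ex]] := @zigzag_ends x; first by lia.
  have [Ei|Ni] := posnP i.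
    right; exists 1, (if x == zigzag i 0 then 2 else 3).
    split; first by case: ifP; lia.
      by rewrite /column_edge; case: ifP.
    right; split; first (by rewrite Ey); case: eqP Ex => [-> _|_ [//|->]].
      by rewrite (lvE 1) // Ei.
    by rewrite (lvO 1) // Ei; congr (zigzag 0 _); lia.
  left; exists i; split; first by rewrite Ni.
  apply: cedgeC; rewrite Ey /even_hamilton; case: Ex => ->.
    apply: cedge_path; left; exists [::].
    exists (map (zigzag i) (iota 1 k.-1) ++ (2 * k).+1 :: map (zigzag i) (iota k k)).
    by rewrite -[in iota 0 k](prednK k0).
  have -> : iota k k = iota k k.-1 ++ [:: (2 * k).-1].
    have -> : (2 * k).-1 = k + k.-1 by lia.
    by rewrite -(iotaD k _ 1) addn1 prednK.
  apply: cedgeC; rewrite map_cat -[_ :: map _ _ ++ map _ _]cat_cons catA cats1.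
  exact: cedge_close.
have [|i [j [Hi Hj Exy]]] := @zigzag_pair x y Hxy; first by lia.
(* The middle step of a zigzag is an antipodal pair, hence a rung of the ladder, whatever the
   rotation. *)
have [Ej|Nj] := eqVneq j.+1 k.
  right; have [h Hh] : exists h, h < k /\ ((x = h /\ y = h + k)).
    have [h Hh] := zigzag_middle Hi; exists h.
    by move: Exy Hh; rewrite -Ej /=; lia.
  case: Hh => Hh [Ex Eyh]; have [c [c0 ck Hc]] := antipodal_rung Hh.
  exists (2 * c), (2 * c).+1; split; first lia; first by rewrite /column_edge; lia.
  by rewrite lvE // lvO // Ex Eyh; case: Hc => -[-> ->]; [left|right].
have [Ei|Ni] := posnP i.
  right; have [Hk|Hk] := ltnP j.+1 k.
    exists (2 * j.+1), (2 * j.+2); split; [lia| |by rewrite !lvE //= -Ei].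
    rewrite /column_edge; apply/or3P; apply: Or32; rewrite !oddM eqxx.
    by have -> : (2 * j.+1 < 2) = false; lia.
  exists (2 * (2 * k - j.+1)).+1, (2 * (2 * k - j)).+1; split; first lia.
    rewrite /column_edge; apply/or3P; apply: Or32; rewrite /= !oddM eqxx.
    by have -> : ((2 * (2 * k - j.+1)).+1 < 2) = false; lia.
  rewrite !lvO; [|lia|lia].
  have -> : 2 * k - (2 * k - j.+1) = j.+1 by lia.
  have -> : 2 * k - (2 * k - j) = j by lia.
  by rewrite Ei in Exy; tauto.
left; exists i; split; first by rewrite Ni.
have H : cedge (even_hamilton i) (zigzag i j) (zigzag i j.+1).
  apply: cedge_path; rewrite /even_hamilton -cat1s; apply: pedge_catr.
  have [Hk|Hk] := ltnP j.+1 k.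
    by apply: pedge_catl; left; apply: padj_map_iota.
  rewrite -cat1s; apply: pedge_catr; apply: pedge_catr; left.
  by apply: padj_map_iota; lia.
by case: Exy => -[-> ->] //; apply: cedgeC.
Qed.
End Walecki.

(** * Splitting a single layer *)

Definition splits n (M : seq (nat * nat)) (Ts : seq (seq nat)) := exists Fs, factors_typed n Ts Fs /\
  forall x y, x < n -> y < n -> x != y ->
    [\/ (x, y) \in M, (y, x) \in M | exists2 F, F \in Fs & factor_edge F x y].

Definition two_factor_type n T := [&& all (leq 4) T, all (predC odd) T & sumn T == n].

Lemma factors_typed_map n (g : nat -> nat) Ts Fs :
  perm_eq (map g (iota 0 n)) (iota 0 n) -> factors_typed n Ts Fs ->
  factors_typed n Ts [seq map (map g) F | F <- Fs].
Proof.
move=> Hg; elim: Ts Fs => [|T Ts IH] [|F Fs] //= [H1 H2 H3]; split; last exact: IH.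
  by rewrite -map_flatten; apply: perm_trans Hg; apply: perm_map.
by rewrite -map_comp (eq_map (fun c => size_map g c)).
Qed.

Lemma factors_typed_cat n Ts Ts' Fs Fs' : factors_typed n Ts Fs -> factors_typed n Ts' Fs' ->
  factors_typed n (Ts ++ Ts') (Fs ++ Fs').
Proof. by elim: Ts Fs => [|T Ts IH] [|F Fs] //= [H1 H2 H3] H; split=> //; apply: IH. Qed.

Lemma factor_edge_map (g : nat -> nat) F x y :
  factor_edge F x y -> factor_edge (map (map g) F) (g x) (g y).
Proof. by case=> c Hc H; exists (map g c); [apply: map_f|apply: cedge_map]. Qed.

Lemma factor_edgeC F x y : factor_edge F x y -> factor_edge F y x.
Proof. by case=> c Hc H; exists c => //; apply: cedgeC. Qed.

(** The twins of x are [2 * x] and [(2 * x).+1]; positions along [h], doubled, are carried to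
    doubled vertices. *)
Definition doubling (h : seq nat) p := 2 * nth 0 h p./2 + odd p.

Lemma doublingE h p (b : bool) : doubling h (2 * p + b) = 2 * nth 0 h p + b.
Proof.
rewrite /doubling; have -> : (2 * p + b)./2 = p by lia.
by rewrite oddD oddM; case: b.
Qed.

Lemma doubling_perm m h : perm_eq h (iota 0 m) ->
  perm_eq (map (doubling h) (iota 0 (2 * m))) (iota 0 (2 * m)).
Proof.
move=> Hh; have Hs : size h = m by rewrite (perm_size Hh) size_iota.
have Hu : uniq h by rewrite (perm_uniq Hh) iota_uniq.
apply: perm_map_iota.
  move=> a b; rewrite !mem_iota !add0n /= => Ha Hb; rewrite /doubling => E.
  have E1 : nth 0 h a./2 = nth 0 h b./2 by lia.
  have E2 : a./2 = b./2 by apply/eqP; rewrite -(nth_uniq 0 _ _ Hu) ?E1 // Hs; lia.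
  by lia.
move=> j Hj; have : nth 0 h j./2 \in iota 0 m.
  by rewrite -(perm_mem Hh) mem_nth // Hs; lia.
by rewrite mem_iota /doubling; lia.
Qed.

Lemma cedge_position m h x y : perm_eq h (iota 0 m) -> cedge h x y ->
  exists i, i < m /\ ((x = nth 0 h i /\ y = nth 0 h (i.+1 %% m)) \/
                      (y = nth 0 h i /\ x = nth 0 h (i.+1 %% m))).
Proof.
move=> Hh; have Hs : size h = m by rewrite (perm_size Hh) size_iota.
have Hu : uniq h by rewrite (perm_uniq Hh) iota_uniq.
have H a b : cadj h a b -> exists i, i < m /\ a = nth 0 h i /\ b = nth 0 h (i.+1 %% m).
  move=> /(cadj_next Hu) [Ha _ Hb]; exists (index a h); rewrite -Hs index_mem nth_index //.
  split=> //; split=> //; rewrite -Hb next_nth Ha.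
  case: h Ha {Hh Hs Hu Hb} => // z h Ha.
  have : index a (z :: h) < (size h).+1 by rewrite index_mem.
  move: (index a (z :: h)) => j Hj; have [Hj'|Hj'] := ltnP j (size h).
    by rewrite modn_small //=; apply: set_nth_default.
  have -> : j = size h by lia.
  by rewrite modnn /= nth_default.
by case=> /H [i [Hi Hxy]]; exists i; split=> //; [left|right].
Qed.

Lemma double_cycle m h T : perm_eq h (iota 0 m) -> two_factor_type (2 * m) T ->
  exists F F', factors_typed (2 * m) [:: T; T] [:: F; F'] /\
    forall x y (b c : bool), cedge h x y ->
      factor_edge F (2 * x + b) (2 * y + c) \/ factor_edge F' (2 * x + b) (2 * y + c).
Proof.
move=> Hh /and3P[H4 Ho /eqP Hs].
pose rs := map half T.
have Hrs : map (muln 2) rs = T.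
  rewrite -map_comp -[RHS]map_id; apply/eq_in_map => t Ht /=.
  by have := allP Ho t Ht; rewrite /=; lia.
have Hsum : sumn rs = m.
  have : sumn T = 2 * sumn rs by rewrite -Hrs; elim: (rs) => //= r s ->; rewrite mulnDr.
  by lia.
have H2 : all (leq 2) rs by rewrite all_map; apply: sub_all H4 => t /=; lia.
have H1 : all (leq 1) rs by apply: sub_all H2 => t; lia.
pose Ff f := map (map (doubling h)) (haggkvist_cycles m f 0 rs).
have Hf f : perm_eq (flatten (Ff f)) (iota 0 (2 * m)) /\ perm_eq (map size (Ff f)) T.
  have [K1 K2] := haggkvist_factor f H1 Hsum; split.
    by rewrite -map_flatten; apply: perm_trans (doubling_perm Hh); apply: perm_map.
  by rewrite -map_comp (eq_map (fun c => size_map (doubling h) c)) K2 Hrs.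
exists (Ff false), (Ff true); split; first by have [] := Hf false; have [] := Hf true.
have key i (b c : bool) : i < m -> exists f,
    factor_edge (Ff f) (2 * nth 0 h i + b) (2 * nth 0 h (i.+1 %% m) + c).
  move=> Hi; have [f H] := haggkvist_cover b c H2 Hsum Hi; exists f.
  have := factor_edge_map (doubling h) H.
  by rewrite /column_vertex !doublingE (modn_small Hi).
move=> x y b c /(cedge_position Hh) [i [Hi [] [-> ->]]].
  by have [[] H] := key i b c Hi; [right|left].
by have [[] /factor_edgeC H] := key i c b Hi; [right|left].
Qed.

Lemma double_cycles m hs (P : seq (seq nat)) : size hs = size P ->
  all (fun h => perm_eq h (iota 0 m)) hs -> all (two_factor_type (2 * m)) P ->
  exists Fs, factors_typed (2 * m) (flatten [seq [:: T; T] | T <- P]) Fs /\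
    forall h x y (b c : bool), h \in hs -> cedge h x y ->
      exists2 F, F \in Fs & factor_edge F (2 * x + b) (2 * y + c).
Proof.
elim: hs P => [|h hs IH] [|T P] //=; first by move=> *; exists [::].
case=> Hs /andP[Hh Hhs] /andP[HT HP].
have [Fs [H1 H2]] := IH P Hs Hhs HP; have [F [F' [H3 H4]]] := double_cycle Hh HT.
exists [:: F, F' & Fs]; split; first by case: H3 => ? ? [].
move=> g x y b c; rewrite inE => /orP[/eqP->|Hg] Hxy.
  by have [H|H] := H4 x y b c Hxy; [exists F|exists F']; rewrite // !inE eqxx ?orbT.
by have [G HG K] := H2 g x y b c Hg Hxy; exists G; rewrite // !inE HG !orbT.
Qed.

Lemma pairs_of_map (g : nat -> nat) M :
  pairs_of [seq (g e.1, g e.2) | e <- M] = map g (pairs_of M).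
Proof. by rewrite /pairs_of map_flatten -!map_comp. Qed.

Lemma pairs_of_cat M M' : pairs_of (M ++ M') = pairs_of M ++ pairs_of M'.
Proof. by rewrite /pairs_of map_cat flatten_cat. Qed.

Lemma consecutive_pairs a n :
  pairs_of [seq (a + 2 * i, a + (2 * i).+1) | i <- iota 0 n] = iota a (2 * n).
Proof.
elim: n => // n IH.
have -> : iota 0 n.+1 = iota 0 n ++ [:: n] by rewrite -[[:: n]]/(iota (0 + n) 1) -iotaD addn1.
rewrite map_cat pairs_of_cat IH; have -> : 2 * n.+1 = 2 * n + 2 by lia.
by rewrite iotaD /pairs_of /= addnS.
Qed.

Lemma splits_odd k P : size P = k -> all (two_factor_type (2 * (2 * k).+1)) P ->
  exists M, perm_eq (pairs_of M) (iota 0 (2 * (2 * k).+1)) /\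
    splits (2 * (2 * k).+1) M (flatten [seq [:: T; T] | T <- P]).
Proof.
move=> HsP HP; set m := (2 * k).+1.
pose hs := map (odd_hamilton k) (iota 0 k).
have Hhs : all (fun h => perm_eq h (iota 0 m)) hs.
  by apply/allP => h /mapP[i]; rewrite mem_iota => Hi ->; apply: odd_hamilton_perm.
have [|Fs [H1 H2]] := @double_cycles m hs P _ Hhs HP; first by rewrite size_map size_iota.
pose M := [seq (2 * i, (2 * i).+1) | i <- iota 0 m].
exists M; split; first by rewrite [pairs_of M](consecutive_pairs 0 m).
exists Fs; split=> // x y Hx Hy Dxy.
have Ex : x = 2 * x./2 + odd x by lia.
have Ey : y = 2 * y./2 + odd y by lia.
have key a b (u v : bool) : a < b < m -> exists2 F, F \in Fs & factor_edge F (2 * a + u) (2 * b + v).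
  move=> Hab; have [i [Hi He]] := odd_hamilton_cover Hab.
  by apply: (H2 (odd_hamilton k i)) => //; apply: map_f; rewrite mem_iota.
have [E|N] := eqVneq x./2 y./2.
  have HM : (2 * x./2, (2 * x./2).+1) \in M by apply: map_f; rewrite mem_iota; lia.
  have [H|H] : (odd x = false /\ odd y = true) \/ (odd x = true /\ odd y = false) by lia.
    by apply: Or31; have -> : (x, y) = (2 * x./2, (2 * x./2).+1) by congr pair; lia.
  by apply: Or32; have -> : (y, x) = (2 * x./2, (2 * x./2).+1) by congr pair; lia.
have [H|H] := ltnP x./2 y./2.
  by apply: Or33; rewrite Ex Ey; apply: key; lia.
apply: Or33; have [|F HF He] := key y./2 x./2 (odd y) (odd x); first by lia.
by exists F; rewrite // Ex Ey; apply: factor_edgeC.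
Qed.

Lemma factors_typed_sum n T Ts F Fs : factors_typed n (T :: Ts) (F :: Fs) -> sumn T = n.
Proof.
case=> H1 H2 _; rewrite -(size_iota 0 n) -(perm_size H1) -(perm_sumn H2).
by rewrite size_flatten /shape.
Qed.

Lemma closed_ladder_edge_double k p q (b c : bool) : p < q -> column_edge k p q ->
  closed_ladder_edge k (2 * p + b) (2 * q + c).
Proof.
move=> Hpq; rewrite /closed_ladder_edge /ladder_edge.
have -> : (2 * p + b) %/ 4 = p./2 by lia.
have -> : (2 * q + c) %/ 4 = q./2 by lia.
have -> : ((2 * p + b) %% 4)./2 = odd p by lia.
have -> : ((2 * q + c) %% 4)./2 = odd q by lia.
have -> : (2 * p + b < 2) = (p == 0) by lia.
have -> : (2 * p + b < 4) = (p < 2) by lia.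
have -> : (2 <= 2 * p + b) = (0 < p) by lia.
rewrite /column_edge orbA; case: (p./2 == q./2) => //=; case: (q./2 == _) => //=.
case: ltnP => Hp; first by case: p Hp {Hpq} => [|[|]].
by case: (odd p); case: (odd q).
Qed.

Lemma splits_even k T P : 0 < k -> size P = k.-1 ->
  all (two_factor_type (2 * (2 * k).+2)) (T :: P) ->
  exists M, perm_eq (pairs_of M) (iota 0 (2 * (2 * k).+2)) /\
    splits (2 * (2 * k).+2) M (nseq 3 T ++ flatten [seq [:: T; T] | T <- P]).
Proof.
move=> k0 HsP /= /andP[HT HP]; set m := (2 * k).+2.
pose hs := map (even_hamilton k) (iota 1 k.-1).
have Hhs : all (fun h => perm_eq h (iota 0 m)) hs.
  by apply/allP => h /mapP[i]; rewrite mem_iota => Hi ->; apply: even_hamilton_perm; lia.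
have [|Fs [H1 H2]] := @double_cycles m hs P _ Hhs HP; first by rewrite size_map size_iota.
pose l := map (ladder_vertex k) (iota 0 m).
have Hl : perm_eq l (iota 0 m) by apply: ladder_vertex_perm.
have nthl p : p < m -> nth 0 l p = ladder_vertex k p.
  by move=> Hp; rewrite (nth_map 0) ?size_iota // nth_iota.
have [K [M [Gs [K0 HM HG HC]]]] : ladder_splits (nseq 3 T).
  by case/and3P: HT => ? ? /eqP Hs; apply: ladder_splits_all => //; rewrite Hs /m; lia.
(* The number of columns, hidden in [ladder_splits], is recovered from the sum of the type. *)
have EK : K = k.
  have : sumn T = 4 * K.+1 by case: Gs HG {HC} => [|G Gs] // /factors_typed_sum.
  by case/and3P: HT => _ _ /eqP ->; rewrite /m; lia.
have Em : 4 * k.+1 = 2 * m by rewrite /m; lia.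
rewrite {K}EK Em in K0 HM HG HC.
have Hd := doubling_perm Hl; set d := doubling l in Hd.
pose dd (e : nat * nat) := (d e.1, d e.2).
have HMd x y : (x, y) \in M -> (d x, d y) \in map dd M by apply: (map_f dd).
exists (map dd M); split.
  by rewrite (pairs_of_map d M); apply: perm_trans Hd; apply: perm_map.
exists ([seq map (map d) G | G <- Gs] ++ Fs); split.
  exact: (factors_typed_cat (factors_typed_map Hd HG) H1).
have lad p q : p < q < 2 * m -> closed_ladder_edge k p q ->
    [\/ (d p, d q) \in map dd M, (d q, d p) \in map dd M |
      exists2 F, F \in [seq map (map d) G | G <- Gs] ++ Fs & factor_edge F (d p) (d q)].
  move=> Hpq /(HC p q Hpq) [/HMd H|/HMd H|[G HGs HG']]; [exact: Or31|exact: Or32|apply: Or33].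
  exists (map (map d) G); last exact: factor_edge_map.
  by rewrite mem_cat (map_f (fun G => map (map d) G)).
have sym x y : [\/ (x, y) \in map dd M, (y, x) \in map dd M |
      exists2 F, F \in [seq map (map d) G | G <- Gs] ++ Fs & factor_edge F x y] ->
    [\/ (y, x) \in map dd M, (x, y) \in map dd M |
      exists2 F, F \in [seq map (map d) G | G <- Gs] ++ Fs & factor_edge F y x].
  case=> [H|H|[F HF HF']]; [exact: Or32|exact: Or31|apply: Or33; exists F => //].
  exact: factor_edgeC.
have key a b (u v : bool) : a < b < m ->
    [\/ (2 * a + u, 2 * b + v) \in map dd M, (2 * b + v, 2 * a + u) \in map dd M |
      exists2 F, F \in [seq map (map d) G | G <- Gs] ++ Fs & factor_edge F (2 * a + u) (2 * b + v)].
  move=> Hab; case: (even_hamilton_cover k0 Hab) => [[i [Hi He]]|[p [q [Hpq Hc Hab']]]].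
    have [|F HF HF'] := H2 (even_hamilton k i) a b u v _ He.
      by apply: map_f; rewrite mem_iota; lia.
    by apply: Or33; exists F; rewrite // mem_cat HF orbT.
  have dE r (w : bool) : r < m -> d (2 * r + w) = 2 * ladder_vertex k r + w.
    by move=> Hr; rewrite /d doublingE nthl.
  have [Hp Hq] : p < m /\ q < m by rewrite /m in Hpq *; lia.
  case: Hab' => -[-> ->].
    rewrite -!dE //; apply: lad; last by apply: closed_ladder_edge_double; lia.
    by rewrite /m in Hpq *; lia.
  apply: sym; rewrite -!dE //; apply: lad; last by apply: closed_ladder_edge_double; lia.
  by rewrite /m in Hpq *; lia.
move=> x y Hx Hy Dxy.
have Ex : x = 2 * x./2 + odd x by lia.
have Ey : y = 2 * y./2 + odd y by lia.
have [H|H|E] := ltngtP x./2 y./2.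
- by rewrite Ex Ey; apply: key; lia.
- by apply: sym; rewrite Ex Ey; apply: key; lia.
(* Twins remain: every vertex of K_m lies on the ladder, which contains the twin edges. *)
have : x./2 \in l by rewrite (perm_mem Hl) mem_iota; lia.
case/(nthP 0) => p; rewrite (perm_size Hl) size_iota => Hp Ep.
have tw : [\/ (2 * x./2 + false, 2 * x./2 + true) \in map dd M,
    (2 * x./2 + true, 2 * x./2 + false) \in map dd M |
      exists2 F, F \in [seq map (map d) G | G <- Gs] ++ Fs &
        factor_edge F (2 * x./2 + false) (2 * x./2 + true)].
  rewrite -Ep -!doublingE; apply: lad; first by lia.
  by rewrite /closed_ladder_edge /ladder_edge; apply/orP; left; apply/orP; left; lia.
have [O|O] : (odd x = false /\ odd y = true) \/ (odd x = true /\ odd y = false) by lia.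
  by rewrite Ex Ey -E; case: O => -> ->.
by apply: sym; rewrite Ex Ey -E; case: O => -> ->.
Qed.

Lemma pairs_of_inj : injective pairs_of.
Proof. by elim=> [|[a b] M IH] [|[c d] M'] //= [-> -> /IH ->]. Qed.

(** Matching the two lists of vertices position by position gives a permutation that carries [M] to
    [M']; every permutation preserves K_n and the types. *)
Lemma splits_relabel n M M' Ts : perm_eq (pairs_of M) (iota 0 n) ->
  perm_eq (pairs_of M') (iota 0 n) -> splits n M Ts -> splits n M' Ts.
Proof.
move=> HM HM' [Fs [HF HC]].
set w := pairs_of M in HM; set w' := pairs_of M' in HM'.
have [Uw Uw'] : uniq w /\ uniq w' by rewrite (perm_uniq HM) (perm_uniq HM') iota_uniq.
have [Sw Sw'] : size w = n /\ size w' = n by rewrite (perm_size HM) (perm_size HM') size_iota.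
pose g x := nth 0 w' (index x w).
have Hgw : map g w = w'.
  apply: (@eq_from_nth _ 0); rewrite size_map ?Sw ?Sw' // => i Hi.
  by rewrite (nth_map 0) ?Sw // /g index_uniq ?Sw.
have Hg : perm_eq (map g (iota 0 n)) (iota 0 n).
  by apply: perm_trans HM'; rewrite -Hgw; apply: perm_map; rewrite perm_sym.
have HMg : [seq (g e.1, g e.2) | e <- M] = M' by apply: pairs_of_inj; rewrite pairs_of_map.
exists [seq map (map g) F | F <- Fs]; split; first exact: factors_typed_map.
have pre x : x < n -> exists2 x0, x0 < n & x = g x0.
  move=> Hx; have : x \in map g (iota 0 n) by rewrite (perm_mem Hg) mem_iota.
  by case/mapP=> x0; rewrite mem_iota => H ->; exists x0.
move=> x y /pre [a Ha ->] /pre [b Hb ->] Dxy.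
have Dab : a != b by apply: contraNneq Dxy => ->.
have gM u v : (u, v) \in M -> (g u, g v) \in M'.
  by rewrite -HMg => H; apply: (map_f (fun e : nat * nat => (g e.1, g e.2)) H).
case: (HC a b Ha Hb Dab) => [/gM H|/gM H|[F HF' He]]; [exact: Or31|exact: Or32|apply: Or33].
by exists (map (map g) F); [apply: (map_f (fun F => map (map g) F))|apply: factor_edge_map].
Qed.

(** A standard 2-factor of type [T]. As all entries are even, its edges fall into two perfect
    matchings: those from an even position to the next, and [shifted_matching]. *)
Fixpoint blocks a (T : seq nat) :=
  if T is t :: T' then iota a t :: blocks (a + t) T' else [::].

(* The edges of the cycles [blocks a T] that join an odd position to the next one. *)
Fixpoint shifted_matching a (T : seq nat) :=
  if T is t :: T' then
    [seq (a + (2 * i).+1, a + (2 * i).+2) | i <- iota 0 t./2.-1] ++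
    (a + t.-1, a) :: shifted_matching (a + t) T'
  else [::].

Lemma blocks_flatten a T : flatten (blocks a T) = iota a (sumn T).
Proof. by elim: T a => //= t T IH a; rewrite IH iotaD. Qed.

Lemma blocks_size a T : map size (blocks a T) = T.
Proof. by elim: T a => //= t T IH a; rewrite IH size_iota. Qed.

Lemma shifted_matching_perm a T : all (leq 1) T -> all (predC odd) T ->
  perm_eq (pairs_of (shifted_matching a T)) (iota a (sumn T)).
Proof.
elim: T a => [|t T IH] a //= /andP[t1 H1] /andP[te He].
rewrite pairs_of_cat iotaD perm_sym -[pairs_of (_ :: _)]/([:: _; _] ++ pairs_of _) catA perm_sym.
apply: perm_cat; last exact: IH.
have -> : [seq (a + (2 * i).+1, a + (2 * i).+2) | i <- iota 0 t./2.-1] =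
    [seq (a.+1 + 2 * i, a.+1 + (2 * i).+1) | i <- iota 0 t./2.-1].
  by apply: eq_map => i; rewrite !addSn !addnS.
rewrite consecutive_pairs.
have -> : iota a t = a :: iota a.+1 (2 * t./2.-1) ++ [:: a + t.-1].
  have {1}-> : t = 1 + 2 * t./2.-1 + 1 by move: te; rewrite /=; lia.
  by rewrite !iotaD /= addn1; congr (_ :: _ ++ [:: _]); move: te; rewrite /=; lia.
by rewrite -[[:: _; a]]/([:: _] ++ [:: a]) catA perm_catC.
Qed.

Lemma padj_iota a n i : a <= i -> i.+1 < a + n -> padj (iota a n) i i.+1.
Proof. by move=> Ha Hi; have := @padj_map_iota id a n i Ha Hi; rewrite map_id. Qed.

Lemma blocks_cadj a T x : ~~ odd a -> all (predC odd) T -> ~~ odd x -> a <= x < a + sumn T ->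
  exists2 c, c \in blocks a T & cadj c x x.+1.
Proof.
elim: T a => [|t T IH] a ae /=; first by rewrite addn0; lia.
case/andP=> te He xe Hx; have [H|H] := ltnP x (a + t).
  exists (iota a t); rewrite ?mem_head //; apply: cadj_path.
  by apply: padj_iota; lia.
have [||c Hc Hxc] := IH (a + t) _ He xe; [lia|lia|].
by exists c; rewrite // inE Hc orbT.
Qed.

Lemma shifted_matching_cadj a T x y : ~~ odd a -> all (leq 4) T -> all (predC odd) T ->
  (x, y) \in shifted_matching a T -> odd x /\ exists2 c, c \in blocks a T & cadj c x y.
Proof.
elim: T a => [|t T IH] a //= ae /andP[t4 H4] /andP[te He].
rewrite mem_cat inE => /or3P[/mapP[i]|/eqP[-> ->]|H].
- rewrite mem_iota => Hi [-> ->]; split; first lia.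
  exists (iota a t); rewrite ?mem_head //; apply: cadj_path.
  by rewrite !addnS; apply: padj_iota; lia.
- split; first lia.
  exists (iota a t); rewrite ?mem_head //.
  have -> : iota a t = a :: rcons (iota a.+1 t.-2) (a + t.-1).
    have {1}-> : t = 1 + t.-2 + 1 by lia.
    by rewrite !iotaD /= addn1 -cats1; congr (_ :: _ ++ [:: _]); lia.
  exact: cadj_close.
have [|xo [c Hc Hxc]] := IH (a + t) _ H4 He H; first lia.
by split=> //; exists c; rewrite // inE Hc orbT.
Qed.

(** * Stacking layers *)

(* [(F, s)] is a 2-factor of the multigraph in which the edge leaving vertex x
   along its cycle is taken from the layer [s`_x]. *)
Definition layered lam n (Ts : seq (seq nat)) := exists M (Fs : seq (seq (seq nat) * seq nat)),
  [/\ perm_eq (pairs_of M) (iota 0 n), factors_typed n Ts [seq F.1 | F <- Fs],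
      forall F x, F \in Fs -> x < n -> nth 0 F.2 x < lam &
      forall x y l, x < n -> y < n -> x != y -> l < lam ->
        (odd lam /\ l = 0 /\ ((x, y) \in M \/ (y, x) \in M)) \/
        exists2 F, F \in Fs & exists2 c, c \in F.1 &
          (cadj c x y /\ nth 0 F.2 x = l) \/ (cadj c y x /\ nth 0 F.2 y = l)].

Lemma layered0 n M : perm_eq (pairs_of M) (iota 0 n) -> layered 0 n [::].
Proof. by move=> HM; exists M, [::]; split. Qed.

Lemma layered1 n M Ts : perm_eq (pairs_of M) (iota 0 n) -> splits n M Ts -> layered 1 n Ts.
Proof.
move=> HM [Fs [HF HC]]; exists M, [seq (F, nseq n 0) | F <- Fs]; split=> //.
- by rewrite -map_comp map_id_in.
- by move=> F x /mapP[G _ ->] Hx; rewrite nth_nseq Hx.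
move=> x y l Hx Hy Dxy; rewrite ltnS leqn0 => /eqP ->.
case: (HC x y Hx Hy Dxy) => [H|H|[F HF' [c Hc Hxy]]]; [by left; split=> //; split=> //; left|
  by left; split=> //; split=> //; right|right].
exists (F, nseq n 0); first exact: (map_f (fun F => (F, nseq n 0))).
by exists c => //; rewrite !nth_nseq Hx Hy; case: Hxy => ?; [left|right].
Qed.

(** The two new layers are relabelled so that their left-over 1-factors become the two perfect
    matchings in the standard 2-factor of type [G], which is then complete. The matching of layer 0
    is kept for odd [lam]. *)
Lemma layered_step lam n M M' Ts Ts1 Ts2 G : ~~ odd n -> two_factor_type n G ->
  perm_eq (pairs_of M) (iota 0 n) -> perm_eq (pairs_of M') (iota 0 n) ->
  splits n M Ts1 -> splits n M' Ts2 -> layered lam n Ts ->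
  layered lam.+2 n (G :: Ts1 ++ Ts2 ++ Ts).
Proof.
move=> ne /and3P[G4 Go /eqP Gs] HM HM' HS1 HS2 [M0 [Fs [HM0 HF Hlt HC]]].
pose M1 := [seq (0 + 2 * i, 0 + (2 * i).+1) | i <- iota 0 n./2].
have HM1 : perm_eq (pairs_of M1) (iota 0 n).
  by rewrite consecutive_pairs; have -> : 2 * n./2 = n by lia.
have G1 : all (leq 1) G by apply: sub_all G4 => t; lia.
have HM2 : perm_eq (pairs_of (shifted_matching 0 G)) (iota 0 n).
  by rewrite -[X in iota _ X]Gs; apply: shifted_matching_perm.
have [Fs1 [HF1 HC1]] := splits_relabel HM HM1 HS1.
have [Fs2 [HF2 HC2]] := splits_relabel HM' HM2 HS2.
(* The edge leaving an even vertex comes from [M1], in layer [lam], and that leaving an odd vertex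
   from the shifted matching, in layer [lam.+1]. *)
pose FG := (blocks 0 G, [seq lam + odd v | v <- iota 0 n]).
have colG x : x < n -> nth 0 FG.2 x = lam + odd x.
  by move=> Hx; rewrite (nth_map 0) ?size_iota // nth_iota.
exists M0, (FG :: [seq (F, nseq n lam) | F <- Fs1] ++ [seq (F, nseq n lam.+1) | F <- Fs2] ++ Fs).
split=> //.
- rewrite /= blocks_flatten blocks_size Gs; split=> //.
  rewrite !map_cat -!map_comp; apply: factors_typed_cat; first by rewrite map_id_in.
  by apply: factors_typed_cat => //; rewrite map_id_in.
- move=> F x; rewrite inE !mem_cat => /orP[/eqP-> Hx|/or3P[/mapP[H _ ->]|/mapP[H _ ->]|HF' Hx]].
  + by rewrite colG // -addn2 ltn_add2l; case: (odd x).
  + by move=> Hx; rewrite nth_nseq Hx.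
  + by move=> Hx; rewrite nth_nseq Hx.
  + by apply: leq_trans (Hlt F x HF' Hx) _; rewrite -addn2 leq_addr.
move=> x y l Hx Hy Dxy Hl.
have lift (Hs : seq (seq (seq nat) * seq nat)) : {subset Hs <= FG :: [seq (F, nseq n lam) | F <- Fs1] ++ [seq (F, nseq n lam.+1) | F <- Fs2] ++ Fs} ->
    (exists2 F, F \in Hs & exists2 c, c \in F.1 &
          (cadj c x y /\ nth 0 F.2 x = l) \/ (cadj c y x /\ nth 0 F.2 y = l)) ->
    exists2 F, F \in FG :: [seq (F, nseq n lam) | F <- Fs1] ++ [seq (F, nseq n lam.+1) | F <- Fs2] ++ Fs & exists2 c, c \in F.1 &
          (cadj c x y /\ nth 0 F.2 x = l) \/ (cadj c y x /\ nth 0 F.2 y = l).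
  by move=> Hsub [F HF' H]; exists F => //; apply: Hsub.
have [Hl'|Hl'] := ltnP l lam.
  case: (HC x y l Hx Hy Dxy Hl') => [[Ho H]|H]; first by left; rewrite /= negbK.
  right; apply: lift H => F HF'; by rewrite inE !mem_cat HF' !orbT.
right; have [El|El] : l = lam \/ l = lam.+1 by clear -Hl Hl'; lia.
  case: (HC1 x y Hx Hy Dxy) => [H|H|[F HF' [c Hc Hxy]]].
  - exists FG; rewrite ?mem_head //; case/mapP: H => i; rewrite mem_iota => Hi [Ex Ey].
    have xe : ~~ odd x by rewrite Ex add0n mul2n odd_double.
    have [|c Hc Hxc] := @blocks_cadj 0 G x isT Go xe; first by rewrite Gs.
    exists c => //; left; rewrite colG // (negbTE xe) addn0 El.
    by have -> : y = x.+1 by rewrite Ey Ex.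
  - exists FG; rewrite ?mem_head //; case/mapP: H => i; rewrite mem_iota => Hi [Ey Ex].
    have ye : ~~ odd y by rewrite Ey add0n mul2n odd_double.
    have [|c Hc Hyc] := @blocks_cadj 0 G y isT Go ye; first by rewrite Gs.
    exists c => //; right; rewrite colG // (negbTE ye) addn0 El.
    by have -> : x = y.+1 by rewrite Ex Ey.
  apply: (lift [:: (F, nseq n lam)]).
    by move=> F'; rewrite inE => /eqP ->; rewrite inE mem_cat (map_f (fun F => (F, nseq n lam))) ?orbT.
  exists (F, nseq n lam); rewrite ?mem_head //; exists c => //=.
  by rewrite !nth_nseq Hx Hy El; case: Hxy => ?; [left|right].
case: (HC2 x y Hx Hy Dxy) => [H|H|[F HF' [c Hc Hxy]]].
- exists FG; rewrite ?mem_head //.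
  have [|xo [c Hc Hxc]] := shifted_matching_cadj _ G4 Go H; first by [].
  by exists c => //; left; rewrite colG // xo addn1.
- exists FG; rewrite ?mem_head //.
  have [|yo [c Hc Hyc]] := shifted_matching_cadj _ G4 Go H; first by [].
  by exists c => //; right; rewrite colG // yo addn1.
apply: (lift [:: (F, nseq n lam.+1)]).
  move=> F'; rewrite inE => /eqP ->.
  by rewrite inE !mem_cat (map_f (fun F => (F, nseq n lam.+1)) HF') ?orbT.
exists (F, nseq n lam.+1); rewrite ?mem_head //; exists c => //=.
by rewrite !nth_nseq Hx Hy El; case: Hxy => ?; [left|right].
Qed.

Lemma layered_perm lam n Ts Ts' : perm_eq Ts Ts' -> layered lam n Ts -> layered lam n Ts'.
Proof.
move=> HT [M [Fs [HM HF Hlt HC]]].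
have [Fs' [HF1 HF2]] : exists Fs', perm_eq Fs Fs' /\ factors_typed n Ts' [seq F.1 | F <- Fs'].
  elim: Ts' Ts Fs HT HF {Hlt HC} => [|T Ts' IH] Ts Fs HT.
    have -> : Ts = [::] by apply/nilP; rewrite /nilp (perm_size HT).
    by case: Fs => // _; exists [::].
  have HTin : T \in Ts by rewrite (perm_mem HT) mem_head.
  have HT' : perm_eq (rem T Ts) Ts'.
    by rewrite -(perm_cons T) -(permPl (perm_to_rem HTin)).
  move=> HF.
  have [F [Fs1 [K1 K2 K3 K4]]] : exists F Fs1, [/\ perm_eq (flatten F.1) (iota 0 n),
      perm_eq (map size F.1) T, perm_eq Fs (F :: Fs1) &
      factors_typed n (rem T Ts) [seq F.1 | F <- Fs1]].
    elim: Ts Fs HTin HF {IH HT HT'} => [|T0 Ts IH] [|F0 Fs] //=; rewrite inE eq_sym.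
    case: eqP => [<- _|_ /= HTin] [H1 H2 H3]; first by exists F0, Fs.
    have [F [Fs1 [K1 K2 K3 K4]]] := IH _ HTin H3.
    exists F, (F0 :: Fs1); split=> //.
    apply: (@perm_trans _ (F0 :: F :: Fs1)); first by rewrite perm_cons.
    by rewrite -[F0 :: _]/([:: F0] ++ [:: F] ++ Fs1) perm_catCA.
  have [Fs2 [L1 L2]] := IH _ _ HT' K4.
  by exists (F :: Fs2); split; [rewrite (permPl K3) perm_cons|split].
exists M, Fs'; split=> // [F x|x y l Hx Hy Dxy Hl].
  by rewrite -(perm_mem HF1); apply: Hlt.
case: (HC x y l Hx Hy Dxy Hl) => [H|[F HF' H]]; [by left|right].
by exists F; rewrite -?(perm_mem HF1).
Qed.

(** * Successors along the cycles of a 2-factor *)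

Lemma next_map_uniq (T U : eqType) (f : T -> U) c x : uniq c -> uniq (map f c) -> x \in c ->
  next (map f c) (f x) = f (next c x).
Proof.
move=> Uc Uf /rot_to [i s E]; rewrite -(next_rot i Uc) -(next_rot i Uf) -map_rot E.
by case: s {E} => [|y s] /=; rewrite !eqxx.
Qed.

Lemma next_next_neq (T : eqType) (c : seq T) x : uniq c -> 2 < size c -> x \in c ->
  next c x != x /\ next c (next c x) != x.
Proof.
move=> Uc Hs /rot_to [i s E]; rewrite -!(next_rot i Uc).
have := Uc; rewrite -(rot_uniq i) E; move: Hs; rewrite -(size_rot i) E.
case: s {E} => [|y [|z s]] //= _; rewrite !inE !negb_or => /and3P[/and3P[N1 N2 _] _ _].
by rewrite eqxx eq_sym N1 (negbTE N1) eqxx eq_sym N2.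
Qed.

Lemma uniq_flatten_mem (T : eqType) (ss : seq (seq T)) s :
  uniq (flatten ss) -> s \in ss -> uniq s.
Proof.
elim: ss => //= s1 ss IH; rewrite inE cat_uniq => /and3P[H1 _ H2] /orP[/eqP-> //|].
exact: IH.
Qed.

Lemma all2_map (T U V : Type) (r : U -> V -> bool) (f : T -> U) (g : T -> V) s :
  all2 r (map f s) (map g s) = all (fun x => r (f x) (g x)) s.
Proof. by elim: s => //= x s ->. Qed.

Lemma factors_typed_nth n Ts Fs i : factors_typed n Ts Fs -> i < size Ts ->
  perm_eq (flatten (nth [::] Fs i)) (iota 0 n) /\
  perm_eq (map size (nth [::] Fs i)) (nth [::] Ts i).
Proof.
elim: Ts Fs i => [|T Ts IH] [|F Fs] [|i] //= [H1 H2 H3] //; exact: IH.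
Qed.

Lemma factors_typed_size n Ts Fs : factors_typed n Ts Fs -> size Fs = size Ts.
Proof. by elim: Ts Fs => [|T Ts IH] [|F Fs] //= [_ _ /IH ->]. Qed.

Section Successor.
Variables (n : nat) (F : seq (seq nat)).
Hypothesis F_span : perm_eq (flatten F) (iota 0 n).
Hypothesis F_size : all (fun c => 2 < size c) F.

Definition successor x := foldr (fun c a => if x \in c then next c x else a) x F.

Lemma flatten_mem x : (x \in flatten F) = (x < n).
Proof. by rewrite (perm_mem F_span) mem_iota. Qed.

Lemma flatten_uniq : uniq (flatten F).
Proof. by rewrite (perm_uniq F_span) iota_uniq. Qed.

Lemma cycle_uniq c : c \in F -> uniq c.
Proof. by apply: uniq_flatten_mem; apply: flatten_uniq. Qed.

Lemma successorE c x : c \in F -> x \in c -> successor x = next c x.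
Proof.
move=> Hc Hx; have := flatten_uniq; rewrite /successor; elim: (F) Hc => //= d Fs IH.
rewrite inE cat_uniq => /orP[/eqP<-|Hc] /and3P[H1 H2 H3]; first by rewrite Hx.
case: ifP => [Hd|_]; last exact: IH.
by case/negP: H2; apply/hasP; exists x => //; apply/flattenP; exists c.
Qed.

Lemma vertex_cycle x : x < n -> exists2 c, c \in F & x \in c.
Proof. by rewrite -flatten_mem => /flattenP [c Hc Hx]; exists c. Qed.

Lemma successor_lt x : x < n -> successor x < n.
Proof.
move=> /vertex_cycle [c Hc Hx]; rewrite (successorE Hc Hx) -flatten_mem.
by apply/flattenP; exists c; rewrite // mem_next.
Qed.

Lemma successor_neq x : x < n -> successor x != x /\ successor (successor x) != x.
Proof.
move=> /vertex_cycle [c Hc Hx]; rewrite (successorE Hc Hx).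
rewrite (successorE Hc); last by rewrite mem_next.
by apply: next_next_neq => //; [apply: cycle_uniq|apply: (allP F_size)].
Qed.

Lemma successor_perm : perm_eq (map successor (iota 0 n)) (iota 0 n).
Proof.
apply: perm_map_iota; last exact: successor_lt.
move=> a b; rewrite !mem_iota !add0n /= => /vertex_cycle [c Hc Ha] /vertex_cycle [d Hd Hb].
rewrite (successorE Hc Ha) (successorE Hd Hb) => E.
have Hbc : next d b \in c by rewrite -E mem_next.
have Ecd : c = d.
  apply/eqP; apply: contraTT flatten_uniq => Ncd; apply/negP.
  elim: (F) Hc Hd => //= e Fs IH; rewrite !inE cat_uniq.
  move=> /orP[/eqP Ec|Hc] /orP[/eqP Ed|Hd] /and3P[H1 H2 H3].
  - by rewrite Ec Ed eqxx in Ncd.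
  - case/negP: H2; apply/hasP; exists (next d b); last by rewrite -Ec.
    by apply/flattenP; exists d; rewrite // mem_next.
  - case/negP: H2; apply/hasP; exists (next d b); last by rewrite -Ed mem_next.
    by apply/flattenP; exists c.
  - exact: IH.
by subst d; apply: (can_inj (prev_next (cycle_uniq Hc))).
Qed.

End Successor.

(** * From layers to a 2-factorization of the multigraph *)

Section Realisation.
Variables n' lam' : nat.
Let n := n'.+2.
Let lam := lam'.+1.
Let G := complete_mgraph lam n.

Lemma first_last_card : #|[set (ord0 : 'I_n); ord_max]| == 2.
Proof. by rewrite cards2. Qed.

(** [insubd] falls back on the edge between the first and the last vertex when the two given
    vertices coincide; that this edge exists is the reason for [n'.+2]. *)
Definition layer_edge x y l : edge G :=
  (insubd (@exist {set 'I_n} (fun e => #|e| == 2) [set ord0; ord_max] first_last_card)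
     [set inord x; inord y], inord l).

Lemma inord_inj x y : x < n -> y < n -> (inord x == inord y :> 'I_n) = (x == y).
Proof. by move=> Hx Hy; rewrite -val_eqE /= !inordK. Qed.

Lemma layer_edge_ends x y l : x < n -> y < n -> x != y ->
  ends (layer_edge x y l) = [set (inord x : 'I_n); inord y].
Proof. by move=> Hx Hy Dxy; rewrite /= insubdK // -topredE /= cards2 inord_inj // Dxy. Qed.

Lemma layer_edgeC x y l : layer_edge x y l = layer_edge y x l.
Proof. by rewrite /layer_edge [in LHS](setUC [set inord x]). Qed.

Lemma layer_edgeP (e : edge G) : exists x y l,
  [/\ x < n, y < n, x != y, l < lam & e = layer_edge x y l].
Proof.
case: e => p l; have /cards2P [a [b [Dab Ep]]] : #|val p| == 2 by apply: valP p.
exists a, b, l; split=> //; congr pair; last by rewrite inord_val.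
by apply: val_inj; rewrite /= !inord_val insubdK // -topredE /= cards2 Dab.
Qed.

Lemma degree_complete (v : 'I_n) : @degree G setT v = lam * n.-1.
Proof.
have -> : @degree G setT v = #|[set layer_edge v wl.1 wl.2 |
    wl : 'I_n * 'I_lam in [set wl : 'I_n * 'I_lam | wl.1 != v]]|.
  apply: eq_card => e; rewrite !inE; apply/idP/imsetP.
    have [x [y [l [Hx Hy Dxy Hl ->]]]] := layer_edgeP e.
    rewrite layer_edge_ends // !inE => /orP[] /eqP Ev.
      exists (inord y, inord l); rewrite ?inE /= ?inordK // Ev ?inordK //.
      by rewrite inord_inj // eq_sym.
    exists (inord x, inord l); rewrite ?inE /= ?inordK // Ev ?inordK //.
      by rewrite inord_inj.
    exact: layer_edgeC.
  case=> -[w l]; rewrite inE => Dw ->; rewrite layer_edge_ends // 1?eq_sym //.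
  by rewrite !inE inord_val eqxx.
rewrite card_in_imset.
  have -> : [set wl : 'I_n * 'I_lam | wl.1 != v] = setX [set~ v] [set: 'I_lam].
    by apply/setP => -[w l]; rewrite !inE andbT.
  by rewrite cardsX cardsT card_ord cardsC1 card_ord mulnC.
move=> [w l] [w' l']; rewrite !inE /= => Dw Dw' E; congr pair; last first.
  by have := congr1 snd E; rewrite /= !inord_val.
have := congr1 (@ends G) E; rewrite !layer_edge_ends ?ltn_ord //; try by rewrite eq_sym.
move/setP/(_ w); rewrite !inE !inord_val eqxx orbT (negbTE Dw) /=.
by move/esym/eqP.
Qed.

Lemma edge_count : 2 * #|edge G| = n * (lam * n.-1).
Proof.
have -> : n * (lam * n.-1) = \sum_(v : vertex G) degree [set: edge G] v.
  by rewrite (eq_bigr _ (fun v _ => degree_complete v)) sum_nat_const card_ord.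
rewrite -cardsT -sum1_card big_distrr /=.
under eq_bigr do rewrite muln1.
have -> : \sum_(v : vertex G) degree [set: edge G] v =
    \sum_(v : vertex G) \sum_(e in [set: edge G]) (v \in ends e).
  by apply: eq_bigr => v _; rewrite /degree -sum1_card big_mkcond [RHS]big_mkcond;
     apply: eq_bigr => e _; rewrite !inE; case: (v \in ends e).
rewrite exchange_big /=; apply: eq_bigr => e _.
rewrite -[LHS](eqP (@card_ends G e)) -sum1_card big_mkcond.
  by apply: eq_bigr => v _; case: (v \in _).
Qed.

Definition factor_edges (F : seq (seq nat)) (s : seq nat) : seq (edge G) :=
  [seq layer_edge x (successor F x) (nth 0 s x) | x <- flatten F].

Definition factor_cycles (F : seq (seq nat)) (s : seq nat) :
    seq (seq (vertex G) * seq (edge G)) :=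
  [seq ([seq inord x | x <- c], [seq layer_edge x (next c x) (nth 0 s x) | x <- c]) | c <- F].

Lemma map_inord_iota : [seq inord x | x <- iota 0 n] = enum 'I_n.
Proof. by rewrite -val_enum_ord -map_comp map_id_in // => x _ /=; rewrite inord_val. Qed.

Lemma degree_seq (es : seq (edge G)) (v : vertex G) : uniq es ->
  degree [set e in es] v = count (fun e => v \in ends e) es.
Proof.
move=> U; rewrite /degree -size_filter -(card_uniqP (filter_uniq _ U)).
by apply: eq_card => e; rewrite !inE mem_filter andbC.
Qed.

Section Factor.
Variables (F : seq (seq nat)) (s : seq nat) (t : seq nat).
Hypothesis F_span : perm_eq (flatten F) (iota 0 n).
Hypothesis F_type : perm_eq (map size F) t.
Hypothesis t_size : all (leq 3) t.
Hypothesis uniq_edges : uniq (factor_edges F s).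

Let F_size : all (fun c => 2 < size c) F.
Proof. by rewrite -(all_map size (leq 3)) (perm_all _ F_type). Qed.

Lemma factor_edges_flatten : factor_edges F s = flatten [seq c.2 | c <- factor_cycles F s].
Proof.
rewrite /factor_edges map_flatten -map_comp; congr flatten; apply/eq_in_map => c Hc /=.
by apply/eq_in_map => x Hx; rewrite (successorE F_span Hc Hx).
Qed.

(** The edges at v are the one leaving v and the one leaving its predecessor. There is one of each,
    [successor] being a permutation, and they differ because it has no fixed point. *)
Lemma factor_is_factor : is_factor 2 [set e in factor_edges F s].
Proof.
apply/forallP => v; rewrite degree_seq // count_map.
pose out := pred1 (val v); pose into := preim (successor F) out.
rewrite (eq_in_count (a2 := predU out into)); last first.
  move=> x; rewrite (perm_mem F_span) mem_iota add0n => Hx.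
  have Hs := successor_lt F_span Hx; have [Ns _] := successor_neq F_span F_size Hx.
  rewrite [LHS](_ : _ = (v \in ends (layer_edge x (successor F x) (nth 0 s x)))) //.
  rewrite layer_edge_ends 1?eq_sym //.
  by rewrite !inE -!val_eqE /= !inordK // ![val v == _]eq_sym.
have one w : perm_eq w (iota 0 n) -> count out w = 1.
  by move/permP->; rewrite count_uniq_mem ?iota_uniq // mem_iota /= ltn_ord.
have := count_predUI out into (flatten F).
rewrite -(count_map (successor F)) !one //; last first.
  by apply: perm_trans (successor_perm F_span); apply: perm_map.
rewrite (eq_in_count (a1 := predI out into) (a2 := pred0)) ?count_pred0 ?addn0 => [->//|x].
rewrite (perm_mem F_span) mem_iota add0n => /(successor_neq F_span F_size) [Ns _] /=.
by apply/negbTE; apply: contra Ns => /andP[/eqP -> /eqP ->].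
Qed.

Lemma factor_has_type : has_type [set e in factor_edges F s] t.
Proof.
exists (factor_cycles F s); split.
- apply/allP => _ /mapP[c Hc ->]; rewrite /is_cycle.
  have Uc : uniq c := cycle_uniq F_span Hc.
  have ltc x : x \in c -> x < n.
    by move=> Hx; rewrite -(flatten_mem F_span); apply/flattenP; exists c.
  have Ui : uniq [seq (inord x : 'I_n) | x <- c].
    rewrite map_inj_in_uniq // => x y /ltc Hx /ltc Hy /eqP; rewrite inord_inj //.
    exact: eqP.
  apply/and4P; split=> //.
  + by rewrite size_map ltnW ?(allP F_size).
  + move: uniq_edges; rewrite factor_edges_flatten => /uniq_flatten_mem; apply.
    by rewrite -map_comp; apply/mapP; exists c.
  rewrite all2_map; apply/allP => x Hx; rewrite next_map_uniq //.
  have Hn : next c x < n by apply: ltc; rewrite mem_next.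
  rewrite layer_edge_ends //; first exact: ltc.
  by rewrite eq_sym; have [] := next_next_neq Uc (allP F_size c Hc) Hx.
- by rewrite -map_comp (eq_map (g := size)) // => c /=; rewrite size_map.
- rewrite -map_comp -map_inord_iota (eq_map (g := map inord)) // -map_flatten.
  exact: perm_map.
- by rewrite factor_edges_flatten.
Qed.

End Factor.

Definition matching_edges (M : seq (nat * nat)) : seq (edge G) :=
  [seq layer_edge e.1 e.2 0 | e <- M].

Lemma matching_is_factor M : perm_eq (pairs_of M) (iota 0 n) -> uniq (matching_edges M) ->
  is_factor 1 [set e in matching_edges M].
Proof.
move=> HM U; apply/forallP => v; rewrite degree_seq //.
have := count_uniq_mem (val v) (iota_uniq 0 n).
rewrite mem_iota add0n ltn_ord -(permP HM) => E; rewrite -[X in _ == X]E count_map.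
have : uniq (pairs_of M) /\ all (gtn n) (pairs_of M).
  by rewrite (perm_uniq HM) (perm_all _ HM) iota_uniq; split=> //; apply/allP => x; rewrite mem_iota.
rewrite /pairs_of; elim: (M) => //= -[a b] M' IH [].
rewrite inE negb_or => /and3P[/andP[Dab _] _ U'] /and3P[Ha Hb H'].
rewrite (eqP (IH (conj U' H'))).
rewrite -[v \in _]/(v \in ends (layer_edge a b 0)) layer_edge_ends // !inE -!val_eqE /= !inordK // ![val v == _]eq_sym.
have E2 (w : nat) : (a == w) || (b == w) = (a == w) + (b == w) :> nat.
  by move: Dab => /= Dab; case: (a =P w) => [Ea|]; case: (b =P w) => [Eb|] //; rewrite Ea Eb eqxx in Dab.
by rewrite addnA eqn_add2r; apply/eqP; apply: E2.
Qed.

Lemma count_flatten_nth (T : eqType) (x : T) (ss : seq (seq T)) m : size ss = m ->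
  count_mem x (flatten ss) = \sum_(i < m) count_mem x (nth [::] ss i).
Proof.
by move=> <-; rewrite count_flatten sumnE big_map (big_nth [::]) big_mkord.
Qed.

Lemma size_pairs_of M : size (pairs_of M) = 2 * size M.
Proof. by rewrite /pairs_of; elim: M => //= e M ->; rewrite mulnS. Qed.

(* As many edges are used as there are in the graph, so covering every edge
   means covering it exactly once. *)
Lemma layered_2factorization TT : ~~ odd n -> size TT = (lam * n.-1)./2 ->
  all (all (leq 3)) TT -> layered lam n TT -> has_2factorization G TT.
Proof.
move=> ne HTT H3 [M [Fs [HM HF Hlt HC]]].
pose es := [seq factor_edges F.1 F.2 | F <- Fs].
pose J := if odd lam then matching_edges M else [::].
have SFs : size Fs = size TT by rewrite -(factors_typed_size HF) size_map.
have Ses : size (flatten es ++ J) = #|edge G|.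
  apply: double_inj; rewrite -!mul2n edge_count size_cat mulnDr.
  have -> : size (flatten es) = size TT * n.
    rewrite -SFs size_flatten /shape /es -map_comp; elim: (Fs) (TT) HF => [|F Fs' IH] [|T Ts] //=.
    by move=> [H1 _ /IH ->]; rewrite size_map (perm_size H1) /= size_iota.
  have SM : 2 * size M = n by rewrite -size_pairs_of (perm_size HM) size_iota.
  have -> : 2 * size J = odd lam * n.
    by rewrite /J; case: (odd lam); rewrite ?size_map ?SM ?mul1n.
  have : odd (lam * n.-1) = odd lam by rewrite oddM; clear -ne; lia.
  rewrite HTT => Ho; rewrite -{2}(odd_double_half (lam * n.-1)) Ho -mul2n.
  by rewrite mulnDr mulnA -mulnDl mulnC [in RHS]addnC mulnDr.
have sub : {subset enum (edge G) <= flatten es ++ J}.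
  move=> e _; have [x [y [l [Hx Hy Dxy Hl ->]]]] := layer_edgeP e.
  rewrite mem_cat; case: (HC x y l Hx Hy Dxy Hl) => [[Ho [-> H]]|[F HF' [c Hc H]]]; apply/orP.
    right; rewrite /J Ho; case: H => H; last rewrite layer_edgeC.
      exact: (map_f (fun e : nat * nat => layer_edge e.1 e.2 0) H).
    exact: (map_f (fun e : nat * nat => layer_edge e.1 e.2 0) H).
  left; apply/flattenP; exists (factor_edges F.1 F.2); first exact: (map_f (fun F => factor_edges F.1 F.2)).
  have F_span : perm_eq (flatten F.1) (iota 0 n).
    have /(nthP [::]) [i Hi E] := map_f fst HF'.
    rewrite -E; apply: (factors_typed_nth HF _).1; rewrite -SFs; move: Hi; by rewrite size_map.
  have Uc := cycle_uniq F_span Hc.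
  wlog H' : x y Hx Hy Dxy H / cadj c x y /\ nth 0 F.2 x = l.
    case: (H) => H'; first by apply.
    by rewrite layer_edgeC; apply=> //; [rewrite eq_sym|left].
  case: H' => /(cadj_next Uc) [Hxc _ <-] <-; apply/mapP; exists x.
    by rewrite (flatten_mem F_span).
  by rewrite (successorE F_span Hc Hxc).
have Ues : uniq (flatten es ++ J).
  by apply: (leq_size_uniq (enum_uniq (edge G)) sub); rewrite Ses cardE.
have cover e : count_mem e (flatten es ++ J) = 1.
  by rewrite count_uniq_mem // sub // mem_enum.
have [Ues1 UJ] : uniq (flatten es) /\ uniq J by move: Ues; rewrite cat_uniq => /and3P[].
have Ue i : uniq (nth [::] es i).
  have [Hi|Hi] := ltnP i (size es); last by rewrite nth_default.
  exact: uniq_flatten_mem Ues1 (mem_nth _ Hi).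
exists (lam * n.-1); split=> //; first by apply/forallP => v; rewrite degree_complete.
exists (fun i => [set e in nth [::] es i]), [set e in J]; split.
- move=> i; have Hi : i < size Fs by rewrite SFs.
  have [HF1 HF2] := factors_typed_nth HF (ltn_ord i).
  have Ui := Ue i; rewrite (nth_map ([::], [::])) // in Ui *.
  rewrite (nth_map ([::], [::])) // in HF1 HF2.
  have H3i : all (leq 3) (nth [::] TT i) by apply: (allP H3); apply: mem_nth.
  by split; [apply: factor_is_factor HF1 HF2 H3i Ui|apply: factor_has_type HF1 HF2 H3i Ui].
- have -> : odd (lam * n.-1) = odd lam by rewrite oddM; clear -ne; lia.
  rewrite /J in UJ *; case: (odd lam) UJ => UJ; first exact: matching_is_factor.
  by apply/eqP/setP => e; rewrite !inE.
move=> e; rewrite -(cover e) count_cat (@count_flatten_nth _ _ _ (size TT)) ?size_map //.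
by rewrite inE count_uniq_mem //; congr (_ + _); apply: eq_bigr => i _; rewrite inE count_uniq_mem.
Qed.

End Realisation.

(** * Regrouping the types into singles, pairs and triples *)

Lemma perm_eq_count (T : eqType) (s1 s2 : seq T) :
  (forall x, count_mem x s1 = count_mem x s2) -> perm_eq s1 s2.
Proof. by move=> H; apply/allP => x _; apply/eqP. Qed.

(** Each entry of [alpha] turns into a block of that many equal types; the refinement tells which
    type the block repeats. *)
Lemma refinement_blocks (s : nat) (T : 'I_s -> seq nat) (beta : 'I_s -> nat) alpha :
  refinement alpha [seq beta i | i <- enum 'I_s] ->
  exists bs : seq (nat * seq nat),
    [/\ perm_eq (map fst bs) alpha, forall b, b \in bs -> exists i, b.2 = T i &
        perm_eq (flatten [seq nseq b.1 b.2 | b <- bs]) (repeat_types T beta)].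
Proof.
(* The list is generalized to [x] because the index type ['I_(size x)] has to be cast to ['I_s]. *)
have Ebeta (x : seq nat) : x = [seq beta i | i <- enum 'I_s] -> refinement alpha x ->
    exists P : 'I_s -> {set 'I_(size alpha)},
      (forall j, exists! i, j \in P i) /\ forall i, \sum_(j in P i) nth 0 alpha j = beta i.
  move=> Ex [_ _ [P [P1 P2]]].
  have Es : s = size x by rewrite Ex size_map size_enum_ord.
  exists (fun i => P (cast_ord Es i)); split=> [j|i].
    have [i [Hi Ui]] := P1 j; exists (cast_ord (esym Es) i); split=> [|i' Hi']; first by rewrite /= cast_ordKV.
    by rewrite (Ui _ Hi') cast_ordK.
  by rewrite P2 -[nat_of_ord (cast_ord _ _)]/(nat_of_ord i) [X in nth _ X]Ex (nth_map i) ?size_enum_ord // nth_ord_enum.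
case/(Ebeta _ erefl) => P [P1 P2] {Ebeta}.
exists (flatten [seq [seq (nth 0 alpha j, T i) | j : 'I_(size alpha) <- enum (P i)] | i <- enum 'I_s]).
split.
- rewrite map_flatten -map_comp (eq_map (g := fun i => map (fun j : 'I_(size alpha) => nth 0 alpha j) (enum (P i)))); last first.
    by move=> i /=; rewrite -map_comp.
  have Ea : map (fun j : 'I_(size alpha) => nth 0 alpha j) (enum 'I_(size alpha)) = alpha.
    by rewrite (map_comp (nth 0 alpha) val) val_enum_ord map_nth_iota0 ?take_size.
  rewrite -[X in perm_eq _ X]Ea (map_comp (map (fun j : 'I_(size alpha) => nth 0 alpha j)) (fun i => enum (P i))) -map_flatten.
  apply: perm_map; apply: perm_eq_count => j.
  rewrite [RHS]count_uniq_mem ?enum_uniq // mem_enum count_flatten -map_comp sumnE big_map big_enum /=.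
  have [i [Hi Ui]] := P1 j; rewrite (bigD1 i) //= count_uniq_mem ?enum_uniq // mem_enum Hi big1 //.
  move=> i' Ni; rewrite count_uniq_mem ?enum_uniq // mem_enum.
  by case: (boolP (j \in P i')) => // /Ui E; rewrite E eqxx in Ni.
- by move=> b /flattenP [_ /mapP[i _ ->] /mapP[j _ ->]]; exists i.
have -> : repeat_types T beta =
    flatten [seq flatten [seq nseq (nth 0 alpha j) (T i) | j : 'I_(size alpha) <- enum (P i)] | i <- enum 'I_s].
  congr flatten; apply/eq_in_map => i _; rewrite -P2 -big_enum /=.
  by elim: (enum (P i)) => [|j r IH]; rewrite ?big_nil // big_cons nseqD IH.
rewrite map_flatten -map_comp; elim: (enum 'I_s) => //= i r IH.
by rewrite flatten_cat -map_comp perm_cat.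
Qed.

Definition copies (T : Type) k (P : seq T) := flatten [seq nseq k x | x <- P].
Arguments copies [T] k P : simpl never.

Lemma copies_cat (T : Type) k (P Q : seq T) : copies k (P ++ Q) = copies k P ++ copies k Q.
Proof. by rewrite /copies map_cat flatten_cat. Qed.

Lemma copies_nseq (T : Type) k m (x : T) : copies k (nseq m x) = nseq (k * m) x.
Proof. by elim: m => [|m IH]; rewrite ?muln0 // mulnS nseqD -IH. Qed.

Lemma size_copies (T : Type) k (P : seq T) : size (copies k P) = k * size P.
Proof. by elim: P => [|x P IH]; rewrite ?muln0 // /copies /= size_cat size_nseq IH mulnS. Qed.

(** Greedily, the first [q] blocks of odd size at least 3 are cut into one triple and pairs, all
    others into pairs and, for odd size, one single. *)
Lemma blocks_regroup (bs : seq (nat * seq nat)) q :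
  q <= count (fun a => odd a && (3 <= a)) (map fst bs) ->
  exists singles pairs triples,
    [/\ perm_eq (flatten [seq nseq b.1 b.2 | b <- bs])
          (singles ++ copies 2 pairs ++ copies 3 triples),
        size triples = q, size singles + q = count odd (map fst bs) &
        {subset singles ++ pairs ++ triples <= map snd bs}].
Proof.
elim: bs q => [|[a t] bs IH] q /=; first by rewrite leqn0 => /eqP->; exists [::], [::], [::].
move=> Hq; case: (boolP ((0 < q) && (odd a && (2 < a)))) => [/and3P[q0 oa a3]|C].
  have [|S [P [Q [H1 H2 H3 H4]]]] := IH q.-1; first by move: Hq; rewrite oa a3 /=; clear; lia.
  have Ea : a = 2 * (a - 3)./2 + 3 by clear -oa a3; lia.
  exists S, (nseq (a - 3)./2 t ++ P), (nseq 1 t ++ Q); split=> [||/=|].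
  - apply/permP => p; rewrite !count_cat (permP H1) !count_cat !copies_cat !count_cat.
    by rewrite !copies_nseq !count_nseq {1}Ea mulnDr; ring.
  - by rewrite /= H2 prednK.
  - by rewrite oa -H3 -{1}(prednK q0) addnS.
  move=> x; rewrite !mem_cat !inE => H; case: (x =P t) => //= Nx.
  apply: H4; rewrite !mem_cat; move: H; rewrite !mem_nseq.
  by case: (x =P t) => // _; rewrite !andbF.
have [|S [P [Q [H1 H2 H3 H4]]]] := IH q.
  case: (posnP q) => [->|q0] //; rewrite q0 /= in C.
  by rewrite (negbTE C) in Hq.
exists (nseq (odd a) t ++ S), (nseq a./2 t ++ P), Q; split=> //.
- apply/permP => p; rewrite !count_cat (permP H1) !count_cat copies_cat !count_cat.
  by rewrite !copies_nseq !count_nseq -{1}(odd_double_half a) -mul2n; ring.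
- by rewrite size_cat size_nseq -addnA H3.
move=> x; rewrite !mem_cat !inE => H; case: (x =P t) => //= Nx.
apply: H4; rewrite !mem_cat; move: H; rewrite !mem_nseq.
by case: (x =P t) => // _; rewrite !andbF.
Qed.

(** If there are too few singles, the [size P - d] pairs in excess are broken into two singles
    each. *)
Lemma rebalance (T : eqType) (S P : seq T) c d :
  size S <= c -> size S + 2 * size P = c + 2 * d ->
  exists S' P', [/\ perm_eq (S' ++ copies 2 P') (S ++ copies 2 P), size S' = c, size P' = d &
    {subset S' ++ P' <= S ++ P}].
Proof.
move=> Hc Hd; exists (S ++ copies 2 (take (size P - d) P)), (drop (size P - d) P); split.
- by rewrite -catA -copies_cat cat_take_drop.
- rewrite size_cat size_copies size_takel ?leq_subr //.
  by clear -Hc Hd; lia.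
- by rewrite size_drop; clear -Hc Hd; lia.
move=> x; rewrite !mem_cat -orbA => /or3P[->//|H|/mem_drop->]; last by rewrite orbT.
case/flattenP: H => _ /mapP[y /mem_take Hy ->]; rewrite mem_nseq => /andP[_ /eqP->].
by rewrite Hy orbT.
Qed.

Definition splittable n W := exists2 M, perm_eq (pairs_of M) (iota 0 n) & splits n M W.

(** Layers are taken two at a time, and the left-over 1-factors of such a couple serve one entry of
    [G]. If the number of layers is odd, the remaining one keeps its 1-factor. *)
Lemma layered_single n G Ws : ~~ odd n -> all (two_factor_type n) G -> size G = (size Ws)./2 ->
  (forall W, W \in Ws -> splittable n W) -> layered (size Ws) n (G ++ flatten Ws).
Proof.
move=> ne; elim: G Ws => [|T G IH] [|W1 [|W2 Ws]] //=.
- move=> _ _ _; apply: (@layered0 n [seq (0 + 2 * i, 0 + (2 * i).+1) | i <- iota 0 n./2]).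
  by rewrite consecutive_pairs; have -> : 2 * n./2 = n by lia.
- move=> _ _ /(_ W1 (mem_head _ _)) [M HM HS]; rewrite cats0.
  exact: layered1 HM HS.
move=> /andP[HT HG] [HS] H.
have [M1 HM1 HS1] := H W1 (mem_head _ _).
have [M2 HM2 HS2] : splittable n W2 by apply: H; rewrite !inE eqxx orbT.
have HL : layered (size Ws) n (G ++ flatten Ws).
  by apply: IH => // W HW; apply: H; rewrite !inE HW !orbT.
apply: layered_perm (layered_step ne HT HM1 HM2 HS1 HS2 HL).
by apply/permP => p; rewrite /= !count_cat; lia.
Qed.

Lemma odd_layers k lam P : size P = lam * k -> all (two_factor_type (2 * (2 * k).+1)) P ->
  exists Ws, [/\ size Ws = lam, forall W, W \in Ws -> splittable (2 * (2 * k).+1) W &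
    flatten Ws = copies 2 P].
Proof.
elim: lam P => [|lam IH] P.
  by rewrite mul0n => /size0nil -> _; exists [::].
rewrite mulSn -{2 3}(cat_take_drop k P) all_cat => HP /andP[HT HD].
have [|Ws [H1 H2 H3]] := IH _ _ HD; first by rewrite size_drop HP addKn.
have [|M [HM HS]] := splits_odd _ HT; first by rewrite size_takel // HP leq_addr.
exists (copies 2 (take k P) :: Ws); split=> /= [|W|]; first by rewrite H1.
  by rewrite inE => /orP[/eqP->|/H2 //]; exists M.
by rewrite copies_cat H3.
Qed.

Lemma even_layers k Q P : size P = size Q * k -> all (two_factor_type (2 * (2 * k.+1).+2)) (Q ++ P) ->
  exists Ws, [/\ size Ws = size Q, forall W, W \in Ws -> splittable (2 * (2 * k.+1).+2) W &
    perm_eq (flatten Ws) (copies 3 Q ++ copies 2 P)].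
Proof.
elim: Q P => [|T Q IH] P; first by rewrite mul0n => /size0nil -> _; exists [::].
rewrite [size (T :: Q)]/= mulSn -{2 3}(cat_take_drop k P) !all_cat [all _ (T :: Q)]/= -andbA => HP /and4P[HTT HQ HT HD].
have [||Ws [H1 H2 H3]] := IH (drop k P); first by rewrite size_drop HP addKn.
  by rewrite all_cat HQ.
have [|||M [HM HS]] := @splits_even k.+1 T (take k P) => //.
- by rewrite size_takel // HP leq_addr.
- by rewrite /= HTT.
exists ((nseq 3 T ++ copies 2 (take k P)) :: Ws); split=> [|W|]; first by rewrite /= H1.
  by rewrite inE => /orP[/eqP->|/H2 //]; exists M.
rewrite -[T :: Q]/(nseq 1 T ++ Q) !copies_cat copies_nseq -!catA.
rewrite -[flatten _]/((nseq 3 T ++ copies 2 (take k P)) ++ flatten Ws) -catA muln1.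
rewrite perm_cat2l; apply/permP => p.
by rewrite !count_cat (permP H3) !count_cat addnCA.
Qed.

Theorem theorem9p4 (n lam s : nat) (T : 'I_s -> seq nat) (beta : 'I_s -> nat)
  (n_gt0 : 0 < n) (n_even : ~~ odd n) (lam_gt0 : 0 < lam)
  (TT_admissible : admissible_2factorization_type lam n (repeat_types T beta))
  (TT_bipartite : bipartite_2factorization_type (repeat_types T beta))
  (T_admissible : forall i,
     admissible_2factor_type 1 n (T i) /\ bipartite_2factor_type (T i))
  (alpha_ex : exists alpha : seq nat,
     refinement alpha [seq beta i | i <- enum 'I_s] /\
     ((n = 2 %[mod 4] /\ count odd alpha <= lam./2) \/
      [/\ n = 0 %[mod 4],
          count odd alpha <= lam + lam./2 &
          lam <= count (fun a => odd a && (3 <= a)) alpha])) :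
  has_2factorization (complete_mgraph lam n) (repeat_types T beta).
Proof.
have HTT : size (repeat_types T beta) = (lam * n.-1)./2.
  by case/andP: TT_admissible => /eqP.
have H3 : all (all (leq 3)) (repeat_types T beta).
  apply/allP => t /flattenP [_ /mapP[i _ ->]]; rewrite mem_nseq => /andP[_ /eqP ->].
  by have [/andP[]] := T_admissible i.
suff HL : layered lam n (repeat_types T beta).
  case: lam n lam_gt0 n_gt0 n_even HTT HL {TT_admissible alpha_ex T_admissible}
    => [|lam'] // [|[|n']] // _ _ ne HTT HL.
  exact: layered_2factorization.
case: alpha_ex => alpha [Hr Halpha].
have [bs [Hbs1 Hbs2 Hbs3]] := refinement_blocks T Hr.
have two_type t : t \in map snd bs -> two_factor_type n t.
  case/mapP => b /Hbs2 [i ->] ->; have [/andP[H1 H2] H4] := T_admissible i.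
  apply/and3P; split=> //; apply/allP => x Hx.
  by have /= := allP H1 x Hx; have /= := allP H4 x Hx; clear; lia.
have regroup q : q <= count (fun a => odd a && (3 <= a)) alpha -> exists S P Q,
    [/\ perm_eq (repeat_types T beta) (S ++ copies 2 P ++ copies 3 Q), size Q = q,
      size S + q = count odd alpha & all (two_factor_type n) (S ++ P ++ Q)].
  rewrite -!(permP Hbs1) => /blocks_regroup [S [P [Q [K1 K2 K3 K4]]]]; exists S, P, Q.
  split=> //; first by rewrite -(permPl Hbs3).
  by apply/allP => t /K4 /two_type.
case: Halpha => [[n2 Ho]|[n0 Ho H3a]].
  have [k En] : exists k, n = 2 * (2 * k).+1 by [exists (n %/ 4); clear -n2; lia].
  have [S [P [Q [K1 /size0nil EQ K3 K4]]]] := regroup 0 isT; subst Q.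
  rewrite [copies 3 _](_ : _ = [::]) // cats0 in K1; rewrite addn0 in K3.
  have HS : size S <= lam./2 by rewrite K3.
  (* The targets are one single for each couple of layers and, in each layer, one pair for each of
     the [k] Hamilton cycles. *)
  have [|S' [P' [L1 L2 L3 L4]]] := @rebalance _ S P lam./2 (lam * k) HS.
    have := perm_size K1; rewrite HTT size_cat size_copies En.
    have -> : lam * (2 * (2 * k).+1).-1 = lam + 2 * (2 * (lam * k)).
      by rewrite (_ : _.-1 = (2 * (2 * k)).+1); [ring|clear; lia].
    by clear; lia.
  have [HS' HP'] : all (two_factor_type n) S' /\ all (two_factor_type n) P'.
    rewrite cats0 in K4; apply/andP; rewrite -all_cat; apply/allP => t /L4.
    exact: (allP K4).
  rewrite En in HP'; have [Ws [M1 M2 M3]] := odd_layers L3 HP'; rewrite -En in M2.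
  rewrite -M1; apply: (@layered_perm _ _ (S' ++ flatten Ws)); last first.
    by apply: layered_single => //; rewrite M1.
  by rewrite M3 (permPl L1) perm_sym.
have [k En] : exists k, n = 2 * (2 * k).+2 by [exists (n %/ 4).-1; clear -n0 n_gt0; lia].
have [S [P [Q [K1 K2 K3 K4]]]] := regroup lam H3a.
have HS : size S <= lam./2 by move: K3 Ho; clear; lia.
have Hsize : size S + 2 * size P + lam * 3 = lam * (2 * k).+1 + lam./2.
  have := perm_size K1; rewrite HTT !size_cat !size_copies K2 En.
  have -> : lam * (2 * (2 * k).+2).-1 = lam + 2 * (lam * (2 * k).+1).
    by rewrite (_ : _.-1 = (2 * (2 * k).+1).+1); [ring|clear; lia].
  by clear; lia.
(* For [n = 4] the hypotheses conflict: the triples alone ask for [lam * 3] 2-factors, and there are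
   only [lam + lam./2]. *)
case: k En Hsize => [|k] En Hsize; first by move: Hsize lam_gt0; clear; lia.
(* Besides its triple, each layer takes [k] pairs, one for each Hamilton cycle outside the
   ladder. *)
have [|S' [P' [L1 L2 L3 L4]]] := @rebalance _ S P lam./2 (lam * k) HS.
  have E : lam * (2 * k.+1).+1 = lam * 3 + 2 * (lam * k) by ring.
  by move: Hsize; rewrite E; clear; lia.
have [HS' HP'] : all (two_factor_type n) S' /\ all (two_factor_type n) (Q ++ P').
  move: K4; rewrite !all_cat => /and3P[A1 A2 A3].
  have : all (two_factor_type n) (S' ++ P').
    by apply/allP => t /L4 Ht; apply: (allP (_ : all _ (S ++ P))) Ht; rewrite all_cat A1.
  by rewrite all_cat => /andP[-> ->]; rewrite A3.
rewrite En in HP'; rewrite -K2 in L3.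
have [Ws [M1 M2 M3]] := even_layers L3 HP'; rewrite -En K2 in M1 M2.
rewrite -M1; apply: (@layered_perm _ _ (S' ++ flatten Ws)); last first.
  by apply: layered_single => //; rewrite M1.
apply/permP => p; rewrite (permP K1) !count_cat (permP M3) !count_cat.
have := permP L1 p; rewrite !count_cat => E; rewrite addnCA E.
by rewrite addnC -addnA.
Qed.
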